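(* Consider the one-dimensional Darcy equation $f'u_f'+fu_f''=h$ on $(0,1)$, $u_f=g$ on $\{0,1\}$, with the prior on $v=u_f'$ described in the context. Let $H(x)=\int_0^xh(s)\,ds$. Suppose $\|H\|_\infty<\infty$, $u_{f_0}'\in G^\beta$ for $\beta>1/2$, and $\inf_{0<x<1}u_{f_0}'(x)>0$. (i) For any $\delta$ with $\alpha\wedge\beta>\delta>1/2$, the contraction rate of the posterior distribution of $f$ to $f_0$ relative to the $\|\cdot\|_\infty$-norm is (at least) $n^{-(\alpha\wedge\beta-\delta)/(1+2\alpha+2)}$. (ii) If $f(0)=0$ and $\alpha\wedge\beta>1/2$, then the contraction rate of the posterior distribution of $f$ to $f_0$ relative to the $L_2$-norm is $n^{-(\alpha\wedge\beta)/(1+2\alpha+2)}$.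
   Context: $h:(0,1)\to\mathbb R$ and $g:\{0,1\}\to\mathbb R$ are given, and the value $f(0)$ (equal to $f_0(0)$ for the true function $f_0$) is assumed known. The solution map is $f=e(u_f')$ with $e(v)(x)=\frac{H(x)+f(0)v(0)}{v(x)}$ (used for positive $v$). Let $\tilde g(x)=g(0)+(g(1)-g(0))x$ and $Kv(x)=\int_0^xv(s)\,ds-x\int_0^1v(s)\,ds$; then $u_f=Ku_f'+\tilde g$. White noise model: one observes $Y_n(\phi)=\langle\phi,u_f\rangle_{L_2}+n^{-1/2}\dot{\mathbb W}(\phi)$, $\phi\in L_2(0,1)$, with $\dot{\mathbb W}$ mean-zero Gaussian with covariance $\langle\phi_1,\phi_2\rangle_{L_2}$; $\tilde Y_n=Y_n-\tilde g$. The posterior distribution of $f$ is the law of $e(v)$ when $v$ follows its posterior distribution in the linear model $\tilde Y_n=Kv+n^{-1/2}\dot{\mathbb W}$. The eigenfunctions of $K^\top K$ are $h_0=1$ (eigenvalue $0$) and $h_i(x)=\sqrt2\cos(\pi ix)$ with eigenvalues $1/(\pi i)^2$, $i\in\mathbb N=\{1,2,\dots\}$. The prior on $v$ is the law of $\tilde g'+\sum_{i\in\mathbb N}v_ih_i$ with independent $v_i\sim N(0,i^{-1-2\alpha})$, for fixed $\alpha$. $(G^s)$ is the scale generated by this eigenexpansion: $v\in G^\beta$ if $v=\sum_{i\ge0}v_ih_i\in L_2(0,1)$ with $\sum_{i\ge1}i^{2\beta}v_i^2<\infty$. The posterior has contraction rate $\epsilon_n$ to $f_0$ relative to a norm if for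 every $M_n\to\infty$ the posterior probability of $\{f:\|f-f_0\|\ge M_n\epsilon_n\}$ tends to $0$ in probability under $f_0$. *)

(* Defs.v *)
From HB Require Import structures.
From mathcomp Require Import all_boot all_order all_algebra.
From mathcomp Require Import all_classical all_reals all_analysis.

Set Implicit Arguments.
Unset Strict Implicit.
Unset Printing Implicit Defensive.
Import Order.TTheory GRing.Theory Num.Theory.
Import numFieldNormedType.Exports.
Local Open Scope classical_set_scope.
Local Open Scope ring_scope.

(** * Functions on (0,1), represented by functions R -> R whose values outside
    (0,1) (or [0,1]) are irrelevant *)

Definition inner (R : realType) (phi psi : R -> R) : R :=
  \int[lebesgue_measure]_(x in `]0, 1[) (phi x * psi x).

Definition L2norm (R : realType) (f : R -> R) : \bar R :=
  Lnorm lebesgue_measure 2%:E ((EFin \o f) \_ `]0, 1[).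

Definition supnorm (R : realType) (f : R -> R) : \bar R :=
  ereal_sup [set (`|f x|)%:E | x in `]0, 1[].

Definition L2 (R : realType) (f : R -> R) : Prop :=
  measurable_fun (`]0, 1[ : set R) f /\ (L2norm f < +oo)%E.

Definition L2fun (R : realType) := {phi : R -> R | L2 phi}.

Definition hbasis (R : realType) (i : nat) (x : R) : R :=
  if i is 0 then 1 else Num.sqrt 2 * cos (pi * i%:R * x).

(* The equality v = \sum_i c_i h_i is convergence in L2(0,1). *)
Definition in_scale (R : realType) (beta : R) (v : R -> R) : Prop :=
  L2 v /\ exists c : nat -> R,
    L2norm (fun x => v x - \sum_(0 <= i < n) c i * hbasis i x) @[n --> \oo]
      --> 0%E /\
    (\sum_(1 <= i <oo) (i%:R `^ (2 * beta) * c i ^+ 2)%:E < +oo)%E.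

(** * The Darcy equation *)

(* f' u' + f u'' = h on (0,1) and u = g on {0,1}.  Right-continuity of f at 0
   is what ties the boundary value f 0 to f on (0,1). *)
Record darcy (R : realType) (h g f u : R -> R) : Prop := Darcy {
  darcy_f0 : f x @[x --> 0^'+] --> f 0 ;
  darcy_df : forall x : R, x \in `]0, 1[ -> derivable f x 1 ;
  darcy_cu : {within `[0, 1], continuous u} ;
  darcy_du : forall x : R, x \in `]0, 1[ -> derivable u x 1 ;
  darcy_ddu : forall x : R, x \in `]0, 1[ -> derivable (derive1 u) x 1 ;
  darcy_eq : forall x : R, x \in `]0, 1[ ->
    derive1 f x * derive1 u x + f x * derive1 (derive1 u) x = h x ;
  darcy_u0 : u 0 = g 0 ;
  darcy_u1 : u 1 = g 1 }.

Definition primitive0 (R : realType) (h : R -> R) (x : R) : R :=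
  \int[lebesgue_measure]_(s in `]0, x[) h s.

Definition gtilde (R : realType) (g : R -> R) (x : R) : R :=
  g 0 + (g 1 - g 0) * x.

Definition Kop (R : realType) (v : R -> R) (x : R) : R :=
  \int[lebesgue_measure]_(s in `]0, x[) v s
  - x * \int[lebesgue_measure]_(s in `]0, 1[) v s.

(* The solution map e, with H = primitive0 h and a the known value f(0).  It is
   total (division by 0 yields 0), although only meaningful for positive v. *)
Definition emap (R : realType) (h : R -> R) (a : R) (v : R -> R) (x : R) : R :=
  (primitive0 h x + a * v 0) / v x.

(** * Probability *)

(* Real functions on I with the product of the Borel sigma-algebras. *)
Definition cylinders (I : Type) (R : realType) : set (set (I -> R)) :=
  [set C | exists (i : I) (B : set R), measurable B /\ C = [set w | B (w i)]].

Definition Rprod (I : Type) (R : realType) :=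
  g_sigma_algebraType (@cylinders I R).

Definition has_law (R : realType) d (T : measurableType d)
    (P : probability T R) (X : T -> R) (m : set R -> \bar R) : Prop :=
  measurable_fun setT X /\
  forall B, measurable B -> P (X @^-1` B) = m B.

Definition independent (R : realType) d (T : measurableType d)
    (P : probability T R) (I : eqType) (X : I -> T -> R) : Prop :=
  forall (s : seq I) (B : I -> set R), uniq s ->
    (forall i, measurable (B i)) ->
    P [set w | forall i, i \in s -> B i (X i w)]
    = (\prod_(i <- s) P (X i @^-1` B i))%E.

(* X has law N_k(0, S): it is distributed as L Z, for Z a vector of independent
   standard normal variables (on some probability space) and L a Cholesky
   factor of S, which exists for every positive semidefinite S.  Laws on R^k
   are compared on the rectangles, which determine them.  (The measure
   normal_prob m s has standard deviation s, and is not a Dirac mass when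
   s = 0, hence no definition by one-dimensional projections.) *)
Definition centered_gaussian (R : realType) d (T : measurableType d)
    (P : probability T R) (k : nat) (X : 'I_k -> T -> R) (S : 'M[R]_k) : Prop :=
  (forall i, measurable_fun setT (X i)) /\
  exists L : 'M[R]_k,
    [/\ is_trig_mx L, (forall i, 0 <= L i i) & L *m L^T = S] /\
  exists d' (T' : measurableType d') (P' : probability T' R)
      (Z : 'I_k -> T' -> R),
    [/\ independent P' Z,
        (forall j, has_law P' (Z j) (normal_prob 0 1)) &
        forall B : 'I_k -> set R, (forall i, measurable (B i)) ->
          P [set w | forall i, B i (X i w)]
          = P' [set w | forall i, B i (\sum_j L i j * Z j w)]].

Definition white_noise (R : realType) d (Omega : measurableType d)
    (P : probability Omega R) (W : L2fun R -> Omega -> R) : Prop :=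
  forall (k : nat) (phi : 'I_k -> L2fun R),
    centered_gaussian P (fun i => W (phi i))
      (\matrix_(i, j) inner (sval (phi i)) (sval (phi j))).

(** * The Bayesian model *)

(* The coordinate i of theta is the coefficient of h_(i+1): the coefficient of
   h_0 is not random. *)
Definition vfun (R : realType) (g : R -> R) (theta : Rprod nat R) (x : R) : R :=
  derive1 (gtilde g) x
  + limn (fun n => \sum_(0 <= i < n) theta i * hbasis i.+1 x).

Definition is_prior (R : realType) (alpha : R)
    (Pi : probability (Rprod nat R) R) : Prop :=
  let coord (i : nat) (theta : Rprod nat R) : R := theta i in
  independent Pi coord /\
  forall i, has_law Pi (coord i)
    (normal_prob 0 (Num.sqrt (i.+1%:R `^ (- 1 - 2 * alpha)))).

(* One observation of the white noise model with signal u. *)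
Definition observe (R : realType) d (Omega : measurableType d)
    (W : L2fun R -> Omega -> R) (n : nat) (u : R -> R) (w : Omega) :
    Rprod (L2fun R) R :=
  fun phi => inner (sval phi) u + (Num.sqrt n%:R)^-1 * W phi w.

(* The observation shifted by -gtilde. *)
Definition shift_obs (R : realType) (g : R -> R) (y : Rprod (L2fun R) R) :
    Rprod (L2fun R) R :=
  fun phi => y phi - inner (sval phi) (gtilde g).

(* Q is a version of the conditional law of theta given the observation in
   the model: theta ~ Pi, W a white noise independent of theta, and
   observation K v + n^(-1/2) W, where v = vfun g theta. *)
Definition is_posterior (R : realType) d (Omega : measurableType d)
    (P : probability Omega R) (W : L2fun R -> Omega -> R) (g : R -> R)
    (Pi : probability (Rprod nat R) R) (n : nat)
    (Q : R.-pker Rprod (L2fun R) R ~> Rprod nat R) : Prop :=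
  let Y (tw : Rprod nat R * Omega) := observe W n (Kop (vfun g tw.1)) tw.2 in
  forall (A : set (Rprod nat R)) (B : set (Rprod (L2fun R) R)),
    measurable A -> measurable B ->
    (Pi \x P)%E [set tw | A tw.1 /\ B (Y tw)]
    = (\int[(Pi \x P)%E]_(tw in [set tw | B (Y tw)]) Q (Y tw) A)%E.

(* The posterior law of f at n is the image of Q n (shifted observation) under
   theta |-> emap h (f0 0) (vfun g theta), and the observation has signal u0.
   Outer measures (mu_ext) extend P and Q n y from the measurable sets to all
   sets, so that no measurability of the norms has to be assumed. *)
Definition contraction_rate (R : realType) d (Omega : measurableType d)
    (P : probability Omega R) (W : L2fun R -> Omega -> R) (h g f0 u0 : R -> R)
    (Q : nat -> R.-pker Rprod (L2fun R) R ~> Rprod nat R)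
    (norm : (R -> R) -> \bar R) (eps : nat -> R) : Prop :=
  forall M : nat -> R, M n @[n --> \oo] --> +oo ->
  forall eta : R, 0 < eta ->
    let far n : set (Rprod nat R) :=
      [set theta | ((M n * eps n)%:E <=
        norm (emap h (f0 0%R) (vfun g theta) \- f0)%R)%E] in
    mu_ext P [set w | (eta%:E <=
      mu_ext (Q n (shift_obs g (observe W n u0 w))) (far n))%E]
    @[n --> \oo] --> 0%E.

(* Main.v *)
(* The operator K maps the cosine h_i to a multiple of the sine e_i, so the model
   is a Gaussian sequence model.  Resampling both the coefficient theta_i and the
   noise W(e_i) preserves the joint law of (theta, W); hence the one-dimensional
   Bayes formula identifies, for almost every observation under the marginal law,
   the posterior law of theta_i as a normal law depending on Y(e_i) only.  Almost
   every observation of the true signal is also covered, because translating W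
   by <., f> preserves null sets: this only requires to shift the normal variable
   W(f / |f|).  Summing posterior variances and squared biases with the weights
   i^(2 delta) gives a risk of order n^(-2 (gamma - delta) / (1 + 2 alpha + 2)) with
   gamma = min(alpha, beta), and Markov's inequality for the posterior, then for P,
   turns risks into contraction rates.
   For 2 delta > 1 the weighted l2 norm of the coefficients dominates their l1 norm,
   hence the uniform norm of v - u0'.  As u0' is bounded below, v is then bounded
   below too, and the solution map is Lipschitz at such v; when f0 0 = 0 its error
   at x involves (v - u0')(x) only, so that L2 bounds suffice for the rate.
   Finally f0 u0' = H + f0(0) u0'(0) on (0,1) is the fundamental theorem of calculus
   for f0 u0', whose derivative h exists everywhere but is merely integrable. *)
Require Import Defs.
From HB Require Import structures.
From mathcomp Require Import all_boot all_order all_algebra.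
From mathcomp Require Import all_classical all_reals all_analysis.
From mathcomp Require Import measurable_realfun simple_functions ring lra.

Set Implicit Arguments.
Unset Strict Implicit.
Unset Printing Implicit Defensive.
Import Order.TTheory GRing.Theory Num.Theory.
Import numFieldNormedType.Exports.
Local Open Scope classical_set_scope.
Local Open Scope ring_scope.

(** * Laws on product spaces *)

(** A posterior kernel is determined only up to null sets of the marginal law of the observation,
    yet it is evaluated at observations generated by one fixed parameter, a point without prior
    mass. Identities between kernels are therefore first proved almost everywhere and then
    transported by a translation of the noise. The observation is a process indexed by all of
    L2(0,1). Instead of a density on that space, Bayes' formula is used along a line: with
    everything but theta_i and W(e_i) frozen, the whole observation is an affine function of the
    scalar kappa_i theta_i + tau W(e_i), because signal and noise move in the same direction phi |->
    <phi, e_i>. The exponent 1 + 2 alpha + 2 comes from the index N = n^(1/(1 + 2 alpha + 2)) at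
    which, up to pi^2, the prior variance multiplied by the squared singular value meets the noise
    variance 1/n: the data dominate before N, the prior after it. Two Sobolev indices are kept
    apart: one is used at a fixed radius, to keep v away from 0, and the other measures the error
    itself. *)

Section product_space.
Context (R : realType) (I : eqType).

Definition rectangle (s : seq I) (B : I -> set R) : set (Rprod I R) :=
  [set w | forall i, i \in s -> B i (w i)].

Lemma measurable_coord (i : I) :
  measurable_fun setT (fun w : Rprod I R => w i : R).
Proof.
move=> _ B mB; rewrite setTI; apply: sub_sigma_algebra.
by exists i, B.
Qed.

Lemma measurable_Rprod d (T : measurableType d) (X : T -> Rprod I R) :
  (forall i, measurable_fun setT (fun t => X t i : R)) -> measurable_fun setT X.
Proof.
move=> mX; apply: (@measurability _ _ _ _ _ X (@cylinders I R)) => // _ [_ [i [B [mB ->]]] <-].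
exact: mX.
Qed.

Lemma measurable_rectangle s (B : I -> set R) :
  (forall i, measurable (B i)) -> measurable (rectangle s B).
Proof.
move=> mB; elim: s => [|i s IHs].
  by rewrite [rectangle _ _](_ : _ = setT)// -subTset => w _ i.
rewrite [rectangle _ _](_ : _ = (fun w : Rprod I R => w i) @^-1` B i `&` rectangle s B).
  by apply: measurableI => //; rewrite -[X in measurable X]setTI; exact: measurable_coord.
apply/seteqP; split => w /=.
  move=> Bw; split; first by apply: Bw; rewrite mem_head.
  by move=> j js; apply: Bw; rewrite in_cons js orbT.
by move=> [Bi Bs] j; rewrite in_cons => /orP[/eqP ->|/Bs].
Qed.

(** Rectangles are stable under intersection and generate the product sigma-algebra, so they
    determine a finite measure. Repeated indices are removed by [undup], because independence only
    speaks of duplicate-free lists. *)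
Lemma Rprod_measure_eq (m1 m2 : {measure set (Rprod I R) -> \bar R}) :
  (m1 setT < +oo)%E ->
  (forall s B, uniq s -> (forall i, measurable (B i)) ->
    m1 (rectangle s B) = m2 (rectangle s B)) ->
  forall A, measurable A -> m1 A = m2 A.
Proof.
move=> m1oo m12 A mA.
pose G := [set C | exists s B, (forall i, measurable (B i)) /\ C = rectangle s B].
have rectT : setT = rectangle [::] (fun=> setT) :> set (Rprod I R).
  by apply/esym; rewrite -subTset => w _ i.
apply: (g_sigma_algebra_measure_unique G _ (fun=> setT)).
- by move=> _ [s [B [mB ->]]]; exact: measurable_rectangle.
- by move=> _; exists [::], (fun=> setT); split.
- by rewrite bigcup_const.
- move=> _ _ [s [B [mB ->]]] [s' [B' [mB' ->]]].
  exists (s ++ s'), (fun i => (if i \in s then B i else setT) `&`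
                         (if i \in s' then B' i else setT)); split.
    by move=> i; apply: measurableI; case: ifP.
  apply/seteqP; split=> w /=.
    by move=> [Bw B'w] i _; split; case: ifPn => // ?; [exact: Bw|exact: B'w].
  move=> Bw; split=> i si; have := Bw i; rewrite mem_cat si ?orbT => /(_ isT)[].
    by [].
  by [].
- move=> _ [s [B [mB ->]]].
  have -> : rectangle s B = rectangle (undup s) B.
    by apply/seteqP; split=> w Bw i; [rewrite mem_undup => /Bw|move=> is_; apply: Bw; rewrite mem_undup].
  by apply: m12 => //; exact: undup_uniq.
- by [].
- suff /(_ _ mA) : <<s @cylinders I R >> `<=` <<s G >> by [].
  apply: sub_sigma_algebra2 => _ [i [B [mB ->]]].
  exists [:: i], (fun=> B); split=> //; apply/seteqP; split=> w /=.
    by move=> Bw j; rewrite inE => /eqP ->.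
  by apply; rewrite inE.
Qed.

(** Equality in law across two probability spaces: a measurable functional of a process, even with
    uncountably many indices, only sees the image measure on the product space. Both resampling
    lemmas are instances. *)
Lemma Rprod_integral_eq d1 (T1 : measurableType d1) (P1 : probability T1 R)
    d2 (T2 : measurableType d2) (P2 : probability T2 R)
    (X1 : T1 -> Rprod I R) (X2 : T2 -> Rprod I R) :
  measurable_fun setT X1 -> measurable_fun setT X2 ->
  (forall s B, uniq s -> (forall i, measurable (B i)) ->
    P1 (X1 @^-1` rectangle s B) = P2 (X2 @^-1` rectangle s B)) ->
  forall f : Rprod I R -> \bar R, measurable_fun [set: Rprod I R] f ->
    (forall w, 0 <= f w)%E ->
  (\int[P1]_t f (X1 t) = \int[P2]_t f (X2 t))%E.
Proof.
move=> mX1 mX2 P12 f mf f0.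
have := @ge0_integral_pushforward _ _ _ _ _ _ mX1 P1 setT f measurableT mf (fun y _ => f0 y).
rewrite preimage_setT => <-.
have := @ge0_integral_pushforward _ _ _ _ _ _ mX2 P2 setT f measurableT mf (fun y _ => f0 y).
rewrite preimage_setT => <-.
apply: eq_measure_integral => A mA _.
apply: Rprod_measure_eq => //.
by rewrite /= /pushforward preimage_setT probability_setT ltry.
Qed.

End product_space.

Section resampling.
Context (R : realType) (I : eqType).

Definition upd (x : Rprod I R) (i : I) (t : R) : Rprod I R :=
  fun j => if j == i then t else x j.

Lemma measurable_upd (i : I) :
  measurable_fun setT (fun p : measurableTypeR R * Rprod I R => upd p.2 i p.1).
Proof.
apply: measurable_Rprod => j; rewrite /upd; case: (j == i).
  exact: measurable_fst.
exact: measurableT_comp (measurable_coord j) measurable_snd.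
Qed.

(** In the probability of a rectangle the factor of index [i] splits off from the product, whether
    it is computed from [X i] or from an independent variable of the same law. *)
Lemma independent_resample d (T : measurableType d) (P : probability T R)
    (X : I -> T -> R) (i : I) (m : probability (measurableTypeR R) R) :
  independent P X -> (forall j, measurable_fun setT (X j)) ->
  has_law P (X i) m ->
  forall f : Rprod I R -> \bar R, measurable_fun [set: Rprod I R] f ->
    (forall x, 0 <= f x)%E ->
  (\int[P]_w f (X ^~ w) =
   \int[(m \x P)%E]_p f (upd (X ^~ p.2) i p.1))%E.
Proof.
move=> indX mX [_ lawX].
apply: Rprod_integral_eq.
- exact: measurable_Rprod.
- have mg : measurable_fun setT (fun p : measurableTypeR R * T => (p.1, (X ^~ p.2 : Rprod I R))).
    apply: measurable_fun_pair; first exact: measurable_fst.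
    by apply: measurable_Rprod => j; exact: measurableT_comp (mX j) measurable_snd.
  exact: (measurableT_comp (measurable_upd i) mg).
move=> s B us mB.
(* When the rectangle does not constrain [i], [setT] makes its factor equal to 1, and both cases
   share one product formula. *)
pose C := if i \in s then B i else setT.
have mC : measurable C by rewrite /C; case: ifP.
have usr : uniq (rem i s) by exact: rem_uniq.
have mE : measurable [set w | forall j, j \in rem i s -> B j (X j w)].
  rewrite -[X in measurable X]setTI.
  have := @measurable_Rprod _ I _ T (fun w => X ^~ w) mX measurableT.
  by move=> /(_ _ (measurable_rectangle (rem i s) mB)).
rewrite [X in _ = _ X](_ : _ = C `*` [set w | forall j, j \in rem i s -> B j (X j w)]).
  rewrite [RHS]product_measure1E//.
  transitivity (m C * \prod_(j <- rem i s) P (X j @^-1` B j))%E; last first.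
    by congr (_ * _)%E; exact/esym/(indX _ _ usr mB).
  transitivity (\prod_(j <- s) P (X j @^-1` B j))%E; first exact: indX.
  have [is_|is_] := boolP (i \in s).
    rewrite (perm_big _ (perm_to_rem is_)) big_cons.
    by congr (_ * _)%E; rewrite /C is_ lawX.
  by rewrite rem_id// /C (negbTE is_) [m _]probability_setT mul1e.
apply/seteqP; split => -[t w] /=.
  rewrite /rectangle /upd /= => Bw; split.
    by rewrite /C; case: ifPn => // /Bw; rewrite eqxx.
  move=> j; rewrite mem_rem_uniq// inE => /andP[ji js].
  by have := Bw _ js; rewrite (negbTE ji).
rewrite /rectangle /upd /= => -[Ct Bw] j js; case: ifPn => [/eqP ji|ji].
  by move: Ct; rewrite /C -ji js.
by apply: Bw; rewrite mem_rem_uniq// inE ji.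
Qed.

End resampling.

(** * White noise *)

(** The lists of test functions in rectangles require a decidable equality, taken classically; test
    functions that agree almost everywhere remain distinct indices. *)
HB.instance Definition _ (R : realType) := gen_eqMixin (L2fun R).

Lemma integral_indic_comp d d' (T : measurableType d) (U : measurableType d')
    (R : realType) (m : {measure set T -> \bar R}) (X : T -> U) (A : set U) :
  measurable_fun setT X -> measurable A ->
  (\int[m]_w (\1_A (X w))%:E = m (X @^-1` A))%E.
Proof.
move=> mX mA; rewrite -[X in _ = m X]setIT -integral_indic//.
by rewrite -[X in measurable X]setTI; exact: mX.
Qed.

Section white_noise_resampling.
Context (R : realType) d (Omega : measurableType d) (P : probability Omega R)
  (W : L2fun R -> Omega -> R).
Hypothesis hW : white_noise P W.

Lemma white_noise_measurable phi : measurable_fun setT (W phi).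
Proof. by have [/(_ ord0)] := hW (fun _ : 'I_1 => phi). Qed.

Lemma white_noise_measurableT : measurable_fun setT (fun w => W ^~ w : Rprod (L2fun R) R).
Proof. by apply: measurable_Rprod => phi; exact: white_noise_measurable. Qed.

(* With [e] put first, the Cholesky factor [L] has first row (1, 0, ..., 0), and
   its first column is the covariance of the process with [W e]: replacing the
   first normal variable only moves [W] along this column. *)
Lemma white_noise_resample (e : L2fun R) : inner (sval e) (sval e) = 1 ->
  forall f : Rprod (L2fun R) R -> \bar R,
    measurable_fun [set: Rprod (L2fun R) R] f -> (forall x, 0 <= f x)%E ->
  (\int[P]_w f (W ^~ w) =
   \int[(normal_prob (0 : R) (1 : R) \x P)%E]_p
     f (fun phi => W phi p.2 + inner (sval phi) (sval e) * (p.1 - W e p.2))%R)%E.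
Proof.
move=> e1; apply: Rprod_integral_eq; first exact: white_noise_measurableT.
  apply: measurable_Rprod => phi; apply: measurable_funD.
    exact: measurableT_comp (white_noise_measurable phi) measurable_snd.
  apply: measurable_funM => //; apply: measurable_funB; first exact: measurable_fst.
  exact: measurableT_comp (white_noise_measurable e) measurable_snd.
move=> s B _ mB; set k := size s.
pose phi (j : 'I_k.+1) := nth e (e :: s) j.
have [mX [L [[Ltrig L0 LS] [d' [T' [P' [Z [indZ lawZ XZ]]]]]]]] := hW phi.
have mZ j : measurable_fun setT (Z j) by have [] := lawZ j.
have S0 j : inner (sval (phi j)) (sval e) = L j ord0 * L ord0 ord0.
  have /matrixP/(_ j ord0) := LS; rewrite !mxE => <-.
  rewrite (bigD1 ord0)//= big1 ?addr0 ?mxE// => l l0.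
  by rewrite mxE [L ord0 l](is_trig_mxP Ltrig) ?mulr0// lt0n.
have L00 : L ord0 ord0 = 1.
  apply/eqP; rewrite -(eqrXn2 (n := 2)) ?ler01// ?L0// expr1n.
  by rewrite expr2 -S0 e1.
have {}S0 j : inner (sval (phi j)) (sval e) = L j ord0 by rewrite S0 L00 mulr1.
pose LZ (z : Rprod 'I_k.+1 R) : Rprod 'I_k.+1 R := fun i => \sum_j L i j * z j.
have mLZ : measurable_fun setT LZ.
  apply: measurable_Rprod => i; apply: measurable_sum => j.
  by apply: measurable_funM => //; exact: measurable_coord.
have law f (mf : measurable_fun [set: Rprod 'I_k.+1 R] f) (f0 : forall x, (0 <= f x)%E) :
    (\int[P]_w f (fun i => W (phi i) w) = \int[P']_w f (LZ (Z ^~ w)))%E.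
  move: f mf f0; apply: Rprod_integral_eq.
  - exact: measurable_Rprod.
  - by apply: (measurableT_comp mLZ); exact: measurable_Rprod.
  move=> s' B' _ mB'; pose C i := if i \in s' then B' i else setT.
  have := XZ C; rewrite /C => /(_ _)/wrap[]; first by move=> i; case: ifP.
  have CE (x : Rprod 'I_k.+1 R) : (forall i, C i (x i)) <-> rectangle s' B' x.
    split=> Hx i; first by move=> si; have := Hx i; rewrite /C si.
    by rewrite /C; case: ifPn => // /Hx.
  move=> H; rewrite [LHS](_ : _ = P [set w | forall i, C i (W (phi i) w)]).
    rewrite H; congr (P' _); apply/seteqP; split => w /=; by move/CE.
  by congr (P _); apply/seteqP; split => w /=; move/CE.
(* Index 0 holds the auxiliary function [e]; the event only constrains the other indices, which
   enumerate [s]. *)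
pose A := [set x : Rprod 'I_k.+1 R | forall j, j != ord0 -> B (phi j) (x j)].
have mA : measurable A.
  rewrite (_ : A = rectangle [seq j <- enum 'I_k.+1 | j != ord0] (fun j => B (phi j))).
    exact: measurable_rectangle.
  apply/seteqP; split => x Ax j.
    by rewrite mem_filter => /andP[/Ax].
  by move=> j0; apply: Ax; rewrite mem_filter j0 mem_enum.
have AE (x : Rprod (L2fun R) R) : rectangle s B x <-> A (fun j => x (phi j)).
  split=> [Bx j j0|Ax l ls].
    apply: Bx; rewrite /phi; case: j j0 => -[//|j] jk _ /=.
    exact: mem_nth.
  pose j : 'I_k.+1 := inord (index l s).+1.
  have jE : nat_of_ord j = (index l s).+1 by rewrite inordK// ltnS index_mem.
  have := Ax j; rewrite /phi jE /= nth_index//; apply.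
  by rewrite -val_eqE /= jE.
pose g (x : Rprod 'I_k.+1 R) := (\1_A x)%:E : \bar R.
have mg : measurable_fun [set: Rprod 'I_k.+1 R] g.
  by apply/measurable_EFinP; exact: measurable_indic.
have g0 x : (0 <= g x)%E by rewrite lee_fin.
pose shift (z : R) (x : Rprod 'I_k.+1 R) : Rprod 'I_k.+1 R :=
  fun j => x j + L j ord0 * (z - x ord0).
have mshift : measurable_fun setT (fun p : measurableTypeR R * Rprod 'I_k.+1 R => shift p.1 p.2).
  apply: measurable_Rprod => j; apply: measurable_funD.
    exact: measurableT_comp (measurable_coord j) measurable_snd.
  apply: measurable_funM => //; apply: measurable_funB; first exact: measurable_fst.
  exact: measurableT_comp (measurable_coord ord0) measurable_snd.
have mWphi : measurable_fun setT (fun w => (fun j => W (phi j) w) : Rprod 'I_k.+1 R).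
  exact: measurable_Rprod.
have mZT : measurable_fun setT (fun w => Z ^~ w : Rprod 'I_k.+1 R).
  exact: measurable_Rprod.
transitivity (\int[P]_w g (fun j => W (phi j) w))%E.
  rewrite integral_indic_comp//; congr (P _).
  by apply/seteqP; split => w; [exact: (AE (W ^~ w)).1|exact: (AE (W ^~ w)).2].
rewrite law//.
have := independent_resample indZ mZ (lawZ ord0) (f := g \o LZ).
move=> /(_ (measurableT_comp mg mLZ) (fun x => g0 _)) ->.
have mLZu : measurable_fun setT (fun p : measurableTypeR R * T' => LZ (upd (Z ^~ p.2) ord0 p.1)).
  apply: (measurableT_comp mLZ).
  have mp : measurable_fun setT (fun p : measurableTypeR R * T' => (p.1, Z ^~ p.2 : Rprod 'I_k.+1 R)).
    apply: measurable_fun_pair; first exact: measurable_fst.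
    exact: measurableT_comp mZT measurable_snd.
  exact: (measurableT_comp (measurable_upd ord0) mp).
have mWs : measurable_fun setT (fun p : measurableTypeR R * Omega => shift p.1 (fun j => W (phi j) p.2)).
  have mp : measurable_fun setT (fun p : measurableTypeR R * Omega => (p.1, (fun j => W (phi j) p.2) : Rprod 'I_k.+1 R)).
    apply: measurable_fun_pair; first exact: measurable_fst.
    exact: measurableT_comp mWphi measurable_snd.
  exact: (measurableT_comp mshift mp).
rewrite fubini_tonelli1; [|exact: (measurableT_comp mg mLZu)|by move=> p; exact: g0].
transitivity (\int[normal_prob (0 : R) (1 : R) \x P]_p
  g (shift p.1 (fun j => W (phi j) p.2)))%E; last first.
  rewrite integral_indic_comp//; congr ((_ \x _)%E _).
  apply/seteqP; split => -[z w] /=.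
    by move=> Aw; apply/AE; move: Aw; congr A; apply/funext => j; rewrite /shift S0.
  by move=> /AE; congr A; apply/funext => j; rewrite /shift S0.
rewrite [RHS]fubini_tonelli1; [|exact: (measurableT_comp mg mWs)|by move=> p; exact: g0].
apply: eq_integral => z _; rewrite /fubini_F /=.
rewrite (law (fun x => g (shift z x))) //; last first.
  apply: (measurableT_comp mg).
  have mp : measurable_fun setT (fun x : Rprod 'I_k.+1 R => (z, x)).
    by apply: measurable_fun_pair.
  exact: (measurableT_comp mshift mp).
apply: eq_integral => w _; congr g; apply/funext => j.
have LZ0 : LZ (Z ^~ w) ord0 = Z ord0 w.
  rewrite /LZ (bigD1 ord0)//= L00 mul1r big1 ?addr0// => l l0.
  by rewrite [L ord0 l](is_trig_mxP Ltrig) ?mul0r// lt0n.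
rewrite /shift LZ0 /LZ (bigD1 ord0)//= [in RHS](bigD1 ord0)//= {1}/upd eqxx.
rewrite [X in _ + X = _](eq_bigr (fun l => L j l * Z l w)); last first.
  by move=> l l0; rewrite /upd (negbTE l0).
by ring.
Qed.

End white_noise_resampling.

(** * Mixtures and normal laws *)

Section mixture.
Import HBNNSimple.
Local Open Scope ereal_scope.
Context (R : realType) d d' (Y : measurableType d) (Z : measurableType d')
  (m : {measure set Y -> \bar R}) (k : Y -> {measure set Z -> \bar R})
  (nu : {measure set Z -> \bar R}).
Hypothesis mk : forall A, measurable A -> measurable_fun setT (k ^~ A).
Hypothesis nuE : forall A, measurable A -> nu A = \int[m]_y k y A.

(** True for indicators by [nuE], hence for simple functions, hence for their monotone limits.
    Weighted Dirac masses for [k] will give the density formula, and posterior laws for [k] the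
    disintegration of the joint law. *)
Lemma integral_mixture (f : Z -> \bar R) :
  measurable_fun setT f -> (forall z, 0 <= f z) ->
  \int[nu]_z f z = \int[m]_y \int[k y]_z f z.
Proof.
move=> mf f0; pose g := nnsfun_approx measurableT mf.
have mg (l : {measure set Z -> \bar R}) :
    (\int[l]_z (g n z)%:E @[n --> \oo]) --> \int[l]_z f z.
  rewrite (_ : f = fun z => limn (fun n => (g n z)%:E)); last first.
    by apply/funext => z; apply/esym/cvg_lim => //; exact: cvg_nnsfun_approx.
  apply: cvg_monotone_convergence => //.
  - by move=> i; exact/measurable_EFinP.
  - by move=> i z _; rewrite lee_fin.
  - by move=> z _ i j ij; rewrite lee_fin; exact/lefP/nd_nnsfun_approx.
have sE n : \int[nu]_z (g n z)%:E = \int[m]_y \int[k y]_z (g n z)%:E.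
  rewrite integralT_nnsfun sintegralE.
  under [RHS]eq_integral do rewrite integralT_nnsfun sintegralE.
  rewrite ge0_integral_fsum//.
  - apply: eq_fsbigr => r /[1!inE] -[z _ <-].
    by rewrite nuE// ge0_integralZl_EFin//; exact: mk.
  - by move=> r; apply: measurable_funeM; exact: mk.
  - by move=> r y _; exact: nnsfun_mulemu_ge0.
have /cvg_lim <- // := mg nu.
apply/cvg_lim => //; under eq_cvg do rewrite sE.
rewrite (_ : \int[m]_y \int[k y]_z f z =
  \int[m]_y limn (fun n => \int[k y]_z (g n z)%:E)); last first.
  by apply: eq_integral => y _; apply/esym/cvg_lim => //; exact: mg.
apply: cvg_monotone_convergence => //.
- move=> n; apply: (@measurable_fun_integral_kernel _ _ Y Z R k mk) => [z|].
    by rewrite lee_fin.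
  exact/measurable_EFinP.
- by move=> n y _; apply: integral_ge0 => z _; rewrite lee_fin.
- move=> y _ i j ij; apply: ge0_le_integral => //.
  + by move=> z _; rewrite lee_fin.
  + by apply/measurable_EFinP.
  + by apply/measurable_EFinP.
  + by move=> z _; rewrite lee_fin; exact/lefP/nd_nnsfun_approx.
Qed.

End mixture.

Section density.
Local Open Scope ereal_scope.
Context (R : realType) d (Y : measurableType d).

Lemma ge0_integral_density (m nu : {measure set Y -> \bar R}) (p : Y -> R) :
  measurable_fun setT p -> (forall y, (0 <= p y)%R) ->
  (forall A, measurable A -> nu A = \int[m]_(y in A) (p y)%:E) ->
  forall f, measurable_fun setT f -> (forall y, 0 <= f y) ->
  \int[nu]_y f y = \int[m]_y ((p y)%:E * f y).
Proof.
move=> mp p0 nuE f mf f0.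
(* A measure with density [p] is the mixture of the Dirac masses at [y] with weights [p y]. *)
pose k y : {measure set Y -> \bar R} := mscale (NngNum (p0 y)) \d_y.
have kE y A : k y A = (p y)%:E * (\1_A y)%:E by [].
have mk A : measurable A -> measurable_fun setT (k ^~ A).
  move=> mA; under [X in measurable_fun _ X]eq_fun do rewrite kE -EFinM.
  by apply/measurable_EFinP; apply: measurable_funM.
rewrite (@integral_mixture _ _ _ _ _ m k nu)//.
  apply: eq_integral => y _; rewrite ge0_integral_mscale//.
  by rewrite integral_dirac// diracT mul1e.
move=> A mA; rewrite nuE// integral_mkcond; apply: eq_integral => y _.
by rewrite kE indicE patchE; case: ifP; rewrite ?mule1 ?mule0.
Qed.

End density.

Section normal_integrals.
Context (R : realType).
Local Notation mu := (@lebesgue_measure R).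
Local Notation gauss := (normal_prob (0 : R) (1 : R)).
Implicit Types (f G b : R -> \bar R).
Local Open Scope ereal_scope.

(** The image of Lebesgue measure under x |-> a x + c, multiplied by [a], gives every half-open
    interval its length and is therefore Lebesgue measure. *)
Lemma ge0_integral_affine (a c : R) f : (0 < a)%R ->
  measurable_fun setT f -> (forall x, 0 <= f x) ->
  \int[mu]_x f x = a%:E * \int[mu]_x f (a * x + c)%R.
Proof.
move=> a0 mf f0; pose phi (x : measurableTypeR R) : measurableTypeR R := (a * x + c)%R.
have mphi : measurable_fun setT phi.
  by apply: (@measurable_funD _ _ _ _ (fun x : measurableTypeR R => (a * x)%R) (cst c)) => //; exact: measurable_funM.
have := @ge0_integral_pushforward _ _ _ _ _ _ mphi mu setT f measurableT mf (fun y _ => f0 y).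
rewrite preimage_setT => /= <-.
rewrite -(@ge0_integral_mscale _ _ _ _ _ measurableT (NngNum (ltW a0)))//.
apply: eq_measure_integral => A mA _.
apply: lebesgue_measure_unique => // _ [[x y] _ <-] /=.
change (mu [set` `]x, y]%R] = a%:E * mu (phi @^-1` [set` `]x, y]%R])).
have -> : phi @^-1` [set` `]x, y]%R] = [set` `](x - c) / a, (y - c) / a]%R].
  apply/seteqP; split => t /=; rewrite !in_itv/= /phi.
    by rewrite ltr_pdivrMr// ler_pdivlMr// ltrBlDr lerBrDr [(t * a)%R]mulrC.
  by rewrite ltr_pdivrMr// ler_pdivlMr// ltrBlDr lerBrDr [(t * a)%R]mulrC.
rewrite !lebesgue_measure_itv/= !lte_fin ltr_pM2r ?invr_gt0// ltrD2r.
case: ifPn => _; last by rewrite mule0.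
by rewrite -!EFinB -EFinM; congr EFin; field; rewrite gt_eqF.
Qed.

Lemma ge0_integral_normal (m s : R) f :
  measurable_fun setT f -> (forall x, 0 <= f x) ->
  \int[normal_prob m s]_x f x = \int[mu]_x ((normal_pdf m s x)%:E * f x).
Proof.
move=> mf f0; apply: ge0_integral_density => //.
- exact: measurable_normal_pdf.
- exact: normal_pdf_ge0.
Qed.

Lemma ge0_integral_normal_affine (m s : R) f : (0 < s)%R ->
  measurable_fun setT f -> (forall x, 0 <= f x) ->
  \int[normal_prob m s]_x f x = \int[gauss]_z f (m + s * z)%R.
Proof.
move=> s0 mf f0.
have maff : measurable_fun setT (fun z : R => m + s * z)%R.
  by apply: measurable_funD => //; exact: measurable_funM.
have faff0 z : 0 <= f (m + s * z)%R by [].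
rewrite (ge0_integral_normal m s mf f0).
rewrite [RHS](@ge0_integral_normal 0 1 (fun z => f (m + s * z)%R) (measurableT_comp mf maff) faff0).
rewrite (ge0_integral_affine m s0); first last.
- by move=> x; rewrite mule_ge0// lee_fin normal_pdf_ge0.
- by apply: emeasurable_funM => //; apply/measurable_EFinP; exact: measurable_normal_pdf.
rewrite -ge0_integralZl//; first last.
- by rewrite lee_fin ltW.
- by move=> x _; rewrite mule_ge0// lee_fin normal_pdf_ge0.
- apply: (@measurableT_comp _ _ _ _ _ _ (fun x => (normal_pdf m s x)%:E * f x)).
    by apply: emeasurable_funM => //; apply/measurable_EFinP; exact: measurable_normal_pdf.
  by apply: measurable_funD => //; exact: measurable_funM.
apply: eq_integral => x _; rewrite muleA -EFinM addrC; congr (_%:E * _).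
rewrite !normal_pdfE ?gt_eqF// /normal_fun /normal_peak.
rewrite mulrA; congr (_ * expR _)%R.
  rewrite expr1n mul1r -mulrnAr sqrtrM ?sqr_ge0// sqrtr_sqr gtr0_norm//.
  by field; rewrite !gt_eqF// sqrtr_gt0 pmulrn_lgt0// pi_gt0.
by field; rewrite gt_eqF.
Qed.

(** N(0,1) has the null sets of Lebesgue measure, its density being positive, and these are
    invariant under translation. This one-dimensional fact carries the whole change of measure from
    one signal to another. *)
Lemma normal_shift_null f (c : R) : measurable_fun setT f -> (forall x, 0 <= f x) ->
  \int[gauss]_z f z = 0 -> \int[gauss]_z f (z + c)%R = 0.
Proof.
move=> mf f0; have mp := @measurable_normal_pdf R 0 1.
have p0 x : (0 < normal_pdf (0 : R) 1 x)%R.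
  by rewrite normal_pdfE// mulr_gt0 ?expR_gt0// normal_peak_gt0.
rewrite ge0_integral_normal// => pf0.
have f_null : \int[mu]_x f x = 0.
  have : ae_eq mu setT (fun x => (normal_pdf 0 1 x)%:E * f x) (cst 0).
    apply/ae_eq_integral_abs => //.
      by apply: emeasurable_funM => //; exact/measurable_EFinP.
    rewrite -pf0; apply: eq_integral => x _; rewrite gee0_abs//.
    by rewrite mule_ge0// lee_fin ltW.
  move=> pf_ae; transitivity (\int[mu]_x (cst 0 x : \bar R)); last exact: integral0.
  apply: ge0_ae_eq_integral => //.
  apply: filterS pf_ae => x /(_ Logic.I) /eqP; rewrite mule_eq0 => /orP[|/eqP ->//].
  by rewrite eqe gt_eqF.
have mc : measurable_fun setT (fun z : R => z + c)%R by exact: measurable_funD.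
have mfc := measurableT_comp mf mc.
rewrite ge0_integral_normal//; apply/eqP; rewrite eq_le; apply/andP; split; last first.
  by apply: integral_ge0 => x _; rewrite mule_ge0// lee_fin ltW.
(* On the way back from Lebesgue measure the density only has to be bounded, by its peak. *)
apply: (@le_trans _ _ (\int[mu]_x ((normal_peak 1)%:E * f (x + c)%R))).
  apply: ge0_le_integral => //.
  - by move=> x _; rewrite mule_ge0// lee_fin ltW.
  - by apply: emeasurable_funM => //; exact/measurable_EFinP.
  - exact: measurable_funeM.
  - by move=> x _; apply: lee_wpmul2r => //; rewrite lee_fin normal_pdf_ub.
rewrite ge0_integralZl//; last by rewrite lee_fin normal_peak_ge0.
have fc : \int[mu]_x f (x + c)%R = 0.
  rewrite -f_null (ge0_integral_affine c ltr01 mf f0) mul1e.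
  by apply: eq_integral => x _; rewrite mul1r.
by rewrite fc mule0.
Qed.

(* Only the finiteness of the second moment of N(0,1) matters for the rates. *)
Lemma normal_second_moment_lty : \int[gauss]_z (z ^+ 2)%:E < +oo.
Proof.
have msqr : measurable_fun setT (fun z : R => (z ^+ 2)%:E).
  by apply/measurable_EFinP; exact: measurable_funX.
rewrite ge0_integral_normal//; last by move=> z; rewrite lee_fin sqr_ge0.
(* Domination by the density of N(0,4): x^2 exp(-x^2/2) is exp(-x^2/8) times x^2 exp(-3x^2/8), and
   exp(t) >= 1 + t at t = 3x^2/8 bounds the latter by 8/3. The quotient of the peaks adjusts the
   normalisations. *)
pose K : R := (8 / 3 * (normal_peak 1 / normal_peak 2))%R.
have K0 : (0 <= K)%R by rewrite !mulr_ge0 ?invr_ge0 ?normal_peak_ge0.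
apply: (@le_lt_trans _ _ (\int[mu]_x (K%:E * (normal_pdf (0 : R) 2 x)%:E))).
  apply: ge0_le_integral => //.
  - by move=> x _; rewrite mule_ge0// lee_fin ?normal_pdf_ge0 ?sqr_ge0.
  - by apply: emeasurable_funM => //; apply/measurable_EFinP; exact: measurable_normal_pdf.
  - by apply: measurable_funeM; apply/measurable_EFinP; exact: measurable_normal_pdf.
  move=> x _; rewrite -!EFinM lee_fin !normal_pdfE// /K /normal_fun !subr0.
  set e2 := expR (- x ^+ 2 / (2 ^+ 2 *+ 2)).
  rewrite [leRHS](_ : _ = normal_peak 1 * (8 / 3 * e2))%R; last first.
    by field; rewrite gt_eqF ?normal_peak_gt0.
  rewrite -[leLHS]mulrA ler_wpM2l ?normal_peak_ge0// /e2.
  have -> : (- x ^+ 2 / (1 ^+ 2 *+ 2) = - x ^+ 2 / (2 ^+ 2 *+ 2) + - (3 / 8 * x ^+ 2))%R by field.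
  rewrite expRD -[leLHS]mulrA [leRHS]mulrC ler_wpM2l ?expR_ge0// mulrC expRN.
  rewrite ler_pdivrMr ?expR_gt0//.
  have := expR_ge1Dx (3 / 8 * x ^+ 2)%R; set e := expR _; lra.
rewrite ge0_integralZl//; first last.
- by move=> x _; rewrite lee_fin normal_pdf_ge0.
- by apply/measurable_EFinP; exact: measurable_normal_pdf.
by rewrite integral_normal_pdf mule1 ltry.
Qed.

Definition normal_moment2 : R := fine (\int[gauss]_z (z ^+ 2)%:E).

Lemma normal_moment2_ge0 : (0 <= normal_moment2)%R.
Proof. by apply: fine_ge0; apply: integral_ge0 => z _; rewrite lee_fin sqr_ge0. Qed.

(** The inequality (x + y)^2 <= 2 x^2 + 2 y^2 disposes of the cross term, at the price of a factor 2
    that the rates do not see. *)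
Lemma le_integral_normal_affine_sqr (a c : R) :
  \int[gauss]_z ((a + c * z) ^+ 2)%:E <= (2 * a ^+ 2 + 2 * c ^+ 2 * normal_moment2)%:E.
Proof.
have mZ : measurable_fun setT (fun z : R => c * z)%R by exact: measurable_funM.
have msqr : measurable_fun setT (fun z : R => (z ^+ 2)%:E).
  by apply/measurable_EFinP; exact: measurable_funX.
apply: (@le_trans _ _ (\int[gauss]_z ((2 * a ^+ 2)%:E + (2 * c ^+ 2)%:E * (z ^+ 2)%:E))).
  apply: ge0_le_integral => //.
  - by move=> z _; rewrite lee_fin sqr_ge0.
  - by apply/measurable_EFinP; apply: measurable_funX; exact: measurable_funD.
  - by apply: emeasurable_funD => //; exact: measurable_funeM.
  - move=> z _; rewrite -EFinM -EFinD lee_fin.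
    by have := sqr_ge0 (a - c * z); rewrite -mulrA -exprMn; nra.
rewrite ge0_integralD//; first last.
- exact: measurable_funeM.
- by move=> z _; rewrite -EFinM lee_fin -mulrA mulr_ge0// mulr_ge0// sqr_ge0.
- by move=> z _; rewrite lee_fin mulr_ge0 ?sqr_ge0.
have -> : \int[gauss]_z (2 * a ^+ 2)%:E = (2 * a ^+ 2)%:E.
  rewrite integral_cst// -[RHS]mule1; congr (_ * _).
  exact: (@probability_setT _ _ _ (normal_prob (0 : R) (1 : R))).
rewrite ge0_integralZl//; first last.
- by rewrite lee_fin mulr_ge0 ?sqr_ge0.
- by move=> z _; rewrite lee_fin sqr_ge0.
have m2_ge0 : 0 <= \int[gauss]_z (z ^+ 2)%:E.
  by apply: integral_ge0 => z _; rewrite lee_fin sqr_ge0.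
have m2_fin : \int[gauss]_z (z ^+ 2)%:E \is a fin_num.
  by rewrite ge0_fin_numE// normal_second_moment_lty.
by rewrite -(fineK m2_fin) -EFinM -EFinD.
Qed.

End normal_integrals.

(** * Conjugacy for one observation y = kappa t + tau z of t with prior N(0, s^2) *)

Section conjugacy.
Context (R : realType) (s kappa tau sigma a r : R).
Local Notation mu := (@lebesgue_measure R).
Local Notation gauss := (normal_prob (0 : R) (1 : R)).
Hypotheses (s0 : 0 < s) (tau0 : 0 < tau) (sigma0 : 0 < sigma) (r0 : 0 < r).
Hypothesis rE : r ^+ 2 = kappa ^+ 2 * s ^+ 2 + tau ^+ 2.
Hypothesis sigmaE : sigma ^+ 2 = s ^+ 2 * tau ^+ 2 / r ^+ 2.
Hypothesis aE : a = kappa * s ^+ 2 / r ^+ 2.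
Implicit Types (G b : R -> \bar R).

(* Bayes: prior density times likelihood is posterior times marginal. *)
Lemma normal_pdf_bayes (t y : R) :
  normal_pdf 0 s t * normal_pdf (kappa * t) tau y =
  normal_pdf (a * y) sigma t * normal_pdf 0 r y.
Proof.
rewrite !normal_pdfE ?gt_eqF// mulrACA [RHS]mulrACA /normal_fun -!expRD.
congr (_ * expR _).
  rewrite /normal_peak -!invfM -!sqrtrM ?mulrn_wge0 ?mulr_ge0 ?pi_ge0 ?ltW//.
  by congr (Num.sqrt _)^-1; rewrite sigmaE; field; rewrite gt_eqF.
have r20 : kappa ^+ 2 * s ^+ 2 + tau ^+ 2 != 0 by rewrite -rE gt_eqF// exprn_gt0.
rewrite aE sigmaE rE; field.
by rewrite exprMn r20 !gt_eqF.
Qed.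

(** Posterior expectation of [G t] given the observation [y]. *)
Let rho G y : \bar R := (\int[normal_prob (a * y) sigma]_t G t)%E.

Lemma measurable_normal_pdf2 (c : R) : measurable_fun setT
  (fun p : measurableTypeR R * measurableTypeR R => normal_pdf (c * p.1) sigma p.2).
Proof.
under [X in measurable_fun _ X]eq_fun do rewrite normal_pdfE ?gt_eqF//.
apply: measurable_funM => //; apply: measurableT_comp => //.
apply: measurable_funM => //; apply: measurableT_comp => //.
apply: measurable_funX; apply: measurable_funB; first exact: measurable_snd.
by apply: measurable_funM => //; exact: measurable_fst.
Qed.

Local Open Scope ereal_scope.

Lemma measurable_posterior_integral G : measurable_fun setT G ->
  (forall t, 0 <= G t) -> measurable_fun setT (rho G).
Proof.
move=> mG G0.
rewrite (_ : rho G = fubini_F mu (fun p => (normal_pdf (a * p.1) sigma p.2)%:E * G p.2)).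
  apply: measurable_fun_fubini_tonelli_F.
    apply: emeasurable_funM; last exact: measurableT_comp mG measurable_snd.
    by apply/measurable_EFinP; exact: measurable_normal_pdf2.
  by move=> p; rewrite mule_ge0// lee_fin normal_pdf_ge0.
by apply/funext => y; rewrite /rho ge0_integral_normal.
Qed.

(** The joint density of (t, y) is rewritten by [normal_pdf_bayes] as posterior times marginal;
    Tonelli then integrates [t] first, which produces [rho G]. *)
Let joint G b : measurable_fun setT G -> (forall t, 0 <= G t) ->
  measurable_fun setT b -> (forall t, 0 <= b t) ->
  \int[normal_prob 0 s]_t \int[gauss]_z (G t * b (kappa * t + tau * z)%R) =
  \int[mu]_y ((normal_pdf 0 r y)%:E * (b y * rho G y)).
Proof.
move=> mG G0 mb b0.
have inner t : \int[gauss]_z (G t * b (kappa * t + tau * z)%R) =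
    \int[mu]_y ((normal_pdf (kappa * t) tau y)%:E * (G t * b y)).
  rewrite -(@ge0_integral_normal_affine _ (kappa * t) tau (fun y => G t * b y))//.
  - rewrite ge0_integral_normal//; first exact: measurable_funeM.
    by move=> y; rewrite mule_ge0.
  - exact: measurable_funeM.
  - by move=> y; rewrite mule_ge0.
under eq_integral do rewrite inner.
pose g (p : measurableTypeR R * measurableTypeR R) :=
  (normal_pdf (a * p.2) sigma p.1 * normal_pdf 0 r p.2)%:E * (G p.1 * b p.2).
have g0 p : 0 <= g p.
  by rewrite !mule_ge0// lee_fin mulr_ge0// normal_pdf_ge0.
have mg : measurable_fun setT g.
  apply: emeasurable_funM.
    apply/measurable_EFinP; apply: measurable_funM.
      have msw : measurable_fun setT
          (fun p : measurableTypeR R * measurableTypeR R => (p.2, p.1)).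
        apply: measurable_fun_pair; [exact: measurable_snd|exact: measurable_fst].
      exact: (measurableT_comp (measurable_normal_pdf2 a) msw).
    exact: measurableT_comp (measurable_normal_pdf 0 r) measurable_snd.
  apply: emeasurable_funM; first exact: measurableT_comp mG measurable_fst.
  exact: measurableT_comp mb measurable_snd.
transitivity (\int[mu]_t \int[mu]_y g (t, y)).
  rewrite ge0_integral_normal//; first last.
  - move=> t; apply: integral_ge0 => y _.
    by rewrite !mule_ge0// lee_fin normal_pdf_ge0.
  - have : measurable_fun setT (fun t => fubini_F mu (fun p : measurableTypeR R * measurableTypeR R =>
        (normal_pdf (kappa * p.1) tau p.2)%:E * (G p.1 * b p.2)) t).
      apply: measurable_fun_fubini_tonelli_F; last first.
        by move=> p; rewrite !mule_ge0// lee_fin normal_pdf_ge0.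
      apply: emeasurable_funM.
        apply/measurable_EFinP.
        under [X in measurable_fun _ X]eq_fun do rewrite normal_pdfE ?gt_eqF//.
        apply: measurable_funM => //; apply: measurableT_comp => //.
        apply: measurable_funM => //; apply: measurableT_comp => //.
        apply: measurable_funX; apply: measurable_funB; first exact: measurable_snd.
        by apply: measurable_funM => //; exact: measurable_fst.
      apply: emeasurable_funM; first exact: measurableT_comp mG measurable_fst.
      exact: measurableT_comp mb measurable_snd.
    by [].
  apply: eq_integral => t _; rewrite -ge0_integralZl//; first last.
  - by rewrite lee_fin normal_pdf_ge0.
  - by move=> y _; rewrite !mule_ge0// lee_fin normal_pdf_ge0.
  - apply: emeasurable_funM; first by apply/measurable_EFinP; exact: measurable_normal_pdf.
    exact: measurable_funeM.
  by apply: eq_integral => y _; rewrite muleA -EFinM normal_pdf_bayes.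
rewrite (fubini_tonelli g)//.
apply: eq_integral => y _; rewrite /rho ge0_integral_normal// muleA.
rewrite -ge0_integralZl//; first last.
- by rewrite mule_ge0// lee_fin normal_pdf_ge0.
- by move=> t _; rewrite mule_ge0// lee_fin normal_pdf_ge0.
- by apply: emeasurable_funM => //; apply/measurable_EFinP; exact: measurable_normal_pdf.
apply: eq_integral => t _; rewrite /g /= EFinM.
rewrite -[LHS]muleA [in LHS]muleCA -!muleA; congr (_ * _).
by rewrite [RHS]muleCA; congr (_ * _); rewrite muleC.
Qed.

(** This is the defining property of a conditional expectation, tested against functions [b] of the
    observation. [joint] is used twice: for [G] and [b], then for the constant 1 and the product of
    [rho G] and [b], since [rho] of the constant 1 is 1. *)
Lemma normal_conjugacy G b : measurable_fun setT G -> (forall t, 0 <= G t) ->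
  measurable_fun setT b -> (forall t, 0 <= b t) ->
  \int[normal_prob 0 s]_t \int[gauss]_z (G t * b (kappa * t + tau * z)%R) =
  \int[normal_prob 0 s]_t \int[gauss]_z
    (rho G (kappa * t + tau * z)%R * b (kappa * t + tau * z)%R).
Proof.
move=> mG G0 mb b0; rewrite joint//.
have rho0 y : 0 <= rho G y by exact: integral_ge0.
have mrb : measurable_fun setT (fun y => rho G y * b y).
  by apply: emeasurable_funM => //; exact: measurable_posterior_integral.
transitivity (\int[mu]_y ((normal_pdf 0 r y)%:E * (rho G y * b y * rho (cst 1) y))).
  apply: eq_integral => y _; congr (_ * _); rewrite [RHS](_ : _ = rho G y * b y * 1).
    by rewrite mule1 muleC.
  congr (_ * _); rewrite /rho integral_cst// mul1e.
  exact: (@probability_setT _ _ _ (normal_prob (a * y) sigma)).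
have J := @joint (cst 1) (fun y => rho G y * b y) (measurable_cst _) (fun=> @lee01 R)
  mrb (fun y => mule_ge0 (rho0 y) (b0 y)).
apply: (etrans (esym J)).
by apply: eq_integral => t _; apply: eq_integral => z _; rewrite mul1e.
Qed.

End conjugacy.

(** * Posterior law of one coordinate *)

Section joint_resampling.
Context (R : realType) d (Omega : measurableType d) (P : probability Omega R)
  (W : L2fun R -> Omega -> R) (Pi : probability (Rprod nat R) R).
Hypothesis hW : white_noise P W.
Local Notation mR := (measurableTypeR R).
Local Notation gauss := (normal_prob (0 : R) (1 : R)).
Local Open Scope ereal_scope.

(** The component of the noise [x] along [e] is exchanged for [z]; for a unit vector [e] the new
    value at [e] is exactly [z]. *)
Definition shiftW (e : L2fun R) (z : R) (x : Rprod (L2fun R) R) : Rprod (L2fun R) R :=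
  (fun phi => x phi + inner (sval phi) (sval e) * (z - x e))%R.

Lemma measurable_shiftW e :
  measurable_fun setT (fun p : mR * Rprod (L2fun R) R => shiftW e p.1 p.2).
Proof.
apply: measurable_Rprod => phi; apply: measurable_funD.
  exact: measurableT_comp (measurable_coord phi) measurable_snd.
apply: measurable_funM => //; apply: measurable_funB; first exact: measurable_fst.
exact: measurableT_comp (measurable_coord e) measurable_snd.
Qed.

(** The fresh variables are integrated innermost, so that [theta] and the noise off [e] are frozen
    while a double integral in (t, z) remains: the situation of [normal_conjugacy]. *)
Lemma joint_resample (i : nat) (s : R) (e : L2fun R) :
  independent Pi (fun j (theta : Rprod nat R) => theta j : R) ->
  has_law Pi (fun theta : Rprod nat R => theta i : R) (normal_prob 0 s) ->
  inner (sval e) (sval e) = 1%R ->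
  forall Psi : Rprod nat R * Rprod (L2fun R) R -> \bar R,
    measurable_fun setT Psi -> (forall x, 0 <= Psi x) ->
  \int[Pi]_theta \int[P]_w Psi (theta, W ^~ w) =
  \int[Pi]_theta \int[P]_w \int[normal_prob 0 s]_t \int[gauss]_z
    Psi (upd theta i t, shiftW e z (W ^~ w)).
Proof.
move=> indPi lawi e1 Psi mPsi Psi0.
have mWT := white_noise_measurableT hW.
pose A theta := \int[P]_w Psi (theta, W ^~ w).
have mA : measurable_fun setT A.
  apply: (@measurable_fun_fubini_tonelli_F _ _ _ _ _ P
    (fun p : Rprod nat R * Omega => Psi (p.1, W ^~ p.2))) => //.
  have mp : measurable_fun setT
      (fun p : Rprod nat R * Omega => (p.1, W ^~ p.2 : Rprod (L2fun R) R)).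
    apply: measurable_fun_pair; first exact: measurable_fst.
    exact: measurableT_comp mWT measurable_snd.
  exact: (measurableT_comp mPsi mp).
have A0 theta : 0 <= A theta by apply: integral_ge0.
have mA2 : measurable_fun setT (fun p : mR * Rprod nat R => A (upd p.2 i p.1)).
  exact: (measurableT_comp mA (measurable_upd i)).
transitivity (\int[Pi]_theta \int[normal_prob 0 s]_t A (upd theta i t)).
  rewrite -(@fubini_tonelli2 _ _ _ _ _ (normal_prob 0 s) Pi
    (fun p : mR * Rprod nat R => A (upd p.2 i p.1)))//.
  exact: (@independent_resample _ _ _ _ Pi
    (fun j (theta : Rprod nat R) => theta j : R) i (normal_prob 0 s) indPi
    (fun j => measurable_coord j) lawi A mA A0).
apply: eq_integral => theta _.
have m4 : measurable_fun setT (fun q : (mR * Omega) * mR =>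
    Psi (upd theta i q.1.1, shiftW e q.2 (W ^~ q.1.2))).
  have m1 : measurable_fun setT (fun q : (mR * Omega) * mR => upd theta i q.1.1).
    have mp : measurable_fun setT (fun q : (mR * Omega) * mR => (q.1.1, theta)).
      by apply: measurable_fun_pair => //; exact: measurableT_comp measurable_fst measurable_fst.
    exact: (measurableT_comp (measurable_upd i) mp).
  have m2 : measurable_fun setT (fun q : (mR * Omega) * mR => shiftW e q.2 (W ^~ q.1.2)).
    have mp : measurable_fun setT (fun q : (mR * Omega) * mR => (q.2, W ^~ q.1.2 : Rprod (L2fun R) R)).
      apply: measurable_fun_pair; first exact: measurable_snd.
      by apply: (measurableT_comp mWT); exact: measurableT_comp measurable_snd measurable_fst.
    exact: (measurableT_comp (measurable_shiftW e) mp).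
  have mp : measurable_fun setT (fun q : (mR * Omega) * mR =>
     (upd theta i q.1.1, shiftW e q.2 (W ^~ q.1.2))) by exact: measurable_fun_pair.
  exact: (measurableT_comp mPsi mp).
pose C (p : mR * Omega) := \int[gauss]_z Psi (upd theta i p.1, shiftW e z (W ^~ p.2)).
have mC : measurable_fun setT C.
  exact: (@measurable_fun_fubini_tonelli_F _ _ _ _ _ gauss _ m4 (fun=> Psi0 _)).
have C0 p : 0 <= C p by apply: integral_ge0.
rewrite -(@fubini_tonelli _ _ _ _ _ (normal_prob 0 s) P C mC C0).
apply: eq_integral => t _.
have mPt : measurable_fun setT (fun x : Rprod (L2fun R) R => Psi (upd theta i t, x)).
  have mp : measurable_fun setT (fun x : Rprod (L2fun R) R => (upd theta i t, x)).
    by apply: measurable_fun_pair.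
  exact: (measurableT_comp mPsi mp).
rewrite /A (white_noise_resample hW e1 mPt)//.
rewrite (@fubini_tonelli2 _ _ _ _ _ gauss P (fun p : mR * Omega =>
  Psi (upd theta i t, shiftW e p.1 (W ^~ p.2))))//.
have mp : measurable_fun setT (fun p : mR * Omega => (p.1, W ^~ p.2 : Rprod (L2fun R) R)).
  apply: measurable_fun_pair; first exact: measurable_fst.
  exact: measurableT_comp mWT measurable_snd.
exact: (measurableT_comp mPt (measurableT_comp (measurable_shiftW e) mp)).
Qed.

End joint_resampling.

Section gaussian_sequence_bayes.
Context (R : realType) d (Omega : measurableType d) (P : probability Omega R)
  (W : L2fun R -> Omega -> R) (Pi : probability (Rprod nat R) R).
Context (T : Rprod nat R -> Rprod (L2fun R) R) (S : set (Rprod nat R))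
  (tau : R) (s kappa : nat -> R) (e : nat -> L2fun R).
Hypothesis hW : white_noise P W.
Hypothesis indPi : independent Pi (fun j (theta : Rprod nat R) => theta j : R).
Hypothesis lawPi : forall i,
  has_law Pi (fun theta : Rprod nat R => theta i : R) (normal_prob 0 (s i)).
Hypothesis s_gt0 : forall i, 0 < s i.
Hypothesis tau_gt0 : 0 < tau.
Hypothesis e1 : forall i, inner (sval (e i)) (sval (e i)) = 1.
Hypothesis mT : measurable_fun setT T.
Hypothesis mS : measurable S.
Hypothesis PiS : Pi S = 1%E.
Hypothesis S_upd : forall theta i t, S theta -> S (upd theta i t).
Hypothesis T_upd : forall theta i t phi, S theta ->
  T (upd theta i t) phi = T (upd theta i 0) phi + t * (kappa i * inner (sval phi) (sval (e i))).
Hypothesis T_e : forall theta i, S theta -> T theta (e i) = kappa i * theta i.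

Local Notation gauss := (normal_prob (0 : R) (1 : R)).

(** [T] stands for the signal as a functional of test functions and is kept abstract: only its
    affine dependence on each coordinate and its values at [e i] enter here, and only on a set [S]
    of prior probability 1 that is stable under changing a coordinate. *)
Definition obs (theta : Rprod nat R) (x : Rprod (L2fun R) R) : Rprod (L2fun R) R :=
  fun phi => T theta phi + tau * x phi.

(** Parameters of the conjugate pair (theta_i, Y(e_i)): [marg_sd i] is the marginal standard
    deviation of Y(e_i), [post_sd i] that of the posterior of theta_i, and the posterior mean is
    [post_slope i] times Y(e_i). *)
Definition marg_sd i := Num.sqrt (kappa i ^+ 2 * s i ^+ 2 + tau ^+ 2).
Definition post_sd i := s i * tau / marg_sd i.
Definition post_slope i := kappa i * s i ^+ 2 / marg_sd i ^+ 2.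

Lemma measurable_obs :
  measurable_fun setT (fun p : Rprod nat R * Rprod (L2fun R) R => obs p.1 p.2).
Proof.
apply: measurable_Rprod => phi; apply: measurable_funD.
  exact: (measurableT_comp (measurable_coord phi) (measurableT_comp mT measurable_fst)).
apply: measurable_funM => //.
exact: measurableT_comp (measurable_coord phi) measurable_snd.
Qed.

Lemma marg_sd_sqr i : marg_sd i ^+ 2 = kappa i ^+ 2 * s i ^+ 2 + tau ^+ 2.
Proof. by rewrite sqr_sqrtr// -exprMn addr_ge0 ?sqr_ge0. Qed.

Lemma marg_sd_gt0 i : 0 < marg_sd i.
Proof.
by rewrite sqrtr_gt0 ltr_wpDl ?exprn_gt0// -exprMn sqr_ge0.
Qed.

Lemma post_sd_gt0 i : 0 < post_sd i.
Proof. by rewrite !mulr_gt0 ?invr_gt0 ?marg_sd_gt0. Qed.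

Local Open Scope ereal_scope.

(** Once inserted before resampling, the indicator of [S] stays in the resampled integrand, where it
    gives access to [T_upd] and [T_e]. *)
Lemma integral_restrict_full (f : Rprod nat R * Rprod (L2fun R) R -> \bar R) :
  measurable_fun setT f -> (forall x, 0 <= f x) ->
  \int[Pi]_theta \int[P]_w f (theta, W ^~ w) =
  \int[Pi]_theta \int[P]_w ((\1_S theta)%:E * f (theta, W ^~ w)).
Proof.
move=> mf f0; have mWT := white_noise_measurableT hW.
have mfp : measurable_fun setT (fun p : Rprod nat R * Omega => f (p.1, W ^~ p.2)).
  have mp : measurable_fun setT
      (fun p : Rprod nat R * Omega => (p.1, W ^~ p.2 : Rprod (L2fun R) R)).
    apply: measurable_fun_pair; first exact: measurable_fst.
    exact: measurableT_comp mWT measurable_snd.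
  exact: (measurableT_comp mf mp).
apply: ge0_ae_eq_integral => //.
- exact: (@measurable_fun_fubini_tonelli_F _ _ _ _ _ P _ mfp (fun=> f0 _)).
- apply: (@measurable_fun_fubini_tonelli_F _ _ _ _ _ P
    (fun p : Rprod nat R * Omega => (\1_S p.1)%:E * f (p.1, W ^~ p.2))).
    apply: emeasurable_funM => //; apply/measurable_EFinP.
    exact: measurableT_comp measurable_fst.
  by move=> p; rewrite mule_ge0// lee_fin.
- by move=> theta _; apply: integral_ge0.
- by move=> theta _; apply: integral_ge0 => w _; rewrite mule_ge0// lee_fin.
exists (~` S); split; first exact: measurableC.
  transitivity (1 - Pi S); first exact: probability_setC.
  by rewrite PiS subee.
move=> theta /=; apply: contra_not => Stheta _.
by apply: eq_integral => w _; rewrite indicE mem_set// mul1e.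
Qed.

(** [B] is an arbitrary event of the whole observation, so the normal law obtained is conditional on
    all of Y although it involves Y(e_i) only. After resampling, the observation depends on (t, z)
    through [kappa i * t + tau * z] alone, and [B] becomes an event of this scalar. *)
Lemma bayes_coordinate (i : nat) (G : R -> \bar R) (B : set (Rprod (L2fun R) R)) :
  measurable_fun setT G -> (forall t, 0 <= G t) -> measurable B ->
  \int[Pi]_theta \int[P]_w (G (theta i) * (\1_B (obs theta (W ^~ w)))%:E) =
  \int[Pi]_theta \int[P]_w
    ((\int[normal_prob (post_slope i * obs theta (W ^~ w) (e i)) (post_sd i)]_t G t)
      * (\1_B (obs theta (W ^~ w)))%:E).
Proof.
move=> mG G0 mB.
pose rho y := \int[normal_prob (post_slope i * y) (post_sd i)]_t G t.
have mrho : measurable_fun setT rho.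
  apply: measurable_posterior_integral => //; exact: post_sd_gt0.
have rho0 y : 0 <= rho y by exact: integral_ge0.
have mBo : measurable_fun setT (fun p : Rprod nat R * Rprod (L2fun R) R =>
    (\1_B (obs p.1 p.2))%:E : \bar R).
  apply/measurable_EFinP; exact: measurableT_comp measurable_obs.
pose Psi1 (p : Rprod nat R * Rprod (L2fun R) R) :=
  G (p.1 i) * (\1_B (obs p.1 p.2))%:E.
pose Psi2 (p : Rprod nat R * Rprod (L2fun R) R) :=
  rho (obs p.1 p.2 (e i)) * (\1_B (obs p.1 p.2))%:E.
have mPsi1 : measurable_fun setT Psi1.
  apply: emeasurable_funM => //; apply: (measurableT_comp mG).
  exact: measurableT_comp (measurable_coord i) measurable_fst.
have mPsi2 : measurable_fun setT Psi2.
  have mY := measurableT_comp (measurable_coord (e i)) measurable_obs.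
  exact: (emeasurable_funM (measurableT_comp mrho mY) mBo).
have Psi10 p : 0 <= Psi1 p by rewrite mule_ge0// lee_fin.
have Psi20 p : 0 <= Psi2 p by rewrite mule_ge0// lee_fin.
have mS1 : measurable_fun setT (fun p : Rprod nat R * Rprod (L2fun R) R => (\1_S p.1)%:E : \bar R).
  by apply/measurable_EFinP; exact: measurableT_comp measurable_fst.
have restr (Psi : Rprod nat R * Rprod (L2fun R) R -> \bar R) : measurable_fun setT Psi -> (forall p, 0 <= Psi p) ->
  \int[Pi]_theta \int[P]_w Psi (theta, W ^~ w) =
  \int[Pi]_theta \int[P]_w \int[normal_prob 0 (s i)]_t \int[gauss]_z
    ((\1_S (upd theta i t))%:E * Psi (upd theta i t, shiftW (e i) z (W ^~ w))).
  move=> mPsi Psi0; apply: (etrans (integral_restrict_full mPsi Psi0)).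
  apply: (joint_resample hW indPi (lawPi i) (e1 i)
    (Psi := fun p => (\1_S p.1)%:E * Psi p)).
    exact: emeasurable_funM.
  by move=> p; rewrite mule_ge0// lee_fin.
apply: (etrans (restr Psi1 mPsi1 Psi10)).
apply: (etrans _ (esym (restr Psi2 mPsi2 Psi20))).
apply: eq_integral => theta _; apply: eq_integral => w _.
have S_updE t : \1_S (upd theta i t) = \1_S theta :> R.
  rewrite !indicE; congr (_%:R); congr nat_of_bool; apply/idP/idP => /set_mem H; apply/mem_set.
    have -> : theta = upd (upd theta i t) i (theta i).
      by apply/funext => j; rewrite /upd; case: eqVneq => [->|].
    exact: S_upd.
  exact: S_upd.
have [Stheta|nStheta] := pselect (S theta); last first.
  have S0 t : \1_S (upd theta i t) = 0%R :> R by rewrite S_updE indicE memNset.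
  under eq_integral do under eq_integral do rewrite S0 mul0e.
  by under [RHS]eq_integral do under eq_integral do rewrite S0 mul0e.
have S1 t : \1_S (upd theta i t) = 1%R :> R by rewrite S_updE indicE mem_set.
under eq_integral do under eq_integral do rewrite S1 mul1e.
under [RHS]eq_integral do under eq_integral do rewrite S1 mul1e.
(* [base] collects what stays frozen. It vanishes at [e i], so the parameter of [line] is the value
   of the observation at [e i]. *)
pose base : Rprod (L2fun R) R := (fun phi => T (upd theta i 0) phi +
  tau * (W phi w - inner (sval phi) (sval (e i)) * W (e i) w))%R.
pose line (y : measurableTypeR R) : Rprod (L2fun R) R :=
  (fun phi => base phi + inner (sval phi) (sval (e i)) * y)%R.
have mline : measurable_fun setT line.
  by apply: measurable_Rprod => phi; apply: measurable_funD => //; exact: measurable_funM.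
have obsE t z : obs (upd theta i t) (shiftW (e i) z (W ^~ w)) = line (kappa i * t + tau * z)%R.
  apply/funext => phi; rewrite /obs /line /shiftW /base T_upd//; ring.
have obs_e t z : obs (upd theta i t) (shiftW (e i) z (W ^~ w)) (e i) = (kappa i * t + tau * z)%R.
  by rewrite /obs /shiftW T_e ?e1; [rewrite /upd eqxx; ring|exact: S_upd].
have mb : measurable_fun setT (fun y => (\1_B (line y))%:E : \bar R).
  by apply/measurable_EFinP; exact: measurableT_comp mline.
have b0 y : 0 <= (\1_B (line y))%:E :> \bar R by rewrite lee_fin.
rewrite /Psi1 /Psi2 /=.
under eq_integral do under eq_integral do rewrite {1}/upd eqxx obsE.
under [RHS]eq_integral do under eq_integral do rewrite obs_e obsE.
apply: (@normal_conjugacy R (s i) (kappa i) tau (post_sd i) (post_slope i) (marg_sd i)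
  (s_gt0 i) tau_gt0 (post_sd_gt0 i) (marg_sd_gt0 i) (marg_sd_sqr i) _ erefl
  G (fun y => (\1_B (line y))%:E) mG G0 mb b0).
by rewrite /post_sd expr_div_n exprMn.
Qed.

End gaussian_sequence_bayes.

(** * Square integrable functions on (0,1) *)

Section L2_space.
Context (R : realType).
Local Notation mu := (@lebesgue_measure R).
Local Notation D := (`]0, 1[%classic : set R).
Implicit Types (f phi psi : R -> R) (c : R).

Lemma L2normE f : L2norm f = ((\int[mu]_(x in D) (f x ^+ 2)%:E) `^ 2^-1)%E.
Proof.
rewrite /L2norm unlock; congr (_ `^ _)%E; rewrite [RHS]integral_mkcond.
apply: eq_integral => x _; rewrite !patchE; case: ifP => _ /=.
  by rewrite powR_mulrn// -normrX ger0_norm// sqr_ge0.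
by rewrite normr0 powR_mulrn// expr0n.
Qed.

Lemma int_sqr_ge0 f : (0 <= \int[mu]_(x in D) (f x ^+ 2)%:E)%E.
Proof. by apply: integral_ge0 => x _; rewrite lee_fin sqr_ge0. Qed.

Lemma L2P f : L2 f <->
  measurable_fun D f /\ (\int[mu]_(x in D) (f x ^+ 2)%:E < +oo)%E.
Proof.
rewrite /L2 L2normE; split=> -[mf foo]; split => //.
  by apply: (lty_poweRy _ foo); rewrite invr_neq0.
exact: poweR_lty.
Qed.

Lemma lebesgue_measure01 : mu D = 1%E.
Proof. by rewrite lebesgue_measure_itv/= lte01 oppr0 adde0. Qed.

Lemma L2_bounded f M : measurable_fun D f -> (forall x, D x -> `|f x| <= M) -> L2 f.
Proof.
move=> mf fM; apply/L2P; split=> //.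
apply: (@le_lt_trans _ _ (\int[mu]_(x in D) (M ^+ 2)%:E)%E); last first.
  by rewrite integral_cst//= lebesgue_measure01 mule1 ltry.
apply: ge0_le_integral => //.
- by move=> x _; rewrite lee_fin sqr_ge0.
- by apply/measurable_EFinP; exact: measurable_funX.
- by move=> x /fM fxM; rewrite lee_fin -real_normK ?num_real// lerXn2r// nnegrE (le_trans _ fxM).
Qed.

Lemma L2_integrableM phi psi : L2 phi -> L2 psi ->
  mu.-integrable D (fun x => (phi x * psi x)%:E).
Proof.
move=> /L2P[mphi phioo] /L2P[mpsi psioo].
have int_sqr f : measurable_fun D f -> (\int[mu]_(x in D) (f x ^+ 2)%:E < +oo)%E ->
    mu.-integrable D (fun x => (f x ^+ 2)%:E).
  move=> mf foo; apply/integrableP; split.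
    by apply/measurable_EFinP; exact: measurable_funX.
  by under eq_integral do rewrite gee0_abs ?lee_fin ?sqr_ge0//.
apply: (@le_integrable _ _ _ mu D _ _ (fun x => ((phi x ^+ 2)%:E + (psi x ^+ 2)%:E)%E)) => //.
- by apply/measurable_EFinP; exact: measurable_funM.
- move=> x _; rewrite !abse_EFin lee_fin normrM.
  rewrite [leRHS]ger0_norm ?addr_ge0 ?sqr_ge0//.
  rewrite -(real_normK (num_real (phi x))) -(real_normK (num_real (psi x))).
  have := sqr_ge0 (`|phi x| - `|psi x|); have := normr_ge0 (phi x).
  have := normr_ge0 (psi x); nra.
- by apply: integrableD => //; exact: int_sqr.
Qed.

Lemma innerC phi psi : inner phi psi = inner psi phi.
Proof. by apply: eq_Rintegral => x _; rewrite mulrC. Qed.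

Lemma innerZ c phi psi : L2 phi -> L2 psi ->
  inner phi (fun x => c * psi x) = c * inner phi psi.
Proof.
move=> Lphi Lpsi; rewrite /inner -RintegralZl//; last exact: L2_integrableM.
by apply: eq_Rintegral => x _; rewrite mulrCA.
Qed.

Lemma innerD phi psi f : L2 phi -> L2 psi -> L2 f ->
  inner phi (fun x => psi x + f x) = inner phi psi + inner phi f.
Proof.
move=> Lphi Lpsi Lf; rewrite /inner -RintegralD//; try exact: L2_integrableM.
by apply: eq_Rintegral => x _; rewrite mulrDr.
Qed.

Lemma eq_inner phi psi f : {in D, psi =1 f} -> inner phi psi = inner phi f.
Proof. by move=> eq_f; apply: eq_Rintegral => x xD; rewrite eq_f. Qed.

Lemma L2Z c f : L2 f -> L2 (fun x => c * f x).
Proof.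
move=> /L2P[mf foo]; apply/L2P; split; first exact: measurable_funM.
under eq_integral do rewrite exprMn EFinM.
rewrite ge0_integralZl//.
- by rewrite lte_mul_pinfty// lee_fin sqr_ge0.
- by apply/measurable_EFinP; exact: measurable_funX.
- by move=> x _; rewrite lee_fin sqr_ge0.
- by rewrite lee_fin sqr_ge0.
Qed.

Lemma L2D f phi : L2 f -> L2 phi -> L2 (fun x => f x + phi x).
Proof.
move=> Lf Lphi; have /L2P[mf foo] := Lf; have /L2P[mphi phioo] := Lphi.
apply/L2P; split; first exact: measurable_funD.
apply: (@le_lt_trans _ _ (\int[mu]_(x in D) (2%:E * (f x ^+ 2)%:E + 2%:E * (phi x ^+ 2)%:E))%E).
  apply: ge0_le_integral => //.
  - by move=> x _; rewrite lee_fin sqr_ge0.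
  - by apply/measurable_EFinP; apply: measurable_funX; exact: measurable_funD.
  - by apply: emeasurable_funD; apply: measurable_funeM; apply/measurable_EFinP; exact: measurable_funX.
  - move=> x _; rewrite -!EFinM -EFinD lee_fin.
    by have := sqr_ge0 (f x - phi x); nra.
rewrite ge0_integralD//.
- rewrite !ge0_integralZl//; try by apply/measurable_EFinP; exact: measurable_funX.
  + by rewrite lte_add_pinfty// lte_mul_pinfty.
  + by move=> x _; rewrite lee_fin sqr_ge0.
  + by move=> x _; rewrite lee_fin sqr_ge0.
- by move=> x _; rewrite -EFinM lee_fin mulr_ge0// sqr_ge0.
- by apply: measurable_funeM; apply/measurable_EFinP; exact: measurable_funX.
- by move=> x _; rewrite -EFinM lee_fin mulr_ge0// sqr_ge0.
- by apply: measurable_funeM; apply/measurable_EFinP; exact: measurable_funX.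
Qed.

Lemma L2B f phi : L2 f -> L2 phi -> L2 (fun x => f x - phi x).
Proof.
move=> Lf /(L2Z (-1)) Lphi; have := L2D Lf Lphi.
by under [X in L2 X]eq_fun do rewrite mulN1r.
Qed.

Lemma innerB phi psi f : L2 phi -> L2 psi -> L2 f ->
  inner phi (fun x => psi x - f x) = inner phi psi - inner phi f.
Proof.
move=> Lphi Lpsi Lf; rewrite -mulN1r -innerZ// -innerD//; last exact: L2Z.
by apply: eq_Rintegral => x _; rewrite mulN1r.
Qed.

Lemma inner_sum phi (I : Type) (s : seq I) (psi : I -> R -> R) : L2 phi ->
  (forall i, L2 (psi i)) ->
  inner phi (fun x => \sum_(i <- s) psi i x) = \sum_(i <- s) inner phi (psi i).
Proof.
move=> Lphi Lpsi; have L0 : L2 (cst 0 : R -> R).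
  by apply: (@L2_bounded _ 0) => // x _; rewrite normr0.
have Ls r : L2 (fun x => \sum_(i <- r) psi i x).
  elim: r => [|i r IHr]; first by under [X in L2 X]eq_fun do rewrite big_nil.
  by under [X in L2 X]eq_fun do rewrite big_cons; exact: L2D.
elim: s => [|i s IHs].
  rewrite big_nil; under [X in inner _ X]eq_fun do rewrite big_nil.
  by rewrite /inner; under eq_Rintegral do rewrite mulr0; rewrite Rintegral_cst// mul0r.
rewrite big_cons -IHs -innerD//.
by congr inner; apply/funext => x; rewrite big_cons.
Qed.

End L2_space.

(** * Risk of the posterior under the true signal *)

Section cameron_martin.
Context (R : realType).
Local Notation mR := (measurableTypeR R).
Local Notation gauss := (normal_prob (0 : R) (1 : R)).

Lemma inner_ge0 (f : R -> R) : 0 <= inner f f.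
Proof. by apply: Rintegral_ge0 => x _; rewrite -expr2 sqr_ge0. Qed.

(** For <f, f> = 0 the polynomial t |-> |phi - t f|^2 is affine, and an affine function that stays
    nonnegative is constant. *)
Lemma inner_null (phi f : R -> R) : L2 phi -> L2 f -> inner f f = 0 -> inner phi f = 0.
Proof.
move=> Lphi Lf f0.
have ge0 t : 0 <= inner phi phi - 2 * t * inner phi f.
  have := inner_ge0 (fun x => phi x - t * f x).
  have Ltf := L2Z t Lf; have Lg := L2B Lphi Ltf.
  rewrite innerB// innerC innerB// innerZ// innerC.
  rewrite [inner _ (fun x => t * f x)]innerC innerB//.
  rewrite [inner (fun x => t * f x) (fun x => t * f x)]innerZ//.
  rewrite ![inner (fun x => t * f x) _]innerC !innerZ// f0.
  by rewrite ?[inner f phi]innerC; lra.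
apply/eqP/negPn/negP => n0.
have := ge0 ((inner phi phi + 1) / (2 * inner phi f)).
rewrite (_ : _ - _ = -1); last by field.
by rewrite oppr_ge0 ler10.
Qed.

Context d (Omega : measurableType d) (P : probability Omega R)
  (W : L2fun R -> Omega -> R).
Hypothesis hW : white_noise P W.

Lemma white_noise_shift_null (f : L2fun R) (N : set (Rprod (L2fun R) R)) :
  measurable N -> P [set w | N (W ^~ w)] = 0%E ->
  P [set w | N (fun phi => W phi w + inner (sval phi) (sval f))] = 0%E.
Proof.
move=> mN PN; have mWT := white_noise_measurableT hW.
have [f0|f_neq0] := eqVneq (inner (sval f) (sval f)) 0.
  rewrite -PN; congr (P _); apply/seteqP; split=> w /=; congr N; apply/funext => phi;
  by rewrite (inner_null (svalP phi) (svalP f))// addr0.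
have v0 : 0 < inner (sval f) (sval f) by rewrite lt_def f_neq0 inner_ge0.
set c := Num.sqrt (inner (sval f) (sval f)).
have c0 : 0 < c by rewrite sqrtr_gt0.
pose e : L2fun R := exist _ _ (L2Z c^-1 (svalP f)).
have fE (phi : L2fun R) : inner (sval phi) (sval f) = c * inner (sval phi) (sval e).
  rewrite /e/= innerZ; [|exact: svalP|exact: svalP].
  by rewrite mulrA divff ?mul1r// gt_eqF.
have e1 : inner (sval e) (sval e) = 1.
  have := fE e; rewrite {1}/e/= innerC innerZ; [|exact: svalP|exact: svalP].
  rewrite -[X in _ * X](sqr_sqrtr (ltW v0)) -/c expr2 mulrA mulVf ?gt_eqF// mul1r.
  by move/eqP; rewrite -[X in X == _]mulr1 (inj_eq (mulfI (lt0r_neq0 c0))) => /eqP.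
have mN1 : measurable_fun setT (fun x : Rprod (L2fun R) R => (\1_N x)%:E : \bar R).
  by apply/measurable_EFinP; exact: measurable_indic.
(* [psi z] is the probability of [N] when the component of the noise along [e] is set to [z]; its
   N(0,1)-integral is the probability of [N]. Since f = c e, shifting by [f] evaluates [psi] at z +
   c. *)
pose psi z := (\int[P]_w (\1_N (shiftW e z (W ^~ w)))%:E)%E.
have mg : measurable_fun setT (fun p : mR * Omega => shiftW e p.1 (W ^~ p.2)).
  have mp : measurable_fun setT (fun p : mR * Omega => (p.1, W ^~ p.2 : Rprod (L2fun R) R)).
    apply: measurable_fun_pair; first exact: measurable_fst.
    exact: measurableT_comp mWT measurable_snd.
  exact: (measurableT_comp (measurable_shiftW e) mp).
have mpsi : measurable_fun setT psi.
  apply: (@measurable_fun_fubini_tonelli_F _ _ _ _ _ P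
    (fun p : mR * Omega => (\1_N (shiftW e p.1 (W ^~ p.2)))%:E)).
    exact: (measurableT_comp mN1 mg).
  by move=> p; rewrite lee_fin.
have psi0 z : (0 <= psi z)%E by apply: integral_ge0 => w _; rewrite lee_fin.
have int_psi : (\int[gauss]_z psi z = 0)%E.
  rewrite -PN.
  rewrite -[RHS]/(P ((fun w => W ^~ w : Rprod (L2fun R) R) @^-1` N)) -integral_indic_comp//.
  rewrite (white_noise_resample hW e1 mN1)//.
  rewrite (@fubini_tonelli1 _ _ _ _ _ gauss P (fun p : mR * Omega =>
    (\1_N (shiftW e p.1 (W ^~ p.2)))%:E))//.
  exact: (measurableT_comp mN1 mg).
pose addf (x : Rprod (L2fun R) R) : Rprod (L2fun R) R :=
  fun phi => x phi + inner (sval phi) (sval f).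
have maddf : measurable_fun setT addf.
  by apply: measurable_Rprod => phi; apply: measurable_funD => //; exact: measurable_coord.
rewrite -[LHS]/(P ((fun w => addf (W ^~ w)) @^-1` N)) -integral_indic_comp//; last first.
  exact: (measurableT_comp maddf mWT).
have mN2 := measurableT_comp mN1 maddf.
rewrite (white_noise_resample hW e1 mN2); last by move=> x; rewrite lee_fin.
rewrite (@fubini_tonelli1 _ _ _ _ _ gauss P (fun p : mR * Omega =>
    (\1_N (addf (shiftW e p.1 (W ^~ p.2))))%:E) (measurableT_comp mN2 mg)); last first.
  by move=> p; rewrite lee_fin.
rewrite -[RHS](normal_shift_null c mpsi psi0 int_psi).
apply: eq_integral => z _; apply: eq_integral => w _; congr (\1_N _)%:E.
by apply/funext => phi; rewrite /addf /shiftW fE /=; ring.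
Qed.

Context (Pi : probability (Rprod nat R) R).
Context (T : Rprod nat R -> Rprod (L2fun R) R) (S : set (Rprod nat R)) (tau : R).
Hypothesis mT : measurable_fun setT T.
Hypothesis mS : measurable S.
Hypothesis PiS : Pi S = 1%E.
Hypothesis tau_gt0 : 0 < tau.

(** Tonelli provides one parameter in [S] whose observations avoid [N] almost surely. Those of
    [theta0] are obtained by translating the noise by [f] divided by [tau], so they avoid [N] as
    well. *)
Lemma marginal_null (theta0 : Rprod nat R) (N : set (Rprod (L2fun R) R)) :
  (forall theta, S theta -> exists f : L2fun R, forall phi,
    T theta0 phi = T theta phi + inner (sval phi) (sval f)) ->
  measurable N ->
  (Pi \x P)%E [set p | N (obs T tau p.1 (W ^~ p.2))] = 0%E ->
  P [set w | N (obs T tau theta0 (W ^~ w))] = 0%E.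
Proof.
move=> diff mN N0; have mWT := white_noise_measurableT hW.
have mobs : measurable_fun setT (fun p : Rprod nat R * Omega => obs T tau p.1 (W ^~ p.2)).
  have mp : measurable_fun setT
      (fun p : Rprod nat R * Omega => (p.1, W ^~ p.2 : Rprod (L2fun R) R)).
    apply: measurable_fun_pair; first exact: measurable_fst.
    exact: measurableT_comp mWT measurable_snd.
  exact: (measurableT_comp (measurable_obs tau mT) mp).
have mN1 : measurable [set p : Rprod nat R * Omega | N (obs T tau p.1 (W ^~ p.2))].
  by rewrite -[X in measurable X]setTI; exact: mobs.
have [theta Stheta Ptheta] : exists2 theta, S theta &
    P [set w | N (obs T tau theta (W ^~ w))] = 0%E.
  apply: contrapT => /forall2NP H.
  have : (\int[Pi]_theta `|P (xsection [set p | N (obs T tau p.1 (W ^~ p.2))] theta)| = 0)%E.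
    by rewrite -N0; apply: eq_integral => theta _; rewrite gee0_abs.
  move/(ae_eq_integral_abs Pi measurableT (@measurable_fun_xsection _ _ _ _ _ P _ mN1)).
  move=> [N' [mN' N'0 sub]].
  have : (Pi S <= Pi N')%E.
    apply: le_measure; rewrite ?inE// => theta Stheta; apply: sub => /= H0.
    have [//|] := H theta; apply; have := H0 Logic.I; rewrite /= => <-.
    by congr (P _); apply/seteqP; split => w /=; rewrite /xsection/= ?inE.
  by rewrite PiS N'0 lee_fin ler10.
have [f diff_f] := diff theta Stheta.
pose f' : L2fun R := exist _ _ (L2Z tau^-1 (svalP f)).
have mN2 : measurable [set x : Rprod (L2fun R) R | N (obs T tau theta x)].
  have mp : measurable_fun setT (fun x : Rprod (L2fun R) R => (theta, x)).
    by apply: measurable_fun_pair.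
  have := measurableT_comp (measurable_obs tau mT) mp => /(_ measurableT N mN).
  by rewrite setTI.
rewrite -[RHS](white_noise_shift_null f' mN2 Ptheta).
congr (P _); apply/seteqP; split => w /=; congr N; apply/funext => phi;
  rewrite /obs diff_f innerZ; try exact: svalP;
  by field; rewrite gt_eqF.
Qed.

End cameron_martin.

Lemma has_law_integral (R : realType) d (T : measurableType d) (P : probability T R)
    (X : T -> R) (m : probability (measurableTypeR R) R) : has_law P X m ->
  forall f : R -> \bar R, measurable_fun setT f -> (forall t, 0 <= f t)%E ->
  (\int[P]_w f (X w) = \int[m]_t f t)%E.
Proof.
move=> [mX lawX] f mf f0.
have := @ge0_integral_pushforward _ _ _ (measurableTypeR R) _ X mX P setT f measurableT mf (fun y _ => f0 y).
rewrite preimage_setT => <-.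
by apply: eq_measure_integral => A mA _; exact: lawX.
Qed.

(** Resampling along [e] turns [W e] into the fresh normal variable. *)
Lemma white_noise_coord (R : realType) d (Omega : measurableType d)
    (P : probability Omega R) (W : L2fun R -> Omega -> R) (e : L2fun R) :
  white_noise P W -> inner (sval e) (sval e) = 1 ->
  forall f : R -> \bar R, measurable_fun setT f -> (forall t, 0 <= f t)%E ->
  (\int[P]_w f (W e w) = \int[normal_prob (0 : R) (1 : R)]_z f z)%E.
Proof.
move=> hW e1 f mf f0.
have mfe := measurableT_comp mf (measurable_coord e).
have mz : measurable_fun setT (fun p : measurableTypeR R * Omega => f p.1).
  exact: (measurableT_comp mf measurable_fst).
rewrite (white_noise_resample hW e1 mfe (fun=> f0 _)).
transitivity (\int[normal_prob (0 : R) (1 : R) \x P]_p f p.1)%E.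
  by apply: eq_integral => p _ /=; rewrite e1 mul1r addrC subrK.
rewrite (@fubini_tonelli1 _ _ _ _ _ (normal_prob (0 : R) (1 : R)) P _ mz (fun=> f0 _)).
apply: eq_integral => z _; rewrite /fubini_F /= integral_cst// -[RHS]mule1.
by congr (_ * _)%E; exact: (@probability_setT _ _ _ P).
Qed.

Section posterior_risk.
Context (R : realType) d (Omega : measurableType d) (P : probability Omega R)
  (W : L2fun R -> Omega -> R) (Pi : probability (Rprod nat R) R).
Context (T : Rprod nat R -> Rprod (L2fun R) R) (S : set (Rprod nat R))
  (tau : R) (s kappa : nat -> R) (e : nat -> L2fun R).
Hypothesis hW : white_noise P W.
Hypothesis indPi : independent Pi (fun j (theta : Rprod nat R) => theta j : R).
Hypothesis lawPi : forall i,
  has_law Pi (fun theta : Rprod nat R => theta i : R) (normal_prob 0 (s i)).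
Hypothesis s_gt0 : forall i, 0 < s i.
Hypothesis tau_gt0 : 0 < tau.
Hypothesis e1 : forall i, inner (sval (e i)) (sval (e i)) = 1.
Hypothesis mT : measurable_fun setT T.
Hypothesis mS : measurable S.
Hypothesis PiS : Pi S = 1%E.
Hypothesis S_upd : forall theta i t, S theta -> S (upd theta i t).
Hypothesis T_upd : forall theta i t phi, S theta ->
  T (upd theta i t) phi = T (upd theta i 0) phi + t * (kappa i * inner (sval phi) (sval (e i))).
Hypothesis T_e : forall theta i, S theta -> T theta (e i) = kappa i * theta i.
Hypothesis T_diff : forall theta0 theta, S theta0 -> S theta ->
  exists f : L2fun R, forall phi, T theta0 phi = T theta phi + inner (sval phi) (sval f).

Local Notation gauss := (normal_prob (0 : R) (1 : R)).
Local Notation Y := (fun p : Rprod nat R * Omega => obs T tau p.1 (W ^~ p.2)).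

Context (Q : R.-pker Rprod (L2fun R) R ~> Rprod nat R).
Hypothesis hQ : forall (A : set (Rprod nat R)) (B : set (Rprod (L2fun R) R)),
  measurable A -> measurable B ->
  ((Pi \x P) [set p | A p.1 /\ B (Y p)] =
   \int[Pi \x P]_(p in [set p | B (Y p)]) Q (Y p) A)%E.

Local Open Scope ereal_scope.

Let mY : measurable_fun setT Y.
Proof.
have mp : measurable_fun setT
    (fun p : Rprod nat R * Omega => (p.1, W ^~ p.2 : Rprod (L2fun R) R)).
  apply: measurable_fun_pair; first exact: measurable_fst.
  exact: measurableT_comp (white_noise_measurableT hW) measurable_snd.
exact: (measurableT_comp (measurable_obs tau mT) mp).
Qed.

Lemma exists_marginal : exists m : {measure set (Rprod (L2fun R) R) -> \bar R},
  (forall B, m B = (Pi \x P) [set p | B (Y p)]) /\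
  forall B f, measurable B -> measurable_fun setT f -> (forall y, 0 <= f y) ->
    \int[m]_(y in B) f y = \int[Pi \x P]_p (f (Y p) * (\1_B (Y p))%:E).
Proof.
unshelve eexists; last split.
- exact: (measure_function_pushforward__canonical__measure_function_Measure (Pi \x P) mY).
- by [].
move=> B f mB mf f0.
rewrite [LHS](@ge0_integral_pushforward _ _ _ _ _ _ mY (Pi \x P) B f)//; last first.
  exact: measurable_funTS.
rewrite integral_mkcond; apply: eq_integral => p _.
rewrite patchE indicE -[p \in _]/(Y p \in B).
by case: ifP => _; rewrite ?mule1 ?mule0.
Qed.

(** The measure giving [A] the joint probability of theta in [A] and Y in [B] is a mixture in two
    ways: of the posterior laws [Q y] over the observation, by [hQ], and of Dirac masses at theta
    over the joint space. *)
Lemma posterior_integral (m : {measure set (Rprod (L2fun R) R) -> \bar R}) :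
  (forall B, m B = (Pi \x P) [set p | B (Y p)]) ->
  (forall B f, measurable B -> measurable_fun setT f -> (forall y, 0 <= f y) ->
    \int[m]_(y in B) f y = \int[Pi \x P]_p (f (Y p) * (\1_B (Y p))%:E)) ->
  forall (G : Rprod nat R -> \bar R) (B : set (Rprod (L2fun R) R)),
  measurable_fun [set: Rprod nat R] G -> (forall theta, 0 <= G theta) -> measurable B ->
  \int[m]_(y in B) \int[Q y]_theta G theta =
  \int[Pi \x P]_p (G p.1 * (\1_B (Y p))%:E).
Proof.
move=> mE m_int G B mG G0 mB.
have mYB : measurable [set p | B (Y p)].
  by rewrite -[X in measurable X]setTI; exact: mY.
pose nu : {measure set (Rprod nat R) -> \bar R} :=
  measure_function_pushforward__canonical__measure_function_Measure
    (mrestr (Pi \x P) mYB) (@measurable_fst _ _ (Rprod nat R) Omega).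
have nuE A : nu A = (Pi \x P) [set p | A p.1 /\ B (Y p)] by [].
have QB y : (0 <= \1_B y :> R)%R by [].
pose k y : {measure set (Rprod nat R) -> \bar R} := mscale (NngNum (QB y)) (Q y).
have kE y A : k y A = (\1_B y)%:E * Q y A by [].
have m1B : measurable_fun setT (fun y : Rprod (L2fun R) R => (\1_B y)%:E : \bar R).
  by apply/measurable_EFinP; exact: measurable_indic.
have QB' p : (0 <= \1_B (Y p) :> R)%R by [].
pose k' (p : Rprod nat R * Omega) : {measure set (Rprod nat R) -> \bar R} :=
  mscale (NngNum (QB' p)) \d_p.1.
have k'E p A : k' p A = (\1_B (Y p))%:E * (\1_A p.1)%:E by [].
transitivity (\int[nu]_theta G theta).
  rewrite (@integral_mixture _ _ _ _ _ m k nu)//.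
  - rewrite [LHS]integral_mkcond; apply: eq_integral => y _.
    rewrite ge0_integral_mscale//= patchE indicE.
    by case: ifP => _; rewrite ?mul1e ?mul0e.
  - move=> A mA; under [X in measurable_fun _ X]eq_fun do rewrite kE.
    apply: emeasurable_funM => //; exact: measurable_kernel.
  - move=> A mA; rewrite nuE hQ//.
    rewrite (_ : \int[m]_y k y A = \int[m]_(y in B) Q y A); last first.
      rewrite [RHS]integral_mkcond; apply: eq_integral => y _.
      rewrite kE patchE indicE.
      by case: ifP => _; rewrite ?mul1e ?mul0e.
    rewrite m_int//; last exact: measurable_kernel.
    rewrite integral_mkcond; apply: eq_integral => p _.
    rewrite patchE indicE -[p \in _]/(Y p \in B).
    by case: ifP => _; rewrite ?mule1 ?mule0.
rewrite (@integral_mixture _ _ _ _ _ (Pi \x P) k' nu)//.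
- apply: eq_integral => p _; rewrite ge0_integral_mscale//=.
  by rewrite integral_dirac// diracT mul1e muleC.
- move=> A mA; under [X in measurable_fun _ X]eq_fun do rewrite k'E.
  apply: emeasurable_funM; first exact: measurableT_comp m1B mY.
  have m1A : measurable_fun setT (\1_A : Rprod nat R -> R) by exact: measurable_indic.
  by apply/measurable_EFinP; exact: (measurableT_comp m1A measurable_fst).
- move=> A mA; rewrite nuE.
  have mAB : measurable [set p | A p.1 /\ B (Y p)].
    apply: measurableI => //; rewrite -[X in measurable X]setTI.
    exact: measurable_fst.
  transitivity (\int[Pi \x P]_p (\1_[set p | A p.1 /\ B (Y p)] p)%:E).
    by rewrite integral_indic// setIT.
  apply: eq_integral => p _.
  rewrite k'E -EFinM !indicE; congr (_%:E).
  rewrite -natrM mulnb; congr (_%:R); congr nat_of_bool.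
  apply/idP/andP => [/set_mem[/= Ap Bp]|[/set_mem Bp /set_mem Ap]]; last exact/mem_set.
  by split; exact/mem_set.
Qed.

Let sqr_dev (c t : R) : \bar R := ((t - c) ^+ 2)%:E.

Let msqr_dev c : measurable_fun setT (sqr_dev c).
Proof. by apply/measurable_EFinP; apply: measurable_funX; exact: measurable_funB. Qed.

Let sqr_dev_ge0 c t : 0 <= sqr_dev c t. Proof. by rewrite lee_fin sqr_ge0. Qed.

Lemma le_normal_sqr_dev (mu sd c : R) : (0 < sd)%R ->
  \int[normal_prob mu sd]_t sqr_dev c t <=
    (2 * (mu - c) ^+ 2 + 2 * sd ^+ 2 * normal_moment2 R)%:E.
Proof.
move=> sd0; rewrite ge0_integral_normal_affine//.
apply: le_trans (le_integral_normal_affine_sqr (mu - c) sd).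
rewrite le_eqVlt; apply/orP; left; apply/eqP; apply: eq_integral => z _.
by rewrite /sqr_dev addrAC.
Qed.

Let post i := post_sd tau s kappa i.
Let slope i := post_slope tau s kappa i.

(** Only one functional of the posterior is identified, the one that the risk is made of. As
    functions of the observation, both sides have the same integral over every event by
    [bayes_coordinate], so they agree almost everywhere for the marginal law; [marginal_null]
    carries the exceptional set over to [theta0]. *)
Lemma posterior_moment (i : nat) (c : R) (theta0 : Rprod nat R) : S theta0 ->
  {ae P, forall w, \int[Q (obs T tau theta0 (W ^~ w))]_theta sqr_dev c (theta i) =
    \int[normal_prob (slope i * obs T tau theta0 (W ^~ w) (e i)) (post i)]_t sqr_dev c t}.
Proof.
move=> Stheta0; have [m [mE m_int]] := exists_marginal.
pose g1 (y : Rprod (L2fun R) R) := \int[Q y]_theta sqr_dev c (theta i).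
pose rho y := \int[normal_prob (slope i * y) (post i)]_t sqr_dev c t.
pose g2 (y : Rprod (L2fun R) R) := rho (y (e i)).
have post0 : (0 < post i)%R by exact: post_sd_gt0.
have mG : measurable_fun setT (fun theta : Rprod nat R => sqr_dev c (theta i)).
  exact: (measurableT_comp (msqr_dev c) (measurable_coord i)).
have mg1 : measurable_fun setT g1.
  apply: (@measurable_fun_integral_kernel _ _ _ _ _ Q) => // U mU.
  exact: measurable_kernel.
have mrho : measurable_fun setT rho by exact: measurable_posterior_integral.
have mg2 : measurable_fun setT g2 := measurableT_comp mrho (measurable_coord (e i)).
have g10 y : 0 <= g1 y by exact: integral_ge0.
have rho0 y : 0 <= rho y by exact: integral_ge0.
have m1B B : measurable B -> measurable_fun setT (fun p : Rprod nat R * Omega => (\1_B (Y p))%:E : \bar R).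
  move=> mB; have m1 : measurable_fun setT (\1_B : Rprod (L2fun R) R -> R) by exact: measurable_indic.
  by apply/measurable_EFinP; exact: (measurableT_comp m1 mY).
have mG1 : measurable_fun setT (fun p : Rprod nat R * Omega => sqr_dev c (p.1 i)).
  exact: (measurableT_comp mG measurable_fst).
have eqB B : measurable B -> \int[m]_(y in B) g1 y = \int[m]_(y in B) g2 y.
  move=> mB; rewrite (m_int B g2 mB mg2 (fun=> rho0 _)).
  rewrite (posterior_integral mE m_int mG (fun=> sqr_dev_ge0 _ _) mB).
  rewrite (@fubini_tonelli1 _ _ _ _ _ Pi P (fun p => sqr_dev c (p.1 i) * (\1_B (Y p))%:E)); first last.
  - by move=> p; apply: mule_ge0; [exact: sqr_dev_ge0|rewrite lee_fin].
  - exact: (emeasurable_funM mG1 (m1B B mB)).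
  rewrite (@fubini_tonelli1 _ _ _ _ _ Pi P (fun p => g2 (Y p) * (\1_B (Y p))%:E)); first last.
  - by move=> p; apply: mule_ge0; [exact: rho0|rewrite lee_fin].
  - exact: (emeasurable_funM (measurableT_comp mg2 mY) (m1B B mB)).
  exact: (bayes_coordinate hW indPi lawPi s_gt0 tau_gt0 e1 mT mS PiS S_upd T_upd T_e i
    (msqr_dev c) (sqr_dev_ge0 c) mB).
(* With the whole space for [B], the mean of the posterior moment is the prior moment, which is
   finite. *)
have int_g1 : m.-integrable setT g1.
  apply/integrableP; split => //.
  have -> : \int[m]_y `|g1 y| = \int[normal_prob 0 (s i)]_t sqr_dev c t.
    under eq_integral do rewrite gee0_abs//.
    rewrite (posterior_integral mE m_int mG (fun=> sqr_dev_ge0 _ _) measurableT).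
    rewrite -(has_law_integral (lawPi i) (msqr_dev c) (sqr_dev_ge0 c)).
    rewrite (@fubini_tonelli1 _ _ _ _ _ Pi P (fun p => sqr_dev c (p.1 i) * (\1_setT (Y p))%:E)); first last.
    - by move=> p; apply: mule_ge0; [exact: sqr_dev_ge0|rewrite lee_fin].
    - exact: (emeasurable_funM mG1 (m1B setT measurableT)).
    apply: eq_integral => theta _; rewrite /fubini_F /=.
    under eq_integral do rewrite indicT mule1.
    rewrite integral_cst// -[RHS]mule1; congr (_ * _).
    exact: (@probability_setT _ _ _ P).
  exact: le_lt_trans (le_normal_sqr_dev 0 c (s_gt0 i)) (ltry _).
have [N [mN N0 sub]] : ae_eq m setT g1 g2.
  by apply: integral_ae_eq => // B _; exact: eqB.
exists ((fun w => obs T tau theta0 (W ^~ w)) @^-1` N); split.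
- have mo : measurable_fun setT (fun w => obs T tau theta0 (W ^~ w)).
    have mp : measurable_fun setT (fun w => (theta0, W ^~ w : Rprod (L2fun R) R)).
      by apply: measurable_fun_pair => //; exact: white_noise_measurableT.
    exact: (measurableT_comp (measurable_obs tau mT) mp).
  by rewrite -[X in measurable X]setTI; exact: mo.
- apply: (marginal_null hW mT mS PiS tau_gt0 _ mN) => [theta|].
    exact: T_diff.
  by rewrite -mE.
- by move=> w /= ne; apply: sub => /= eq12; apply: ne; exact: eq12.
Qed.

(** Applying (x + y)^2 <= 2 x^2 + 2 y^2 under the posterior, then under [P], yields 4 times the
    squared bias plus 4 + 2 second moments times the posterior variance; the sum dominates both
    coefficients. *)
Let risk_const : R := 4 + 6 * normal_moment2 R.

Lemma coordinate_risk (i : nat) (theta0 : Rprod nat R) : S theta0 ->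
  \int[P]_w \int[Q (obs T tau theta0 (W ^~ w))]_theta sqr_dev (theta0 i) (theta i) <=
  (risk_const * (post i ^+ 2 + (1 - slope i * kappa i) ^+ 2 * theta0 i ^+ 2))%:E.
Proof.
move=> Stheta0; set c := theta0 i.
have post0 : (0 < post i)%R by exact: post_sd_gt0.
have M0 := normal_moment2_ge0 R.
have mo : measurable_fun setT (fun w => obs T tau theta0 (W ^~ w)).
  have mp : measurable_fun setT (fun w => (theta0, W ^~ w : Rprod (L2fun R) R)).
    by apply: measurable_fun_pair => //; exact: white_noise_measurableT.
  exact: (measurableT_comp (measurable_obs tau mT) mp).
pose g1 (y : Rprod (L2fun R) R) := \int[Q y]_theta sqr_dev c (theta i).
have mg1 : measurable_fun setT g1.
  apply: (@measurable_fun_integral_kernel _ _ _ _ _ Q) => [U mU|theta|].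
  - exact: measurable_kernel.
  - exact: sqr_dev_ge0.
  - exact: (measurableT_comp (msqr_dev c) (measurable_coord i)).
(* With z = W(e_i), the posterior mean minus [c] is [b * c + v * z]: a bias and a noise term. *)
pose b := (slope i * kappa i - 1)%R; pose v := (slope i * tau)%R.
pose h z := (2 * (b * c + v * z) ^+ 2 + 2 * post i ^+ 2 * normal_moment2 R)%R.
have mlin : measurable_fun setT (fun z : R => b * c + v * z)%R.
  by apply: measurable_funD => //; exact: measurable_funM.
have msq : measurable_fun setT (fun z : R => ((b * c + v * z) ^+ 2)%R).
  exact: measurable_funX.
have mh : measurable_fun setT (EFin \o h).
  by apply/measurable_EFinP; apply: measurable_funD => //; exact: measurable_funM.
have h0 z : 0 <= (EFin \o h) z.
  have := mulr_ge0 (sqr_ge0 (post i)) M0; have := sqr_ge0 (b * c + v * z).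
  rewrite lee_fin /h; lra.
apply: (@le_trans _ _ (\int[P]_w (EFin \o h) (W (e i) w))).
  apply: ae_ge0_le_integral => //.
  - by move=> w _; apply: integral_ge0.
  - exact: (measurableT_comp mg1 mo).
  - exact: (measurableT_comp mh (white_noise_measurable hW (e i))).
  apply: filterS (posterior_moment i c Stheta0) => w -> _.
  apply: le_trans (le_normal_sqr_dev _ _ post0) _.
  rewrite lee_fin /h /obs T_e// le_eqVlt; apply/orP; left; apply/eqP.
  by congr (2 * _ ^+ 2 + _)%R; rewrite /b /v -/c; ring.
rewrite (white_noise_coord hW (e1 i) mh h0).
have -> : \int[gauss]_z (EFin \o h) z =
    2%:E * \int[gauss]_z ((b * c + v * z) ^+ 2)%:E + (2 * post i ^+ 2 * normal_moment2 R)%:E.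
  rewrite -ge0_integralZl//; first last.
  - by move=> z _; rewrite lee_fin sqr_ge0.
  - exact/measurable_EFinP.
  have -> : (2 * post i ^+ 2 * normal_moment2 R)%:E =
      \int[gauss]_z (2 * post i ^+ 2 * normal_moment2 R)%:E.
    rewrite integral_cst// -[LHS]mule1; congr (_ * _).
    exact/esym/(@probability_setT _ _ _ (normal_prob (0 : R) (1 : R))).
  rewrite -ge0_integralD//.
  - by move=> z _; rewrite mule_ge0// lee_fin sqr_ge0.
  - by apply: measurable_funeM; exact/measurable_EFinP.
  - by move=> z _; rewrite lee_fin mulr_ge0// mulr_ge0// sqr_ge0.
(* The noise in the posterior mean is at most the posterior spread: their ratio is kappa s / r, of
   absolute value at most 1 because r^2 = kappa^2 s^2 + tau^2. *)
have v_post : (v ^+ 2 <= post i ^+ 2)%R.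
  rewrite /v /slope /post /post_slope /post_sd.
  have r0 := marg_sd_gt0 s kappa tau_gt0 i; have r2 := marg_sd_sqr tau s kappa i.
  set r := marg_sd _ _ _ _ in r0 r2 *.
  have -> : (kappa i * s i ^+ 2 / r ^+ 2 * tau = (kappa i * s i / r) * (s i * tau / r))%R.
    by field; rewrite gt_eqF.
  rewrite exprMn ler_piMl ?sqr_ge0// expr_div_n ler_pdivrMr ?exprn_gt0// mul1r r2.
  by rewrite exprMn lerDl sqr_ge0.
apply: (@le_trans _ _ (2%:E * (2 * (b * c) ^+ 2 + 2 * v ^+ 2 * normal_moment2 R)%:E
    + (2 * post i ^+ 2 * normal_moment2 R)%:E)).
  by rewrite leeD2r// lee_pmul2l// le_integral_normal_affine_sqr.
rewrite -EFinM -EFinD lee_fin /risk_const exprMn.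
have -> : ((1 - slope i * kappa i) ^+ 2 = b ^+ 2)%R by rewrite /b -sqrrN opprB.
have := ler_wpM2r M0 v_post; have := sqr_ge0 (b * c); have := sqr_ge0 (post i).
have := mulr_ge0 (sqr_ge0 (b * c)) M0; rewrite exprMn; nra.
Qed.

Lemma posterior_risk (theta0 : Rprod nat R) (wt : nat -> R) : S theta0 ->
  (forall i, (0 <= wt i)%R) ->
  \int[P]_w \int[Q (obs T tau theta0 (W ^~ w))]_theta
    (\sum_(i <oo) (wt i * (theta i - theta0 i) ^+ 2)%:E) <=
  risk_const%:E * \sum_(i <oo)
    (wt i * (post i ^+ 2 + (1 - slope i * kappa i) ^+ 2 * theta0 i ^+ 2))%:E.
Proof.
move=> Stheta0 wt0.
have risk0 : (0 <= risk_const)%R.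
  by rewrite addr_ge0// mulr_ge0// normal_moment2_ge0.
have mo : measurable_fun setT (fun w => obs T tau theta0 (W ^~ w)).
  have mp : measurable_fun setT (fun w => (theta0, W ^~ w : Rprod (L2fun R) R)).
    by apply: measurable_fun_pair => //; exact: white_noise_measurableT.
  exact: (measurableT_comp (measurable_obs tau mT) mp).
have msq i : measurable_fun setT (fun theta : Rprod nat R => sqr_dev (theta0 i) (theta i)).
  exact: (measurableT_comp (msqr_dev _) (measurable_coord i)).
pose g i (y : Rprod (L2fun R) R) := \int[Q y]_theta sqr_dev (theta0 i) (theta i).
have mg i : measurable_fun setT (g i).
  apply: (@measurable_fun_integral_kernel _ _ _ _ _ Q) => [U mU|theta|//].
  - exact: measurable_kernel.
  - exact: sqr_dev_ge0.
have g0 i y : 0 <= g i y by apply: integral_ge0.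
have -> : \int[P]_w \int[Q (obs T tau theta0 (W ^~ w))]_theta
    (\sum_(i <oo) (wt i * (theta i - theta0 i) ^+ 2)%:E) =
  \sum_(i <oo) \int[P]_w ((wt i)%:E * g i (obs T tau theta0 (W ^~ w))).
  rewrite -integral_nneseries//; first last.
  - by move=> i w _; apply: mule_ge0; [rewrite lee_fin|exact: g0].
  - by move=> i; apply: measurable_funeM; exact: (measurableT_comp (mg i) mo).
  apply: eq_integral => w _; rewrite integral_nneseries//; first last.
  - by move=> i theta _; rewrite lee_fin mulr_ge0// sqr_ge0.
  - by move=> i; under [X in measurable_fun _ X]eq_fun do rewrite EFinM;
      apply: measurable_funeM; exact: msq.
  apply: eq_eseriesr => i _; under eq_integral do rewrite EFinM.
  apply: (@ge0_integralZl _ _ _ (Q _) _ measurableT (fun theta => sqr_dev (theta0 i) (theta i))) => //.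
  by rewrite lee_fin.
rewrite -nneseriesZl//; last first.
  by move=> i _; rewrite lee_fin mulr_ge0// addr_ge0 ?sqr_ge0// -exprMn sqr_ge0.
apply: lee_nneseries => i _.
  by move=> _; apply: integral_ge0 => w _; apply: mule_ge0; [rewrite lee_fin|exact: g0].
rewrite ge0_integralZl//; [|exact: (measurableT_comp (mg i) mo)|by rewrite lee_fin].
rewrite -EFinM mulrCA EFinM; apply: lee_wpmul2l; first by rewrite lee_fin.
exact: coordinate_risk.
Qed.

End posterior_risk.

(** * The fundamental theorem of calculus for everywhere derivable functions *)

Section everywhere_derivable_FTC.
Context (R : realType).
Local Notation mu := (@lebesgue_measure R).

(* Vitali-Caratheodory: an integrable nonnegative function has a majorant, of
   almost the same integral, that exceeds it by a constant near every point. *)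
Lemma lsc_majorant (f : R -> R) (a b eps : R) : a < b -> 0 < eps ->
  measurable_fun `[a, b] f -> (forall x, `[a, b]%classic x -> 0 <= f x) ->
  exists g : R -> \bar R, [/\ measurable_fun setT g, (forall x, (0 <= g x)%E),
    (\int[mu]_(x in `[a, b]) g x <= \int[mu]_(x in `[a, b]) (f x)%:E + eps%:E)%E &
    forall x, `[a, b]%classic x -> exists c U, [/\ f x < c, open U, U x &
      forall y, U y -> (c%:E <= g y)%E] ].
Proof.
move=> ab eps0 mf f0; set D := `[a, b]%classic.
have muD : mu D = (b - a)%:E by rewrite lebesgue_measure_itv/= lte_fin ab EFinB.
have mD : measurable D by exact: measurable_itv.
have ba0 : 0 < b - a by rewrite subr_gt0.
(* Half of [eps] pays for rounding [f] up to the next multiple of the mesh [r], over an interval of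
   length b - a. *)
pose r := eps / 2 / (b - a); have r0 : 0 < r by rewrite !divr_gt0.
pose c (k : nat) : R := k.+1%:R * r.
have c0 k : 0 < c k by rewrite mulr_gt0.
pose E k := D `&` [set x | k%:R * r <= f x < c k].
have mE k : measurable (E k).
  have -> : E k = D `&` f @^-1` `[k%:R * r, c k[%classic.
    by apply/seteqP; split => x /= []; rewrite in_itv.
  exact: mf.
have muE k : (mu (E k) < +oo)%E.
  apply: (@le_lt_trans _ _ (mu D)); last by rewrite muD ltry.
  by apply: le_measure => [| |x []//]; rewrite inE; [exact: mE|exact: mD].
(* The other half pays for enlarging the slices [E k] to open sets: the excess of slice [k] costs at
   most [c k * del k], a geometric series of sum eps / 2. *)
pose del k : R := eps / 2 / (2 ^ k.+1)%:R / c k.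
have del0 k : 0 < del k by rewrite !divr_gt0// ltr0n expn_gt0.
have /choice[V VP] : forall k, exists U : set R,
    [/\ open U, E k `<=` U & (mu (U `\` E k) < (del k)%:E)%E].
  by move=> k; exact: (lebesgue_regularity_outer (mE k) (muE k) (del0 k)).
have mV k : measurable (V k) by have [oV _ _] := VP k; exact: open_measurable.
(* Each [V k] will be open, and [g] is at least [c k] on it, a level that [f] does not reach on the
   slice [E k]. *)
pose g (x : R) : \bar R := (\sum_(k <oo) (c k)%:E * (\1_(V k) x)%:E)%E.
have term_ge0 (A : nat -> set R) k (x : R) : (0 <= (c k)%:E * (\1_(A k) x)%:E)%E.
  by apply: mule_ge0; rewrite lee_fin// ltW.
have mterm (A : set R) k : measurable A ->
    measurable_fun setT (fun x : R => ((c k)%:E * (\1_A x)%:E)%E).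
  by move=> mA; apply: measurable_funeM; apply/measurable_EFinP; exact: measurable_indic.
have msum (A : nat -> set R) : (forall k, measurable (A k)) ->
    measurable_fun setT (fun x : R => \sum_(k <oo) (c k)%:E * (\1_(A k) x)%:E)%E.
  move=> mA; apply: ge0_emeasurable_sum => [k x _ _|k _]; first exact: term_ge0.
  exact: mterm.
exists g; split.
- exact: msum.
- by move=> x; apply: nneseries_ge0 => k _ _; exact: term_ge0.
- have kP x : D x -> exists k, E k x /\ forall j, E j x -> j = k.
    move=> Dx; exists (Num.truncn (f x / r)).
    have fr0 : 0 <= f x / r by rewrite divr_ge0 ?f0// ltW.
    have /andP[t1 t2] := truncn_itv fr0.
    split=> [|j [_ /= /andP[h1 h2]]].
      by split => //=; rewrite -ler_pdivlMr// -ltr_pdivrMr// t1.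
    by apply/esym/truncn_def; rewrite ler_pdivlMr// ltr_pdivrMr// h1.
  pose gE (x : R) : \bar R := (\sum_(k <oo) (c k)%:E * (\1_(E k) x)%:E)%E.
  pose gV (x : R) : \bar R := (\sum_(k <oo) (c k)%:E * (\1_(V k `\` E k) x)%:E)%E.
  have g_le x : (g x <= gE x + gV x)%E.
    rewrite /gE /gV -nneseriesD; [|by move=> *; exact: term_ge0|by move=> *; exact: (term_ge0 (fun k => V k `\` E k))].
    apply: lee_nneseries => k _; first by move=> _; exact: term_ge0.
    rewrite -!EFinM -EFinD lee_fin -mulrDr ler_wpM2l ?(ltW (c0 k))// !indicE in_setD.
    by rewrite -natrD ler_nat; case: (x \in V k); case: (x \in E k).
  have gE_le x : D x -> (gE x <= (f x)%:E + r%:E)%E.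
    move=> Dx; have [k [Ekx kuniq]] := kP x Dx.
    rewrite /gE (nneseriesD1 (n := k) (fun j _ => term_ge0 E j x))//.
    rewrite eseries0 ?adde0; last first.
      move=> j _ /= jk; rewrite indicE memNset ?mule0// => /kuniq jk'.
      by rewrite jk' eqxx in jk.
    rewrite indicE mem_set// mule1 -EFinD lee_fin /c.
    by case: Ekx => _ /= /andP[h1 _]; rewrite -natr1 mulrDl mul1r lerD2r.
  have mgE : measurable_fun setT gE by exact: msum.
  have mgV : measurable_fun setT gV.
    by apply: (msum (fun k => V k `\` E k)) => k; exact: measurableD.
  have gE0 x : (0 <= gE x)%E by apply: nneseries_ge0 => k _ _; exact: term_ge0.
  have gV0 x : (0 <= gV x)%E.
    by apply: nneseries_ge0 => k _ _; exact: (term_ge0 (fun k => V k `\` E k)).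
  have mg : measurable_fun setT g by exact: msum.
  apply: (@le_trans _ _ (\int[mu]_(x in D) (gE x + gV x))%E).
    apply: ge0_le_integral => //.
    - by move=> x _; apply: nneseries_ge0 => k _ _; exact: term_ge0.
    - exact: measurable_funTS.
    - by apply: measurable_funTS; exact: emeasurable_funD.
  rewrite ge0_integralD//; [|exact: measurable_funTS|exact: measurable_funTS].
  apply: (@le_trans _ _ ((\int[mu]_(x in D) (f x)%:E + (eps / 2)%:E) + (eps / 2)%:E)%E); last first.
    by rewrite -addeA -EFinD -splitr.
  apply: leeD.
    apply: (@le_trans _ _ (\int[mu]_(x in D) ((f x)%:E + r%:E))%E).
      apply: ge0_le_integral => //; first exact: measurable_funTS.
      by apply: emeasurable_funD => //; exact/measurable_EFinP.
    rewrite ge0_integralD//.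
    - rewrite leeD2l// integral_cst//= muD -EFinM lee_fin /r divfK// gt_eqF//.
    - exact/measurable_EFinP.
    - by move=> x _; rewrite lee_fin ltW.
  apply: (@le_trans _ _ (\int[mu]_x gV x)%E).
    apply: ge0_subset_integral => //; exact: mgV.
  rewrite integral_nneseries//; last 2 first.
  - by move=> k; apply: mterm; exact: measurableD.
  - by move=> k x _; exact: (term_ge0 (fun k => V k `\` E k)).
  apply: (@le_trans _ _ (\sum_(k <oo) (eps / 2 / (2 ^ k.+1)%:R)%:E)%E); last first.
    by apply: epsilon_trick0; rewrite ltW// divr_gt0.
  apply: lee_nneseries => k _.
    by move=> _; apply: integral_ge0 => x _; exact: (term_ge0 (fun k => V k `\` E k)).
  have mVE : measurable (V k `\` E k) by exact: measurableD.
  rewrite ge0_integralZl//; last 2 first.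
  - by apply/measurable_EFinP; exact: measurable_indic.
  - by rewrite lee_fin ltW.
  rewrite integral_indic// setIT.
  apply: (@le_trans _ _ ((c k)%:E * (del k)%:E)%E).
    apply: lee_wpmul2l; first by rewrite lee_fin ltW.
    by have [_ _ /ltW] := VP k.
  by rewrite -EFinM lee_fin /del mulrC divfK// gt_eqF.
move=> x Dx.
pose k := Num.truncn (f x / r).
have fr0 : 0 <= f x / r by rewrite divr_ge0 ?f0// ltW.
have /andP[t1 t2] := truncn_itv fr0.
have Ekx : E k x by split => //=; rewrite -ler_pdivlMr// -ltr_pdivrMr// t1.
have [oV EV _] := VP k.
exists (c k), (V k); split => //; first by case: Ekx => _ /= /andP[].
  exact: EV.
move=> y Vy; rewrite /g (nneseriesD1 (n := k) (fun j _ => term_ge0 V j y))//.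
rewrite indicE mem_set// mule1 leeDl//.
by apply: nneseries_ge0 => j _ _; exact: term_ge0.
Qed.

Lemma derive1_lt_near (F : R -> R) (x c : R) : derivable F x 1 -> derive1 F x < c ->
  \forall y \near x^'+, F y - F x <= c * (y - x).
Proof.
move=> dF; rewrite derive1E => Fc.
have /cvgr_lt/(_ _ Fc) : h^-1 *: (F (h *: 1 + x) - F x) @[h --> 0^'] --> 'D_1 F x by [].
move=> /nbhs_ballP[e /= e0 He].
near=> y; have yx : 0 < y - x by rewrite subr_gt0; near: y; exact: nbhs_right_gt.
have := He (y - x); rewrite /ball/= sub0r normrN gtr0_norm// => /(_ _ (lt0r_neq0 yx)).
rewrite [_ *: 1]mulr1 subrK [_ *: _]mulrC ltr_pdivrMr// => /(_ _)/ltW; apply.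
by rewrite ltrBlDl; near: y; apply: nbhs_right_lt; rewrite ltrDl.
Unshelve. all: by end_near. Qed.

(** Let G be the indefinite integral of the majorant [g] of [f]. If the increment of [F] exceeded G
    at [b], consider the infimum [i] of the points where it does. It is not such a point itself, and
    there are none just to its right either, which contradicts the infimum. *)
Lemma increment_le_integral (F f : R -> R) (a b : R) : a < b ->
  (forall x, `[a, b]%classic x -> derivable F x 1 /\ derive1 F x <= f x) ->
  measurable_fun `[a, b] f -> (forall x, `[a, b]%classic x -> 0 <= f x) ->
  ((F b - F a)%:E <= \int[mu]_(x in `[a, b]) (f x)%:E)%E.
Proof.
move=> ab dF mf f0.
have [->|foo] := eqVneq (\int[mu]_(x in `[a, b]) (f x)%:E)%E +oo%E; first exact: leey.
have {}foo : (\int[mu]_(x in `[a, b]) (f x)%:E < +oo)%E by rewrite ltey.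
apply/lee_addgt0Pr => eps eps0.
have [g [mg g0 int_g gP]] := lsc_majorant ab eps0 mf f0.
apply: le_trans int_g.
pose G y := (\int[mu]_(x in `[a, y]) g x)%E.
rewrite -/(G b); case: (leP (F b - F a)%:E (G b)) => // bad; exfalso.
pose B := [set y | a <= y <= b /\ (G y < (F y - F a)%:E)%E].
have Bb : B b by split => //; rewrite lexx ltW.
have lbB : has_lbound B by exists a => y [/andP[]].
have hiB : has_inf B by split => //; exists b.
set i := inf B.
have ai : a <= i by apply: lb_le_inf; [exists b|move=> y [/andP[]]].
have ib : i <= b by apply: ge_inf.
have G_mono x y : x <= y -> (G x <= G y)%E.
  move=> xy; apply: ge0_subset_integral => //; first exact: measurable_funTS.
  by move=> t /=; rewrite !in_itv/= => /andP[-> /le_trans]; exact.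
have G0 y : (0 <= G y)%E by apply: integral_ge0.
have iD : `[a, b]%classic i by rewrite /= in_itv/= ai.
have [dFi Fi] := dF i iD.
(* If [i] were bad, left continuity of [F] and monotonicity of [G] would make some point to its left
   bad. *)
have good : ((F i - F a)%:E <= G i)%E.
  rewrite leNgt; apply/negP => badi.
  have {}ai : a < i.
    rewrite lt_neqAle ai andbT; apply/eqP => ai'.
    by move: badi; rewrite -ai' subrr ltNge G0.
  have cF : F y - F a @[y --> i^'-] --> F i - F a.
    apply: cvgB; last exact: cvg_cst.
    by apply: cvg_at_left_filter; apply: differentiable_continuous; apply/derivable1_diffP.
  have Gi : G i \is a fin_num.
    by rewrite ge0_fin_numE// (lt_trans badi)// ltry.
  have : fine (G i) < F i - F a by rewrite -lte_fin fineK.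
  move=> /(cvgr_gt _ cF) near_gt.
  near (i^'-) => y.
  have yi : y < i by near: y; exact: nbhs_left_lt.
  have : B y.
    split; first by apply/andP; split; [rewrite ltW//; near: y; exact: nbhs_left_gt|exact: ltW (lt_le_trans yi ib)].
    apply: (@le_lt_trans _ _ (G i)); first exact/G_mono/ltW.
    by rewrite -(fineK Gi) lte_fin; near: y; exact: near_gt.
  by move=> /(ge_inf lbB); rewrite leNgt yi.
have {}ib : i < b.
  rewrite lt_neqAle ib andbT; apply/eqP => ib'.
  by move: bad; rewrite ltNge -ib' good.
(* The derivative of [F] at [i] is at most [f i], hence below [c], while [g] is at least [c] around
   [i]: just to the right of [i], increments of [F] from [i] stay below those of [G]. *)
have [c [U [fc oU Ui gU]]] := gP i iD.
have near_F := derive1_lt_near dFi (le_lt_trans Fi fc).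
have [e /= e0 eU] : \forall y \near i, U y by exact: open_nbhs_nbhs.
have [e' /= e'0 eF] := near_F.
pose m := Num.min e e'; have m0 : 0 < m by rewrite lt_min e0.
have [y By yim] := inf_adherent m0 hiB.
have iy : i < y.
  rewrite lt_neqAle (ge_inf lbB By) andbT; apply/eqP => iy.
  by case: By => _; rewrite -iy ltNge good.
have {}Fy : F y - F i <= c * (y - i).
  apply: eF => //; rewrite /ball/= distrC gtr0_norm ?subr_gt0//.
  by rewrite ltrBlDl (lt_le_trans yim)// lerD2l ge_min lexx orbT.
case: By => _; rewrite ltNge => /negP; apply.
have -> : G y = (G i + \int[mu]_(x in `]i, y]) g x)%E.
  rewrite /G -ge0_integral_setU//.
  - congr (integral _ _ _); apply/seteqP; split => t /=; rewrite !in_itv/=.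
      by move=> /andP[at_ ty]; case: (leP t i) => it; [left|right]; rewrite ?at_ ?ty.
    move=> [/andP[at_ ti]|/andP[it ty]].
      by rewrite at_ (le_trans ti (ltW iy)).
    by rewrite ty (le_trans ai (ltW it)).
  - exact: measurable_funTS.
  - apply/disj_set2P; rewrite -subset0 => t [] /=; rewrite !in_itv/= => /andP[_ ti] /andP[it _].
    by move: (lt_le_trans it ti); rewrite ltxx.
apply: (@le_trans _ _ ((F i - F a)%:E + (c * (y - i))%:E)%E).
  by rewrite -EFinD lee_fin; lra.
apply: leeD => //.
apply: (@le_trans _ _ (\int[mu]_(x in `]i, y]) c%:E)%E).
  by rewrite integral_cst//= lebesgue_measure_itv/= lte_fin iy -EFinB -EFinM.
have [c0|c0] := leP 0 c.
  apply: ge0_le_integral => //; first exact: measurable_funTS.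
  move=> x /=; rewrite in_itv/= => /andP[ix xy]; apply: gU; apply: eU.
  rewrite /ball/= distrC gtr0_norm ?subr_gt0//.
  by rewrite ltrBlDl (le_lt_trans xy)// (lt_le_trans yim)// lerD2l ge_min lexx.
apply: (@le_trans _ _ 0%E); last exact: integral_ge0.
by rewrite integral_cst//= mule_le0_ge0// lee_fin ltW.
Unshelve. all: by end_near. Qed.

(** [f] is truncated below at -N, and N x is added to [F] to reach the nonnegative case; as N tends
    to infinity, dominated convergence removes the truncation. *)
Lemma increment_le_signed_integral (F f : R -> R) (a b : R) : a < b ->
  (forall x, `[a, b]%classic x -> derivable F x 1 /\ derive1 F x = f x) ->
  mu.-integrable `[a, b] (EFin \o f) ->
  ((F b - F a)%:E <= \int[mu]_(x in `[a, b]) (f x)%:E)%E.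
Proof.
move=> ab dF intf; have mf : measurable_fun `[a, b] f.
  by apply/measurable_EFinP; exact: measurable_int intf.
pose fN (N : nat) x := Num.max (f x) (- N%:R).
have mfN N : measurable_fun `[a, b] (fN N).
  exact: (@measurable_maxr _ _ _ _ f (fun=> - N%:R) mf (measurable_cst _)).
have fN_le N x : `|fN N x| <= `|f x|.
  rewrite /fN; have [fx|fx] := leP (f x) (- N%:R) => //.
  have N0 : - N%:R <= 0 :> R by rewrite oppr_le0.
  by rewrite !ler0_norm ?(le_trans fx)// lerN2.
have intfN N : mu.-integrable `[a, b] (EFin \o fN N).
  apply: (@le_integrable _ _ _ mu _ _ _ (EFin \o f)) => //; first by apply/measurable_EFinP; exact: mfN.
  by move=> x _; rewrite /= lee_fin.
have le_N N : ((F b - F a)%:E <= \int[mu]_(x in `[a, b]) (fN N x)%:E)%E.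
  have incr := @increment_le_integral (fun x => F x + N%:R * x) (fun x => fN N x + N%:R) a b ab.
  have intN : mu.-integrable `[a, b] (EFin \o cst (N%:R : R)).
    apply/integrableP; split; first by apply/measurable_EFinP.
    by rewrite /= integral_cst//= lebesgue_measure_itv/= lte_fin ab -EFinB -EFinM ltry.
  have : ((F b + N%:R * b - (F a + N%:R * a))%:E <=
      \int[mu]_(x in `[a, b]) (fN N x + N%:R)%:E)%E.
    apply: incr.
    - move=> x xab; have [dFx Fx] := dF x xab.
      have dlin : is_derive x 1 (fun x : R => N%:R * x) N%:R.
        by apply: is_derive_eq; rewrite [_ *: _]mulr1.
      have dFi : is_derive x 1 F (derive1 F x) by rewrite derive1E; exact: DeriveDef.
      split; first exact: ex_derive.
      by rewrite derive1E derive_val Fx lerD2r /fN le_max lexx.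
    - exact: measurable_funD.
    - by move=> x _; rewrite -lerBlDr sub0r /fN le_max lexx orbT.
  under eq_integral do rewrite EFinD.
  have intc : (\int[mu]_(_ in `[a, b]) (N%:R)%:E = (N%:R * (b - a))%:E)%E.
    by rewrite integral_cst//= lebesgue_measure_itv/= lte_fin ab -EFinB -EFinM.
  rewrite integralD//=; last exact: intfN.
  rewrite intc.
  rewrite (_ : F b + _ - _ = F b - F a + N%:R * (b - a)); last by ring.
  by rewrite EFinD leeD2rE.
have := @dominated_convergence _ _ _ mu `[a, b] (measurable_itv _) (fun N => EFin \o fN N) (EFin \o f) (fun x => `|f x|%:E).
case.
- by move=> N; apply/measurable_EFinP; exact: mfN.
- by apply/measurable_EFinP; exact: mf.
- apply: aeW => x _; apply: cvg_near_cst; near=> N; rewrite /= /fN.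
  congr EFin; apply/max_idPl; rewrite lerNl.
  near: N; have [n fn] : exists n : nat, - f x <= n%:R.
    by exists (Num.truncn `|- f x|).+1; rewrite (le_trans (ler_norm _))// ltW// truncnS_gt.
  by exists n => // N /= nN; rewrite (le_trans fn)// ler_nat.
- by apply: (integrable_abse intf).
- by apply: aeW => x N _; rewrite /= lee_fin.
move=> _ _ cvg_int; rewrite -(cvg_lim _ cvg_int)//; apply: lime_ge; [exact: (cvgP _ cvg_int)|exact: nearW].
Unshelve. all: by end_near. Qed.

(** The one-sided bound is applied to [F] and to its opposite. *)
Lemma everywhere_derivable_FTC (F f : R -> R) (a b : R) : a < b ->
  (forall x, `[a, b]%classic x -> derivable F x 1 /\ derive1 F x = f x) ->
  mu.-integrable `[a, b] (EFin \o f) ->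
  ((F b - F a)%:E = \int[mu]_(x in `[a, b]) (f x)%:E)%E.
Proof.
move=> ab dF intf; apply/eqP; rewrite eq_le increment_le_signed_integral//=.
have intNf : mu.-integrable `[a, b] (EFin \o (fun x => - f x)).
  exact: (integrableN intf).
have dNF x : `[a, b]%classic x -> derivable (fun x => - F x) x 1 /\ derive1 (fun x => - F x) x = - f x.
  move=> /dF[dFx Fx]; split; first exact: derivableN.
  by rewrite derive1E deriveN// -derive1E Fx.
have := increment_le_signed_integral ab dNF intNf.
under eq_integral do rewrite EFinN.
rewrite integralN/=; last exact: integrable_add_def.
by rewrite leeNr -EFinN opprB opprK addrC.
Qed.

End everywhere_derivable_FTC.

(** * Risk bounds in the sequence model *)

Section power_sums.
Context (R : realType).
Implicit Types (x y s e p N : R).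

Lemma powRDp x r s : 0 < x -> x `^ (r + s) = x `^ r * x `^ s.
Proof. by move=> x0; rewrite powRD// (gt_eqF x0)/= implybT. Qed.

Lemma le_powRN x y s : 0 < x -> x <= y -> 0 <= s -> y `^ (- s) <= x `^ (- s).
Proof.
move=> x0 xy s0; have y0 := lt_le_trans x0 xy.
by rewrite !powRN lef_pV2 ?posrE ?powR_gt0// ge0_ler_powR// nnegrE ltW.
Qed.

(** A discrete substitute for integrating x^(-1-s). From ln(1 + 1/x) >= 1/(x+1) >= 1/(2x), the ratio
    ((x+1)/x)^(-s) is at most 1/(1+y) with y = s/(2x). What remains is 1/x <= (2+s)/(2x+s), an
    equality at x = 1, which explains the constant. *)
Lemma powRN_telescope x s : 1 <= x -> 0 < s ->
  x `^ (- 1 - s) <= (2 + s) / s * (x `^ (- s) - (x + 1) `^ (- s)).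
Proof.
move=> x1 s0; have x0 : 0 < x by exact: lt_le_trans x1.
pose y := s / (2 * x); have y0 : 0 < y by rewrite divr_gt0// mulr_gt0.
have ratio : ((x + 1) / x) `^ (- s) <= (1 + y)^-1.
  rewrite powRN lef_pV2 ?posrE ?powR_gt0 ?divr_gt0 ?addr_gt0//.
  have ln_ge : (2 * x)^-1 <= ln ((x + 1) / x).
    rewrite -[leRHS]opprK -lnV ?posrE ?divr_gt0 ?addr_gt0// invf_div lerNr.
    have := @le_ln1Dx R (- (x + 1)^-1); rewrite (_ : 1 + - _ = x / (x + 1)); last first.
      by field; rewrite gt_eqF// addr_gt0.
    move=> /(_ _)/le_trans; apply.
      by rewrite ltrN2 invf_lt1 ?addr_gt0// ltrDr.
    by rewrite lerN2 lef_pV2 ?posrE ?addr_gt0 ?mulr_gt0//; lra.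
  rewrite /powR gt_eqF ?divr_gt0 ?addr_gt0//.
  apply: le_trans (expR_ge1Dx _); rewrite lerD2l /y ler_pM2l//.
have -> : (x + 1) `^ (- s) = x `^ (- s) * ((x + 1) / x) `^ (- s).
  rewrite -powRM ?divr_ge0 ?addr_ge0 ?(ltW x0)//; congr (_ `^ _).
  by field; rewrite gt_eqF.
have xs0 : 0 < x `^ (- s) by exact: powR_gt0.
rewrite powRDp// powR_inv1 ?(ltW x0)// -[X in X - _ * _]mulr1 -mulrBr.
rewrite mulrCA [leLHS]mulrC ler_pM2l//.
apply: (@le_trans _ _ ((2 + s) / s * (1 - (1 + y)^-1))); last first.
  by rewrite ler_pM2l ?divr_gt0 ?addr_gt0// lerD2l lerN2.
have -> : 1 - (1 + y)^-1 = s / (2 * x + s).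
  by rewrite /y; field; rewrite !gt_eqF ?addr_gt0 ?mulr_gt0.
rewrite mulrA divfK ?gt_eqF// ler_pdivlMr ?addr_gt0 ?mulr_gt0//.
by rewrite mulrC ler_pdivrMr//; nra.
Qed.

Lemma sum_powRN_le s k : 0 < s ->
  \sum_(i < k) (i.+1%:R : R) `^ (- 1 - s) <= (2 + s) / s.
Proof.
move=> s0; have c0 : 0 < (2 + s) / s by rewrite divr_gt0 ?addr_gt0.
pose g (i : nat) : R := i.+1%:R `^ (- s).
apply: (@le_trans _ _ ((2 + s) / s * \sum_(0 <= i < k) (g i - g i.+1))).
  rewrite mulr_sumr big_mkord; apply: ler_sum => i _.
  by rewrite /g -[i.+2%:R]natr1; apply: powRN_telescope => //; rewrite ler1n.
rewrite -[leRHS]mulr1 ler_pM2l//.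
under eq_bigr do rewrite -opprB.
by rewrite sumrN telescope_sumr// opprB /g powR1 lerBlDr lerDl powR_ge0.
Qed.

(** The sum changes regime at N. Each term up to N is at most N^(-1-s), thanks to 1 + s <= p, and
    there are at most N of them; the later ones telescope. The sequence [m] is constant beyond N and
    [g] before it, so both regimes telescope over the same range. *)
Lemma sum_powRN_min_le s p N k : 0 < s -> 1 + s <= p -> 1 <= N ->
  \sum_(i < k) (i.+1%:R : R) `^ (- 1 - s) * Num.min 1 ((i.+1%:R / N) `^ p) <=
  ((2 + s) / s + 1) * N `^ (- s).
Proof.
move=> s0 sp N1; have N0 : 0 < N by exact: lt_le_trans N1.
have c0 : 0 < (2 + s) / s by rewrite divr_gt0 ?addr_gt0.
pose g (i : nat) : R := Num.max i.+1%:R N `^ (- s).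
pose m (i : nat) : R := Num.min i%:R N.
have g_le i : g i.+1 <= g i.
  apply: le_powRN; [by rewrite lt_max N0 orbT| |exact: ltW].
  by rewrite ge_max !le_max lexx orbT andbT ler_nat leqnSn.
have m_le i : m i <= m i.+1.
  by rewrite le_min !ge_min lexx orbT andbT ler_nat leqnSn.
apply: (@le_trans _ _ (\sum_(0 <= i < k)
    ((2 + s) / s * (g i - g i.+1) + N `^ (- 1 - s) * (m i.+1 - m i)))).
  rewrite big_mkord; apply: ler_sum => i _; set J : R := i.+1%:R.
  have J0 : 0 < J by rewrite ltr0n.
  have [JN|NJ] := leP J N.
    apply: (@le_trans _ _ (N `^ (- 1 - s) * (m i.+1 - m i))); last first.
      by rewrite lerDr mulr_ge0 ?(ltW c0)// subr_ge0.
    have -> : m i.+1 - m i = 1.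
      rewrite /m !min_l//; first by rewrite -natr1 addrC addKr.
      by rewrite (le_trans _ JN)// ler_nat leqnSn.
    rewrite mulr1.
    apply: (@le_trans _ _ (J `^ (- 1 - s) * (J / N) `^ p)).
      by rewrite ler_pM2l ?powR_gt0// ge_min lexx orbT.
    rewrite powRM ?invr_ge0 ?(ltW J0) ?(ltW N0)// mulrA -powRDp//.
    rewrite -[N^-1]powR_inv1 ?(ltW N0)// -powRrM mulN1r.
    rewrite (_ : N `^ (- 1 - s) = N `^ (- 1 - s + p) * N `^ (- p)); last first.
      by rewrite -powRDp// addrK.
    rewrite ler_pM2r ?powR_gt0// ge0_ler_powR ?nnegrE ?(ltW J0) ?(ltW N0)//; lra.
  apply: (@le_trans _ _ ((2 + s) / s * (g i - g i.+1))); last first.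
    by rewrite lerDl mulr_ge0 ?powR_ge0// subr_ge0.
  apply: (@le_trans _ _ (J `^ (- 1 - s))).
    by rewrite ler_piMr ?powR_ge0// ge_min lexx.
  rewrite /g max_l ?(ltW NJ)// max_l; last first.
    by rewrite (le_trans (ltW NJ))// ler_nat.
  by rewrite -[i.+2%:R]natr1; apply: powRN_telescope => //; rewrite ler1n.
have tele (c : R) (h : nat -> R) :
    \sum_(0 <= i < k) c * (h i.+1 - h i) = c * (h k - h 0%N).
  by rewrite -mulr_sumr telescope_sumr.
have -> : \sum_(0 <= i < k) ((2 + s) / s * (g i - g i.+1) + N `^ (- 1 - s) * (m i.+1 - m i)) =
    (2 + s) / s * (g 0%N - g k) + N `^ (- 1 - s) * (m k - m 0%N).
  have <- : (2 + s) / s * (- g k - - g 0%N) = (2 + s) / s * (g 0%N - g k).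
    by congr (_ * _); rewrite opprK addrC.
  rewrite -(tele _ (fun i => - g i)) -(tele _ m) -big_split.
  by apply: eq_bigr => i _; congr (_ * _ + _); rewrite opprK addrC.
rewrite [leRHS]mulrDl mul1r; apply: lerD.
  rewrite ler_pM2l// lerBlDr (_ : g 0%N = N `^ (- s)).
    by rewrite lerDl powR_ge0.
  by rewrite /g max_r.
have -> : N `^ (- s) = N `^ (- 1 - s) * N.
  rewrite -[X in _ * X]powRr1 ?(ltW N0)// -powRDp//; congr (_ `^ _); ring.
rewrite ler_pM2l ?powR_gt0// /m [X in _ - X]min_l ?(ltW N0)// subr0.
by rewrite ge_min lexx orbT.
Qed.

(** For x <= N the squared minimum is at most (x/N)^(2e), because e <= p; for x > N it is at most 1,
    and x^(-2e) is nonincreasing. *)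
Lemma powRN_min_sqr_le e p x N : 0 <= e -> e <= p -> 1 <= x -> 1 <= N ->
  x `^ (- (2 * e)) * Num.min 1 ((x / N) `^ p) ^+ 2 <= N `^ (- (2 * e)).
Proof.
move=> e0 ep x1 N1; have x0 : 0 < x by exact: lt_le_trans x1.
have N0 : 0 < N by exact: lt_le_trans N1.
have e20 : 0 <= 2 * e by rewrite mulr_ge0.
have min0 : 0 <= Num.min 1 ((x / N) `^ p) by rewrite le_min ler01 powR_ge0.
have [xN|Nx] := leP x N.
  have xN1 : 0 < x / N <= 1 by rewrite divr_gt0//= ler_pdivrMr// mul1r.
  have : Num.min 1 ((x / N) `^ p) ^+ 2 <= (x / N) `^ (2 * e).
    rewrite [2 * e]mulrC powRrM powR_mulrn ?powR_ge0// lerXn2r ?nnegrE ?powR_ge0//.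
    by rewrite ge_min (ger_powR xN1 ep) orbT.
  move=> /(ler_wpM2l (powR_ge0 x (- (2 * e))))/le_trans; apply.
  rewrite powRM ?invr_ge0 ?(ltW x0) ?(ltW N0)// mulrA -powRDp// addrC subrr powRr0 mul1r.
  by rewrite -[N^-1]powR_inv1 ?(ltW N0)// -powRrM mulN1r.
apply: (@le_trans _ _ (x `^ (- (2 * e)))).
  by rewrite ler_piMr ?powR_ge0// expr_le1// ge_min lexx.
by apply: le_powRN => //; exact: ltW.
Qed.

Lemma nneseries_le_bound (u : nat -> R) (c : R) : (forall i, 0 <= u i) ->
  (forall k, \sum_(i < k) u i <= c) -> (\sum_(i <oo) (u i)%:E <= c%:E)%E.
Proof.
move=> u0 uc; apply: lime_le; first by apply: is_cvg_nneseries => i _ _; rewrite lee_fin.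
by apply: nearW => k; rewrite sumEFin big_mkord lee_fin.
Qed.

(* The scaled form of Cauchy-Schwarz: by AM-GM,
   2 |x_i| <= w_i x_i^2 / r + r / w_i. *)
Lemma l1_le_weighted_l2 (a : R) : 1 < a -> exists2 C : R, 0 < C &
  forall (x : nat -> R) (r : R), 0 < r ->
    (\sum_(i <oo) ((i.+1%:R `^ a) * x i ^+ 2)%:E <= (r ^+ 2)%:E)%E ->
    (\sum_(i <oo) (`|x i|)%:E <= (C * r)%:E)%E.
Proof.
move=> a1; pose s := a - 1; have s0 : 0 < s by rewrite subr_gt0.
pose C0 := (2 + s) / s; have C00 : 0 < C0 by rewrite divr_gt0// addr_gt0.
exists ((1 + C0) / 2); first by rewrite divr_gt0// addr_gt0.
move=> x r r0 xr; apply: nneseries_le_bound => // k.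
pose w (i : nat) : R := i.+1%:R `^ a.
have w0 i : 0 < w i by rewrite powR_gt0.
have sum_w : \sum_(i < k) (w i)^-1 <= C0.
  apply: le_trans (sum_powRN_le k s0); apply: ler_sum => i _.
  rewrite /w -powRN /s le_eqVlt; apply/orP; left; apply/eqP; congr (_ `^ _); ring.
have sum_x : \sum_(i < k) w i * x i ^+ 2 <= r ^+ 2.
  rewrite -lee_fin; apply: le_trans xr; rewrite -sumEFin -(big_mkord xpredT (fun i => (w i * x i ^+ 2)%:E)).
  by apply: nneseries_lim_ge => i _ _; rewrite lee_fin mulr_ge0 ?sqr_ge0// powR_ge0.
apply: (@le_trans _ _ (\sum_(i < k) (w i * x i ^+ 2 / r + r * (w i)^-1) / 2)).
  apply: ler_sum => i _; rewrite ler_pdivlMr//.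
  have : 0 <= (w i * `|x i| - r) ^+ 2 / (w i * r) by rewrite divr_ge0 ?sqr_ge0// mulr_ge0 ?ltW.
  rewrite -(real_normK (num_real (x i))).
  rewrite (_ : _ / (w i * r) = w i * `|x i| ^+ 2 / r + r / w i - `|x i| * 2); last first.
    by field; rewrite !gt_eqF.
  by rewrite subr_ge0.
rewrite -mulr_suml big_split/= -mulr_suml -mulr_sumr mulrAC ler_pM2r ?invr_gt0//.
rewrite mulrDl mul1r lerD//.
  by rewrite ler_pdivrMr// -expr2.
by rewrite mulrC ler_pM2r.
Qed.

End power_sums.

Section risk_rate.
Context (R : realType) (alpha : R).
(** Exponent of decay of [sing_val i ^+ 2 * prior_sd i ^+ 2]: 2 for the operator and 1 + 2 alpha for
    the prior. *)
Let p : R := 1 + 2 * alpha + 2.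

Definition prior_sd (i : nat) : R := Num.sqrt (i.+1%:R `^ (- 1 - 2 * alpha)).
Definition sing_val (i : nat) : R := (pi * i.+1%:R)^-1.
Definition noise_sd (n : nat) : R := (Num.sqrt n%:R)^-1.

(** Bias factor of the posterior mean. It is also the share of the noise in the marginal variance of
    Y(e_i), so that it governs the posterior variance as well. *)
Let shrink n i := 1 - post_slope (noise_sd n) prior_sd sing_val i * sing_val i.

Lemma prior_sd_gt0 i : 0 < prior_sd i.
Proof. by rewrite sqrtr_gt0 powR_gt0. Qed.

Lemma prior_sd_sqr i : prior_sd i ^+ 2 = i.+1%:R `^ (- 1 - 2 * alpha).
Proof. by rewrite sqr_sqrtr// powR_ge0. Qed.

Lemma noise_sd_gt0 n : (0 < n)%N -> 0 < noise_sd n.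
Proof. by move=> n0; rewrite invr_gt0 sqrtr_gt0 ltr0n. Qed.

Lemma noise_sd_sqr n : noise_sd n ^+ 2 = n%:R^-1.
Proof. by rewrite exprVn sqr_sqrtr. Qed.

Lemma shrinkE n i : (0 < n)%N ->
  shrink n i = (1 + n%:R * (sing_val i ^+ 2 * prior_sd i ^+ 2))^-1.
Proof.
move=> n0; have nR : 0 < n%:R :> R by rewrite ltr0n.
have sk0 : 0 <= sing_val i ^+ 2 * prior_sd i ^+ 2 by rewrite -exprMn sqr_ge0.
rewrite /shrink /post_slope marg_sd_sqr noise_sd_sqr.
rewrite (_ : _ / _ * _ = sing_val i ^+ 2 * prior_sd i ^+ 2 /
  (sing_val i ^+ 2 * prior_sd i ^+ 2 + n%:R^-1)); last by rewrite expr2; ring.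
move: (sing_val i ^+ 2 * _) (n%:R) sk0 nR => x m x0 m0.
have mx : 0 < m * x + 1 by rewrite ltr_wpDl// mulr_ge0// ltW.
by field; rewrite (addrC 1) !gt_eqF.
Qed.

Lemma post_sd_sqr n i : (0 < n)%N ->
  post_sd (noise_sd n) prior_sd sing_val i ^+ 2 = prior_sd i ^+ 2 * shrink n i.
Proof.
move=> n0; rewrite /shrink /post_sd /post_slope expr_div_n exprMn.
rewrite (_ : 1 - _ = (noise_sd n) ^+ 2 / marg_sd (noise_sd n) prior_sd sing_val i ^+ 2).
  by rewrite mulrA.
have r0 := marg_sd_gt0 prior_sd sing_val (noise_sd_gt0 n0) i.
have r2 := marg_sd_sqr (noise_sd n) prior_sd sing_val i.
apply: (@mulIf _ (marg_sd (noise_sd n) prior_sd sing_val i ^+ 2)).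
  by rewrite gt_eqF ?exprn_gt0.
rewrite divfK ?gt_eqF ?exprn_gt0// mulrBl mul1r mulrAC divfK ?gt_eqF ?exprn_gt0//.
by rewrite r2; ring.
Qed.

(** With N = n^(1/p) and q = ((i+1)/N)^p, the signal-to-noise ratio of coordinate [i] is the inverse
    of pi^2 q, whence a shrinkage of pi^2 q / (pi^2 q + 1). This is at most 1, hence at most pi^2,
    and at most pi^2 q. *)
Lemma shrink_le n i : 0 < p -> (0 < n)%N ->
  0 <= shrink n i <= pi ^+ 2 * Num.min 1 ((i.+1%:R / n%:R `^ p^-1) `^ p).
Proof.
move=> p0 n0; rewrite shrinkE//.
have nR : 0 < n%:R :> R by rewrite ltr0n.
set J : R := i.+1%:R; have J0 : 0 < J by rewrite ltr0n.
set q := (J / _) `^ p; have q0 : 0 < q.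
  by rewrite powR_gt0 // divr_gt0// powR_gt0.
have pi0 : 0 < pi :> R by exact: pi_gt0.
have pi1 : 1 <= pi ^+ 2 :> R.
  by apply/exprn_ege1/(le_trans _ (pi_ge2 R)); rewrite ler1n.
have qE : n%:R * (sing_val i ^+ 2 * prior_sd i ^+ 2) = (pi ^+ 2 * q)^-1.
  rewrite prior_sd_sqr /sing_val -/J exprVn exprMn.
  have -> : q = J `^ p / n%:R.
    rewrite /q powRM ?invr_ge0 ?powR_ge0 ?(ltW J0)//; congr (_ * _).
    by rewrite -powRN -powRrM mulNr mulVf ?gt_eqF// powR_inv1// ltW.
  have -> : J `^ p = J ^+ 2 * (J `^ (- 1 - 2 * alpha))^-1.
    rewrite -powRN -powR_mulrn ?(ltW J0)// -powRDp//; congr (_ `^ _).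
    by rewrite /p; ring.
  have : J `^ (- 1 - 2 * alpha) != 0 by rewrite gt_eqF ?powR_gt0.
  move: (J `^ _) => x x0; move: (J) (n%:R) (pi : R) J0 nR pi0 => j m c j0 m0 c0.
  by field; rewrite x0 !gt_eqF.
rewrite qE; have Q0 : 0 < pi ^+ 2 * q by rewrite mulr_gt0 ?exprn_gt0.
have -> : (1 + (pi ^+ 2 * q)^-1)^-1 = pi ^+ 2 * q / (pi ^+ 2 * q + 1).
  by move: (pi ^+ 2 * q) Q0 => x x0; field; rewrite !gt_eqF ?addr_gt0.
have y1 : 0 < pi ^+ 2 * q + 1 by rewrite addr_gt0.
rewrite (divr_ge0 (ltW Q0) (ltW y1)) /= ler_pdivrMr//.
have [q1|q1] := leP 1 q; last by rewrite ler_peMr ?(ltW Q0)// lerDr ltW.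
rewrite mulr1 mulrDr mulr1; apply: (@le_trans _ _ (pi ^+ 2 * (pi ^+ 2 * q))).
  by rewrite ler_peMl// ltW.
by rewrite lerDl exprn_ge0// ltW.
Qed.

(** With N = n^(1/p), the variances sum to a multiple of N^(-2(alpha - delta)), which
    [gamma <= alpha] bounds by N^(-2(gamma - delta)); the squared biases are of this last order
    because 2 delta is at most 2 beta - 2(gamma - delta). The value [delta = 0] is allowed for the
    sake of the L2 norm. *)
Lemma risk_rate (beta gamma delta : R) (theta0 : nat -> R) :
  0 <= delta -> delta < gamma -> gamma <= alpha -> gamma <= beta ->
  (\sum_(i <oo) ((i.+1%:R `^ (2 * beta)) * theta0 i ^+ 2)%:E < +oo)%E ->
  exists2 C : R, 0 < C & forall n, (0 < n)%N ->
  (\sum_(i <oo) ((i.+1%:R `^ (2 * delta)) *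
      (post_sd (noise_sd n) prior_sd sing_val i ^+ 2 +
       (1 - post_slope (noise_sd n) prior_sd sing_val i * sing_val i) ^+ 2
         * theta0 i ^+ 2))%:E
    <= (C * (n%:R `^ (- ((gamma - delta) / p))) ^+ 2)%:E)%E.
Proof.
move=> d0 dg ga gb theta_oo.
have a0 : 0 < alpha by rewrite (lt_le_trans _ ga)// (le_lt_trans d0).
have p0 : 0 < p by rewrite /p; lra.
have tw0 i : 0 <= i.+1%:R `^ (2 * beta) * theta0 i ^+ 2 by rewrite mulr_ge0 ?powR_ge0 ?sqr_ge0.
set Th := (\sum_(i <oo) _)%E in theta_oo.
have Th0 : (0 <= Th)%E by apply: nneseries_ge0 => i _ _; rewrite lee_fin.
have Thfin : Th \is a fin_num by rewrite ge0_fin_numE.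
pose B := fine Th; have B0 : 0 <= B by exact: fine_ge0.
have sumB k : \sum_(i < k) i.+1%:R `^ (2 * beta) * theta0 i ^+ 2 <= B.
  rewrite -lee_fin fineK// -sumEFin.
  rewrite -(big_mkord xpredT (fun i => (i.+1%:R `^ (2 * beta) * theta0 i ^+ 2)%:E)).
  by apply: nneseries_lim_ge => i _ _; rewrite lee_fin.
pose s := 2 * (alpha - delta); have s0 : 0 < s by rewrite mulr_gt0// subr_gt0 (lt_le_trans dg).
pose e := gamma - delta; have e0 : 0 < e by rewrite subr_gt0.
pose C0 := (2 + s) / s + 1.
have C00 : 0 < C0 by rewrite /C0 addr_gt0// divr_gt0// addr_gt0.
have pi0 : 0 < pi :> R by exact: pi_gt0.
have C1 : 0 < pi ^+ 2 * C0 + pi ^+ 4 * B.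
  by rewrite ltr_pwDl// ?mulr_gt0 ?exprn_gt0// mulr_ge0// exprn_ge0// ltW.
exists (pi ^+ 2 * C0 + pi ^+ 4 * B) => // n n0.
set N : R := n%:R `^ p^-1.
have N1 : 1 <= N by rewrite -(powRr0 n%:R) ler_powR ?ler1n// invr_ge0 ltW.
have N0 : 0 < N by exact: lt_le_trans N1.
have rateE : (n%:R `^ (- ((gamma - delta) / p))) ^+ 2 = N `^ (- (2 * e)).
  transitivity ((n%:R `^ (- ((gamma - delta) / p))) `^ 2%:R).
    by rewrite (powR_mulrn 2%N (powR_ge0 _ _)).
  rewrite /N -[LHS]powRrM -[RHS]powRrM; congr (_ `^ _).
  by rewrite /e; field; rewrite gt_eqF.
have sh i := shrink_le i p0 n0.
apply: nneseries_le_bound => [i|k].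
  by rewrite mulr_ge0 ?powR_ge0// addr_ge0 ?sqr_ge0// -exprMn sqr_ge0.
rewrite rateE (mulrDl (pi ^+ 2 * C0)).
pose mn (i : nat) := Num.min 1 ((i.+1%:R / N) `^ p).
have mn0 i : 0 <= mn i by rewrite le_min ler01 powR_ge0.
apply: (@le_trans _ _ (\sum_(i < k) (pi ^+ 2 * (i.+1%:R `^ (- 1 - s) * mn i) +
   pi ^+ 4 * N `^ (- (2 * e)) * (i.+1%:R `^ (2 * beta) * theta0 i ^+ 2)))).
  apply: ler_sum => i _; set J : R := i.+1%:R.
  have J1 : 1 <= J by rewrite ler1n.
  have J0 : 0 < J by exact: lt_le_trans J1.
  have /andP[sh0 shm] := sh i; rewrite -/J -/N -/(mn i) in sh0 shm.
  rewrite (mulrDr (J `^ (2 * delta))) post_sd_sqr// -/(shrink n i); apply: lerD.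
    rewrite prior_sd_sqr mulrA -powRDp// mulrCA.
    rewrite (_ : 2 * delta + _ = - 1 - s); last by rewrite /s; ring.
    by rewrite ler_pM2l ?powR_gt0//.
  rewrite [leLHS]mulrA [leRHS]mulrA ler_wpM2r ?sqr_ge0//.
  apply: (@le_trans _ _ (J `^ (2 * delta) * (pi ^+ 2 * mn i) ^+ 2)).
    by rewrite ler_pM2l ?powR_gt0// lerXn2r// nnegrE ?mulr_ge0 ?exprn_ge0// ltW.
  rewrite exprMn -exprM mulrCA -mulrA ler_pM2l ?exprn_gt0//.
  apply: (@le_trans _ _ (J `^ (- (2 * e)) * mn i ^+ 2 * J `^ (2 * beta))).
    rewrite mulrAC ler_wpM2r ?sqr_ge0// -powRDp// ler_powR// /e; lra.
  rewrite ler_pM2r ?powR_gt0//; apply: powRN_min_sqr_le => //; first exact: ltW.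
  by rewrite /e /p; lra.
rewrite big_split/= -mulr_sumr -mulr_sumr; apply: lerD.
  rewrite -mulrA ler_pM2l ?exprn_gt0//.
  apply: (le_trans (sum_powRN_min_le k s0 _ N1)); first by rewrite /s /p; lra.
  rewrite ler_pM2l// ler_powR// /s /e; lra.
rewrite [leRHS]mulrAC ler_pM2l; first exact: sumB.
by apply: mulr_gt0; [exact: exprn_gt0|exact: powR_gt0].
Qed.

End risk_rate.

(** * Cosine series *)

Section cosine_series.
Context (R : realType).
Implicit Types (d : nat -> R) (x M : R).

(** The same limit as in [vfun], so that the two agree without a convergence argument; coordinate
    [i] goes with [hbasis i.+1]. *)
Definition cosser d x : R := limn (fun n => \sum_(0 <= i < n) d i * hbasis i.+1 x).

Definition ell1 d : Prop := (\sum_(i <oo) (`|d i|)%:E < +oo)%E.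

Lemma norm_hbasis_le i x : `|hbasis i.+1 x| <= Num.sqrt 2 :> R.
Proof.
rewrite /hbasis normrM ger0_norm ?sqrtr_ge0// -[leRHS]mulr1.
by rewrite ler_wpM2l ?sqrtr_ge0// cos_max.
Qed.

Lemma partial_sum_le d M n : (\sum_(i <oo) (`|d i|)%:E <= M%:E)%E ->
  \sum_(0 <= i < n) `|d i| <= M.
Proof.
move=> dM; rewrite -lee_fin -sumEFin; apply: le_trans dM.
by apply: nneseries_lim_ge => i _ _; rewrite lee_fin.
Qed.

Lemma ell1_bound d : ell1 d -> exists M, (\sum_(i <oo) (`|d i|)%:E <= M%:E)%E.
Proof.
move=> dl; exists (fine (\sum_(i <oo) (`|d i|)%:E)%E); rewrite fineK//.
by rewrite ge0_fin_numE//; apply: nneseries_ge0 => i _ _; rewrite lee_fin.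
Qed.

Lemma ell1_is_cvg d : ell1 d -> cvgn (series (fun i => `|d i|)).
Proof.
move=> /ell1_bound[M dM]; apply: nondecreasing_is_cvgn.
  by apply: nondecreasing_series => i _ _; exact: normr_ge0.
by exists M => _ [n _ <-]; exact: partial_sum_le.
Qed.

Lemma ell1_le d d' (c : R) : (forall i, `|d i| <= c * `|d' i|) -> ell1 d' -> ell1 d.
Proof.
move=> dd' /ell1_bound[M dM].
apply: (@le_lt_trans _ _ ((`|c| * M)%:E)); last exact: ltry.
apply: lime_le; first by apply: is_cvg_nneseries => i _ _; rewrite lee_fin.
apply: nearW => n; rewrite sumEFin lee_fin.
apply: (@le_trans _ _ (\sum_(0 <= i < n) `|c| * `|d' i|)).
  apply: ler_sum => i _; apply: (le_trans (dd' i)).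
  by rewrite ler_wpM2r// ler_norm.
by rewrite -mulr_sumr ler_wpM2l// partial_sum_le.
Qed.

Lemma ell1D d d' : ell1 d -> ell1 d' -> ell1 (fun i => d i + d' i).
Proof.
move=> /ell1_bound[M dM] /ell1_bound[M' dM'].
apply: (@le_lt_trans _ _ ((M + M')%:E)); last exact: ltry.
apply: lime_le; first by apply: is_cvg_nneseries => i _ _; rewrite lee_fin.
apply: nearW => n; rewrite sumEFin lee_fin.
apply: (@le_trans _ _ (\sum_(0 <= i < n) (`|d i| + `|d' i|))).
  by apply: ler_sum => i _; exact: ler_normD.
by rewrite big_split/= lerD// partial_sum_le.
Qed.

Lemma ell1_finite d n : (forall i, (n <= i)%N -> d i = 0) -> ell1 d.
Proof.
move=> d0; apply: (@le_lt_trans _ _ ((\sum_(0 <= i < n) `|d i|)%:E)); last exact: ltry.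
rewrite (nneseries_split 0 n); last by move=> i _; rewrite lee_fin.
rewrite eseries0 ?adde0 ?sumEFin ?add0n// => i ni _.
by rewrite d0// normr0.
Qed.

Lemma is_cvg_cosser d x : ell1 d ->
  cvgn (fun n => \sum_(0 <= i < n) d i * hbasis i.+1 x).
Proof.
move=> dl; apply: (@normed_cvg _ _ (fun i => d i * hbasis i.+1 x)).
apply: (@series_le_cvg _ _ (fun i => Num.sqrt 2 * `|d i|)) => [i|i|i|].
- exact: normr_ge0.
- by rewrite /= mulr_ge0 ?sqrtr_ge0.
- by rewrite /= normrM mulrC ler_wpM2r// norm_hbasis_le.
exact: (is_cvg_seriesZ (k := Num.sqrt 2 : R) (ell1_is_cvg dl)).
Qed.

Lemma cosserP d x : ell1 d ->
  \sum_(0 <= i < n) d i * hbasis i.+1 x @[n --> \oo] --> cosser d x.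
Proof. by move=> dl; exact: is_cvg_cosser. Qed.

Lemma norm_cosser_le d M x : (\sum_(i <oo) (`|d i|)%:E <= M%:E)%E ->
  `|cosser d x| <= Num.sqrt 2 * M.
Proof.
move=> dM; have dl : ell1 d by exact: le_lt_trans dM (ltry _).
have cn : `|\sum_(0 <= i < n) d i * hbasis i.+1 x| @[n --> \oo] --> `|cosser d x|.
  by apply: cvg_norm; exact: cosserP.
rewrite -(cvg_lim _ cn)//; apply: limr_le; first exact: cvgP cn.
apply: nearW => n; apply: (le_trans (ler_norm_sum _ _ _)).
apply: (@le_trans _ _ (\sum_(0 <= i < n) Num.sqrt 2 * `|d i|)).
  by apply: ler_sum => i _; rewrite normrM mulrC ler_wpM2r// norm_hbasis_le.
by rewrite -mulr_sumr ler_wpM2l ?sqrtr_ge0// partial_sum_le.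
Qed.

Lemma cosserD d d' x : ell1 d -> ell1 d' ->
  cosser (fun i => d i + d' i) x = cosser d x + cosser d' x.
Proof.
move=> dl d'l; apply/cvg_lim => //.
rewrite [X in X @ _ --> _](_ : _ = (fun n => \sum_(0 <= i < n) d i * hbasis i.+1 x +
    \sum_(0 <= i < n) d' i * hbasis i.+1 x)); last first.
  by apply/funext => n; rewrite -big_split/=; apply: eq_bigr => i _; rewrite mulrDl.
by apply: cvgD; exact: cosserP.
Qed.

Lemma cosserB d d' x : ell1 d -> ell1 d' ->
  cosser (fun i => d i - d' i) x = cosser d x - cosser d' x.
Proof.
move=> dl d'l; apply/cvg_lim => //.
rewrite [X in X @ _ --> _](_ : _ = (fun n => \sum_(0 <= i < n) d i * hbasis i.+1 x -
    \sum_(0 <= i < n) d' i * hbasis i.+1 x)); last first.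
  by apply/funext => n; rewrite -sumrB/=; apply: eq_bigr => i _; rewrite mulrBl.
by apply: cvgB; exact: cosserP.
Qed.

Lemma cosser_finite d n x : (forall i, (n <= i)%N -> d i = 0) ->
  cosser d x = \sum_(0 <= i < n) d i * hbasis i.+1 x.
Proof.
move=> d0; apply/cvg_lim => //; apply: cvg_near_cst; near=> m.
have nm : (n <= m)%N by near: m; exists n.
have tail0 : \sum_(n <= i < m) d i * hbasis i.+1 x = 0.
  by rewrite big_nat_cond big1// => i /andP[/andP[ni _] _]; rewrite d0// mul0r.
by rewrite (@big_cat_nat _ _ _ n 0 m)//= [X in _ + X = _]tail0 addr0.
Unshelve. all: by end_near. Qed.

Definition trunc d n (i : nat) : R := if (i < n)%N then d i else 0.

Lemma cosser_trunc d n x : cosser (trunc d n) x = \sum_(0 <= i < n) d i * hbasis i.+1 x.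
Proof.
rewrite (cosser_finite (n := n)); last by move=> i ni; rewrite /trunc ltnNge ni.
by apply: eq_big_nat => i /andP[_ ni]; rewrite /trunc ni.
Qed.

Lemma ell1_trunc d n : ell1 (trunc d n).
Proof. by apply: (@ell1_finite _ n) => i ni; rewrite /trunc ltnNge ni. Qed.

(** The tail of the l1 norm bounds the error for all [x] at once. This uniformity carries
    continuity, [Kop], integrals and L2 bounds from finite sums to the limit. *)
Lemma cosser_approx d (e : R) : ell1 d -> 0 < e ->
  \forall n \near \oo, forall x, `|cosser d x - cosser (trunc d n) x| <= e.
Proof.
move=> dl e0; have s0 : 0 < Num.sqrt 2 :> R by rewrite sqrtr_gt0.
have tl : (\sum_(n <= i <oo) (`|d i|)%:E)%E @[n --> \oo] --> 0%E.
  by apply: nneseries_tail_cvg => // i _; rewrite lee_fin.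
have /fine_cvgP[_ /cvgrPdist_lt/(_ (e / Num.sqrt 2))] := tl.
rewrite divr_gt0// => /(_ isT) tl_lt.
have /fine_cvgP[tl_fin _] := tl.
near=> n => x; rewrite -cosserB//; last exact: ell1_trunc.
rewrite -[leRHS](divfK (lt0r_neq0 s0)) mulrC; apply: norm_cosser_le.
have tE : (\sum_(i <oo) (`|d i - trunc d n i|)%:E = \sum_(n <= i <oo) (`|d i|)%:E)%E.
  rewrite (nneseries_split 0 n); last by move=> i _; rewrite lee_fin.
  rewrite add0n big_nat_cond big1 ?add0e; last first.
    by move=> i /andP[/andP[_ i_n] _]; rewrite /trunc i_n subrr normr0.
  apply: congr_lim; apply/funext => m /=; apply: eq_big_nat => i /andP[ni _].
  by rewrite /trunc ltnNge ni subr0.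
rewrite tE; have fin : (\sum_(n <= i <oo) (`|d i|)%:E)%E \is a fin_num by near: n.
rewrite -(fineK fin) lee_fin ltW// (le_lt_trans (ler_norm _))//.
rewrite -normrN -[- _]add0r; near: n; exact: tl_lt.
Unshelve. all: by end_near. Qed.

Lemma continuous_hbasis i : continuous (@hbasis R i).
Proof.
case: i => [|i] x; first exact: cvg_cst.
rewrite /hbasis; apply: cvgM; first exact: cvg_cst.
apply: (@continuous_comp _ _ _ (fun x => pi * i.+1%:R * x) cos); last exact: continuous_cos.
by apply: cvgM; [exact: cvg_cst|exact: cvg_id].
Qed.

Lemma continuous_cosser d : ell1 d -> continuous (cosser d).
Proof.
move=> dl x; apply/cvgrPdist_lt => e e0.
have e30 : 0 < e / 3 by rewrite divr_gt0.
have [n _ /(_ n (leqnn n)) near_n] := cosser_approx dl e30.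
have ct : continuous (cosser (trunc d n)).
  have -> : cosser (trunc d n) = fun x => \sum_(0 <= i < n) d i * hbasis i.+1 x.
    by apply/funext => y; rewrite cosser_trunc.
  elim: n {near_n} => [|n IHn] y.
    rewrite (_ : (fun x => _) = cst 0); first exact: cvg_cst.
    by apply/funext => z; rewrite big_geq.
  rewrite (_ : (fun x => _) = fun x =>
    \sum_(0 <= i < n) d i * hbasis i.+1 x + d n * hbasis n.+1 x); last first.
    by apply/funext => z; rewrite big_nat_recr.
  apply: cvgD; first exact: IHn.
  apply: cvgM; [exact: cvg_cst|exact: (@continuous_hbasis n.+1)].
near=> y.
have h1 := near_n x; have h2 := near_n y.
have h3 : `|cosser (trunc d n) x - cosser (trunc d n) y| < e / 3.
  by near: y; move/cvgrPdist_lt : (ct x); exact.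
rewrite (_ : cosser d x - cosser d y = (cosser d x - cosser (trunc d n) x) +
  (cosser (trunc d n) x - cosser (trunc d n) y) - (cosser d y - cosser (trunc d n) y)); last by ring.
apply: (le_lt_trans (ler_normB _ _)); apply: (le_lt_trans (lerD (ler_normD _ _) (lexx _))).
lra.
Unshelve. all: by end_near. Qed.

End cosine_series.

(** * The operator K *)

Section kop_sine.
Context (R : realType).
Local Notation mu := (@lebesgue_measure R).
Local Notation D := (`]0, 1[%classic : set R).
Implicit Types (f v w phi : R -> R) (x t M : R).

Lemma continuous_integrable f (i : interval R) (x : R) : continuous f ->
  [set` i] `<=` `[0, x] -> mu.-integrable [set` i] (EFin \o f).
Proof.
move=> cf sub; have icc : mu.-integrable `[0, x] (EFin \o f).
  apply: continuous_compact_integrable; first exact: segment_compact.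
  exact: continuous_subspaceT.
by apply: (@integrableS _ _ _ mu `[0, x]%classic _ _ _ _ sub icc); exact: measurable_itv.
Qed.

Lemma continuous_integrable_oo f x : continuous f -> mu.-integrable `]0, x[ (EFin \o f).
Proof. by move=> cf; apply: (continuous_integrable (x := x) cf); exact: subset_itv_oo_cc. Qed.

Lemma Rintegral_oo_cc f x : continuous f -> 0 < x ->
  \int[mu]_(s in `]0, x[) f s = \int[mu]_(s in `[0, x]) f s.
Proof.
move=> cf x0; rewrite Rintegral_itv_bndo_bndc; last exact: continuous_integrable_oo.
rewrite Rintegral_itv_obnd_cbnd//; apply: (continuous_integrable (x := x) cf).
exact: subset_itv_oc_cc.
Qed.

Lemma Rintegral_FTC f (F : R -> R) x : 0 <= x -> continuous f ->
  (forall y : R, is_derive y 1 F (f y)) -> \int[mu]_(s in `]0, x[) f s = F x - F 0.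
Proof.
rewrite le_eqVlt => /predU1P[<-|x0] cf dF.
  by rewrite set_itv_ge ?bnd_simp// Rintegral_set0 subrr.
have cF : continuous F.
  by move=> y; apply: differentiable_continuous; apply/derivable1_diffP; exact: ex_derive.
rewrite Rintegral_oo_cc// /Rintegral (@continuous_FTC2 _ f F)//.
- exact: continuous_subspaceT.
- split; first by move=> y _; exact: ex_derive.
  + by apply: cvg_at_right_filter; exact: cF.
  + by apply: cvg_at_left_filter; exact: cF.
- by move=> y _; rewrite derive1E derive_val.
Qed.

(** Shifted like the coordinates of theta: [sinb i] is the sine that matches [hbasis i.+1]. *)
Definition sinb (i : nat) x : R := Num.sqrt 2 * sin (pi * i.+1%:R * x).

Lemma is_derive_sin_lin (c y : R) : is_derive y 1 (fun x => sin (c * x)) (c * cos (c * y)).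
Proof.
have dl : is_derive y 1 (fun x : R => c * x) c.
  by apply: is_derive_eq; rewrite [_ *: _]mulr1.
by apply: (is_derive_eq (is_derive1_comp (is_derive_sin (c * y)) dl)); rewrite mulrC.
Qed.

Lemma continuous_cos_lin (c : R) : continuous (fun x => cos (c * x)).
Proof.
move=> x; apply: (@continuous_comp _ _ _ (fun x => c * x) cos); last exact: continuous_cos.
by apply: cvgM; [exact: cvg_cst|exact: cvg_id].
Qed.

Lemma continuous_sin_lin (c : R) : continuous (fun x => sin (c * x)).
Proof.
move=> x; apply: (@continuous_comp _ _ _ (fun x => c * x) sin); last exact: continuous_sin.
by apply: cvgM; [exact: cvg_cst|exact: cvg_id].
Qed.

Lemma Rintegral_cos_lin (c x : R) : 0 <= x -> c != 0 ->
  \int[mu]_(s in `]0, x[) cos (c * s) = sin (c * x) / c.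
Proof.
move=> x0 c0; have dF (y : R) : is_derive y 1 (fun x => sin (c * x) / c) (cos (c * y)).
  have ds := is_derive_sin_lin c y.
  apply: is_derive_eq; rewrite [_ *: 0]mulr0 add0r [_ *: _]mulrC mulrC mulrA.
  by rewrite mulVf// mul1r.
rewrite (Rintegral_FTC x0 (@continuous_cos_lin c) dF).
by rewrite mulr0 sin0 mul0r subr0.
Qed.

Lemma sin_pi_nat (n : nat) : sin (pi * n%:R) = 0 :> R.
Proof.
elim: n => [|n IHn]; first by rewrite mulr0 sin0.
by rewrite -natr1 mulrDr mulr1 sinDpi IHn oppr0.
Qed.

Lemma Rintegral_cos_pi (n : nat) :
  \int[mu]_(s in `]0, 1[) cos (pi * n%:R * s) = (n == 0%N)%:R.
Proof.
case: n => [|n] /=.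
  under eq_Rintegral do rewrite mulr0 mul0r cos0.
  by rewrite Rintegral_cst// mul1r [X in fine X]lebesgue_measure01.
by rewrite Rintegral_cos_lin ?ler01// ?mulr1 ?sin_pi_nat ?mul0r// mulf_neq0 ?gt_eqF ?pi_gt0.
Qed.

Lemma cos_pi_dist (i j : nat) (s : R) :
  cos (pi * (i%:R - j%:R) * s) = cos (pi * `|i - j|%N%:R * s).
Proof.
have [ij|ji] := leqP i j.
  by rewrite distnEr// natrB// -[LHS]cosN; congr cos; ring.
by rewrite distnEl 1?ltnW// natrB// ltnW.
Qed.

Lemma cos_factored (p a b s : R) :
  cos (p * (a - b) * s) = cos (p * a * s) * cos (p * b * s) + sin (p * a * s) * sin (p * b * s) /\
  cos (p * (a + b) * s) = cos (p * a * s) * cos (p * b * s) - sin (p * a * s) * sin (p * b * s).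
Proof.
by rewrite -cosB -cosD; split; congr cos; ring.
Qed.

(** By the product-to-sum formulas both inner products reduce to integrals of cosines of frequencies
    |i - j| and i + j + 2. The second frequency is never 0, so its integral vanishes; the first one
    contributes on the diagonal only. *)
Lemma inner_trig (i j : nat) :
  inner (@hbasis R i.+1) (hbasis j.+1) = (i == j)%:R /\
  inner (sinb i) (sinb j) = (i == j)%:R.
Proof.
have integrable_cos (n : nat) : mu.-integrable D (EFin \o (fun s => cos (pi * n%:R * s))).
  by apply: continuous_integrable_oo; exact: continuous_cos_lin.
have s2 : Num.sqrt 2 * Num.sqrt 2 = 2 :> R by rewrite -expr2 sqr_sqrtr.
have dist0 : (`|i.+1 - j.+1|%N == 0%N) = (i == j) by rewrite distn_eq0 eqSS.
split.
  transitivity (\int[mu]_(s in D) (cos (pi * `|i.+1 - j.+1|%N%:R * s) + cos (pi * (i.+1 + j.+1)%N%:R * s))).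
    apply: eq_Rintegral => s _; rewrite /hbasis mulrACA s2 -cos_pi_dist natrD.
    by have [-> ->] := cos_factored pi i.+1%:R j.+1%:R s; ring.
  by rewrite RintegralD// !Rintegral_cos_pi dist0 addSn addr0.
transitivity (\int[mu]_(s in D) (cos (pi * `|i.+1 - j.+1|%N%:R * s) - cos (pi * (i.+1 + j.+1)%N%:R * s))).
  apply: eq_Rintegral => s _; rewrite /sinb mulrACA s2 -cos_pi_dist natrD.
  by have [-> ->] := cos_factored pi i.+1%:R j.+1%:R s; ring.
by rewrite RintegralB// !Rintegral_cos_pi dist0 addSn subr0.
Qed.

Lemma Rintegral_hbasis i x : 0 <= x ->
  \int[mu]_(s in `]0, x[) hbasis i.+1 s = sing_val R i * sinb i x.
Proof.
move=> x0; rewrite /hbasis RintegralZl//; last first.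
  by apply: continuous_integrable_oo; exact: continuous_cos_lin.
rewrite Rintegral_cos_lin//; last by rewrite mulf_neq0// gt_eqF// pi_gt0.
by rewrite /sing_val /sinb; ring.
Qed.

Lemma L2_continuous v : continuous v -> L2 v.
Proof.
move=> cv; have [M [_ Mv]] : bounded_set (v @` `[0, 1]).
  apply: compact_bounded; apply: continuous_compact; last exact: segment_compact.
  exact: continuous_subspaceT.
apply: (@L2_bounded _ v (M + 1)).
  by apply: measurable_funTS; exact: continuous_measurable_fun.
move=> x Dx; apply: Mv; first by rewrite ltrDl.
by exists x => //; exact: subset_itv_oo_cc Dx.
Qed.

Lemma L2_sinb i : L2 (sinb i).
Proof.
by apply: L2_continuous => x; apply: cvgM; [exact: cvg_cst|exact: continuous_sin_lin].
Qed.

Lemma Kop_linear v w t x : continuous v -> continuous w ->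
  Kop (fun y => v y + t * w y) x = Kop v x + t * Kop w x.
Proof.
move=> cv cw; rewrite /Kop.
have E z : \int[mu]_(s in `]0, z[) (v s + t * w s) =
    \int[mu]_(s in `]0, z[) v s + t * \int[mu]_(s in `]0, z[) w s.
  rewrite RintegralD//; [|exact: continuous_integrable_oo|].
    by rewrite RintegralZl//; exact: continuous_integrable_oo.
  apply: continuous_integrable_oo => y; apply: cvgM; first exact: cvg_cst.
  exact: cw.
by rewrite !E; ring.
Qed.

Lemma Kop_cst (c : R) x : 0 <= x -> Kop (cst c) x = 0.
Proof.
have E z : 0 <= z -> \int[mu]_(s in `]0, z[) c = c * z.
  rewrite le_eqVlt => /predU1P[<-|z0].
    by rewrite set_itv_ge ?bnd_simp// Rintegral_set0 mulr0.
  by rewrite Rintegral_cst// [X in fine X]lebesgue_measure_itv/= lte_fin z0 oppr0 addr0.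
by move=> x0; rewrite /Kop !E//; ring.
Qed.

Lemma Kop_hbasis i x : 0 <= x -> Kop (hbasis i.+1) x = sing_val R i * sinb i x.
Proof.
move=> x0; rewrite /Kop !Rintegral_hbasis//.
by rewrite /sinb mulr1 sin_pi_nat !mulr0 subr0.
Qed.

Lemma norm_Rintegral_le v M x : continuous v -> 0 <= M -> 0 <= x -> x <= 1 ->
  (forall y, D y -> `|v y| <= M) -> `|\int[mu]_(s in `]0, x[) v s| <= M.
Proof.
move=> cv M0 + x1 vM; rewrite le_eqVlt => /predU1P[<-|x0].
  by rewrite set_itv_ge ?bnd_simp// Rintegral_set0 normr0.
apply: le_trans (le_normr_Rintegral _ _) _ => //; first exact: continuous_integrable_oo.
apply: (@le_trans _ _ (\int[mu]_(s in `]0, x[) M)).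
  apply: le_Rintegral => //.
  - by apply: (integrable_norm (continuous_integrable_oo x cv)).
  - by apply: (@continuous_integrable_oo (cst M)) => y; exact: cvg_cst.
  - move=> y /=; rewrite in_itv/= => /andP[y0 yx]; apply: vM.
    by rewrite /= in_itv/= y0 (lt_le_trans yx).
rewrite Rintegral_cst// [X in fine X]lebesgue_measure_itv/= lte_fin x0 oppr0 addr0/=.
by rewrite ler_piMr.
Qed.

Lemma norm_Kop_le v M x : continuous v -> 0 <= M -> D x ->
  (forall y, D y -> `|v y| <= M) -> `|Kop v x| <= 2 * M.
Proof.
move=> cv M0 /=; rewrite in_itv/= => /andP[x0 x1] vM.
apply: (le_trans (ler_normB _ _)); rewrite mulr_natl mulr2n lerD//.
  by apply: norm_Rintegral_le => //; exact: ltW.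
rewrite normrM gtr0_norm// -[leRHS]mul1r; apply: ler_pM => //; try exact: ltW.
by apply: norm_Rintegral_le.
Qed.

Lemma measurable_Kop v : continuous v -> measurable_fun D (Kop v).
Proof.
move=> cv; have icc : mu.-integrable `[0, 1] (EFin \o v).
  by apply: (continuous_integrable (x := 1) cv).
have cP := parameterized_integral_continuous ler01 icc.
have mP := subspace_continuous_measurable_fun (measurable_itv _) cP.
apply: measurable_funB; last exact: measurable_funM.
apply: (@eq_measurable_fun _ _ _ _ _ (fun x => \int[mu]_(s in `[0, x]) v s)).
  by move=> x; rewrite inE/= in_itv/= => /andP[x0 _]; rewrite Rintegral_oo_cc.
by apply: (measurable_funS _ _ mP) => //; exact: subset_itv_oo_cc.
Qed.

Lemma L2_Kop v : continuous v -> L2 (Kop v).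
Proof.
move=> cv; have [M [_ Mv]] : bounded_set (v @` `[0, 1]).
  apply: compact_bounded; apply: continuous_compact; last exact: segment_compact.
  exact: continuous_subspaceT.
apply: (@L2_bounded _ _ (2 * `|M + 1|)); first exact: measurable_Kop.
move=> x Dx; apply: norm_Kop_le => // y Dy; apply: (@le_trans _ _ (M + 1)); last exact: ler_norm.
by apply: Mv; [rewrite ltrDl|exists y => //; exact: subset_itv_oo_cc Dy].
Qed.

Lemma norm_inner_le phi f M : L2 phi -> L2 f -> 0 <= M ->
  (forall x, D x -> `|f x| <= M) ->
  `|inner phi f| <= M * \int[mu]_(x in D) `|phi x|.
Proof.
move=> Lphi Lf M0 fM.
have i1 := L2_integrableM Lphi Lf.
have L1 : L2 (cst 1 : R -> R) by apply: L2_continuous => x; exact: cvg_cst.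
have iphi : mu.-integrable D (EFin \o phi).
  have := L2_integrableM Lphi L1.
  by under [X in mu.-integrable _ X -> _]eq_fun do rewrite mulr1.
apply: le_trans (le_normr_Rintegral _ i1) _ => //.
rewrite -RintegralZl//; last exact: integrable_norm.
apply: le_Rintegral => //.
- exact: (integrable_norm i1).
- have := @integrableZl _ _ _ mu D (measurable_itv _) M _ (integrable_norm iphi).
  by under [X in mu.-integrable _ X -> _]eq_fun do rewrite -EFinM.
- by move=> x Dx; rewrite normrM mulrC ler_wpM2r// fM.
Qed.

End kop_sine.

(** * The signal of the Darcy model *)

Section darcy_signal.
Context (R : realType).
Local Notation mu := (@lebesgue_measure R).
Local Notation D := (`]0, 1[%classic : set R).
Implicit Types (theta d : nat -> R) (phi : R -> R) (x t : R).

Lemma continuous_trunc d n : continuous (cosser (trunc d n)).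
Proof. exact/continuous_cosser/ell1_trunc. Qed.

Lemma cosser_truncS d n :
  cosser (trunc d n.+1) = fun y => cosser (trunc d n) y + d n * hbasis n.+1 y.
Proof. by apply/funext => y; rewrite !cosser_trunc big_nat_recr. Qed.

Lemma Kop_cosser_trunc d n x : 0 <= x ->
  Kop (cosser (trunc d n)) x = \sum_(0 <= i < n) d i * (sing_val R i * sinb i x).
Proof.
move=> x0; elim: n => [|n IHn].
  rewrite big_nil -[RHS](Kop_cst 0 x0); congr (Kop _ x).
  by apply/funext => y; rewrite cosser_trunc big_nil.
rewrite cosser_truncS Kop_linear; [|exact: continuous_trunc|exact: continuous_hbasis].
by rewrite IHn Kop_hbasis// big_nat_recr.
Qed.

Lemma inner_Kop_trunc phi d n : L2 phi ->
  inner phi (Kop (cosser (trunc d n))) =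
  \sum_(0 <= i < n) d i * (sing_val R i * inner phi (sinb i)).
Proof.
move=> Lphi.
transitivity (inner phi (fun x => \sum_(0 <= i < n) (d i * sing_val R i) * sinb i x)).
  apply: eq_inner => x; rewrite inE/= in_itv/= => /andP[x0 _].
  by rewrite Kop_cosser_trunc ?ltW//; apply: eq_bigr => i _; rewrite mulrA.
rewrite inner_sum//; last by move=> i; apply: L2Z; exact: L2_sinb.
by apply: eq_bigr => i _; rewrite innerZ ?mulrA//; exact: L2_sinb.
Qed.

Lemma KopB v w x : continuous v -> continuous w ->
  Kop v x - Kop w x = Kop (fun y : R => v y - w y) x.
Proof.
move=> cv cw; rewrite -mulN1r -Kop_linear//; congr (Kop _ x).
by apply/funext => y; rewrite mulN1r.
Qed.

Lemma inner_Kop_cvg phi d : L2 phi -> ell1 d ->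
  \sum_(0 <= i < n) d i * (sing_val R i * inner phi (sinb i)) @[n --> \oo]
    --> inner phi (Kop (cosser d)).
Proof.
move=> Lphi dl; apply/cvgrPdist_le => e e0.
pose C := \int[mu]_(x in D) `|phi x|.
have C0 : 0 <= C by apply: Rintegral_ge0.
(* The factor 2 is that of [norm_Kop_le], and C + 1 replaces the L1 norm [C] of [phi], which may be
   0. *)
pose e' := e / (2 * (C + 1)).
have e'0 : 0 < e' by rewrite divr_gt0// mulr_gt0// ltr_wpDl.
have cd := continuous_cosser dl.
apply: filterS (cosser_approx dl e'0) => n dn; have ct := @continuous_trunc d n.
rewrite -inner_Kop_trunc// -innerB//; [|exact: L2_Kop|exact: L2_Kop].
apply: (@le_trans _ _ (2 * e' * C)).
  apply: norm_inner_le => //.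
  - by apply: L2B; exact: L2_Kop.
  - by rewrite mulr_ge0// ltW.
  move=> x Dx; rewrite KopB//; apply: norm_Kop_le => //.
  - by move=> y; apply: cvgB; [exact: cd|exact: ct].
  - exact: ltW.
rewrite /e' (_ : _ * C = e * (C / (C + 1))); last by field; rewrite gt_eqF// ltr_wpDl.
by rewrite ler_piMr ?(ltW e0)// ler_pdivrMr ?ltr_wpDl// mul1r lerDl.
Qed.

Lemma inner_sinb_Kop d i : ell1 d ->
  inner (sinb i) (Kop (cosser d)) = sing_val R i * d i.
Proof.
move=> dl; rewrite -(cvg_lim _ (inner_Kop_cvg (@L2_sinb R i) dl))//.
apply/cvg_lim => //; apply: cvg_near_cst; near=> n.
have ni : (i < n)%N by near: n; exists i.+1.
rewrite (bigD1_seq i) ?mem_index_iota ?iota_uniq//= big1 ?addr0.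
  by have [_ ->] := inner_trig R i i; rewrite eqxx mulr1 mulrC.
by move=> j ji; have [_ ->] := inner_trig R i j; rewrite eq_sym (negbTE ji) !mulr0.
Unshelve. all: by end_near. Qed.

(** The good set [S] of the abstract argument: absolute summability makes the cosine series converge
    uniformly and is insensitive to a change of one coordinate. *)
Definition summable_set : set (Rprod nat R) := [set theta | ell1 theta].

Lemma measurable_nneseries_coord (f : nat -> R -> R) :
  (forall i, measurable_fun setT (f i)) -> (forall i t, 0 <= f i t) ->
  measurable_fun setT (fun theta : Rprod nat R => \sum_(i <oo) (f i (theta i))%:E)%E.
Proof.
move=> mf f0; have := @ge0_emeasurable_sum _ (Rprod nat R) R setT
  (fun i theta => (f i (theta i : R))%:E) xpredT.
apply=> [i theta _ _|i _]; first by rewrite lee_fin.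
by apply/measurable_EFinP; exact: measurableT_comp (mf i) (measurable_coord i).
Qed.

Lemma measurable_summable_set : measurable summable_set.
Proof.
have mf : measurable_fun setT (fun theta : Rprod nat R => \sum_(i <oo) (`|theta i : R|)%:E)%E.
  exact: (measurable_nneseries_coord (f := fun _ => @Num.norm R R)).
rewrite (_ : summable_set = ~` ((fun theta : Rprod nat R => \sum_(i <oo) (`|theta i : R|)%:E)%E @^-1` [set +oo%E])).
  by apply: measurableC; rewrite -[X in measurable X]setTI; apply: mf => //; exact: emeasurable_set1.
apply/seteqP; split => theta /=; rewrite /summable_set/= /ell1 ltey.
  by move/eqP.
by move=> H; apply/eqP.
Qed.

Lemma ell1_weighted d (a : R) : 1 < a ->
  (\sum_(i <oo) ((i.+1%:R `^ a) * d i ^+ 2)%:E < +oo)%E -> ell1 d.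
Proof.
move=> a1 doo; have [C C0 dC] := l1_le_weighted_l2 a1.
have s0 : (0 <= \sum_(i <oo) ((i.+1%:R `^ a) * d i ^+ 2)%:E)%E.
  by apply: nneseries_ge0 => i _ _; rewrite lee_fin mulr_ge0 ?powR_ge0 ?sqr_ge0.
move: doo; rewrite -ge0_fin_numE// => /fineK sE.
set s := fine _ in sE; have s0' : 0 <= s by exact: fine_ge0.
have r0 : 0 < s + 1 by rewrite ltr_wpDl.
apply: le_lt_trans (dC _ _ r0 _) (ltry _).
rewrite -sE lee_fin; nra.
Qed.

Lemma prior_summable (alpha : R) (Pi : probability (Rprod nat R) R) :
  1 / 2 < alpha ->
  (forall i, has_law Pi (fun theta : Rprod nat R => theta i : R)
     (normal_prob 0 (prior_sd alpha i))) ->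
  Pi summable_set = 1%E.
Proof.
(* [a] is the midpoint of 1 and 2 alpha. Being above 1, it makes the weighted l2 norm control the l1
   norm; being below 2 alpha, it keeps the expected weighted norm summable, with exponents -1 -
   s. *)
move=> a12 lawPi; pose a := 1 / 2 + alpha; pose s := alpha - 1 / 2.
have a1 : 1 < a by rewrite /a; lra.
have s0 : 0 < s by rewrite /s; lra.
pose f (i : nat) (t : R) : R := i.+1%:R `^ a * t ^+ 2.
have f0 i t : 0 <= f i t by rewrite mulr_ge0 ?powR_ge0 ?sqr_ge0.
have mf i : measurable_fun setT (f i) by apply: measurable_funM => //; exact: measurable_funX.
have mfE i : measurable_fun setT (fun t => (f i t)%:E) by apply/measurable_EFinP; exact: mf.
have fE0 i t : (0 <= (f i t)%:E)%E by rewrite lee_fin.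
have mZ := measurable_nneseries_coord mf f0.
have Efi i : (\int[Pi]_theta (f i (theta i : R))%:E <=
    (2 * normal_moment2 R * i.+1%:R `^ (- 1 - s))%:E)%E.
  rewrite (has_law_integral (lawPi i) (mfE i) (fE0 i)).
  rewrite (ge0_integral_normal_affine 0 (prior_sd_gt0 alpha i) (mfE i) (fE0 i)).
  under eq_integral do rewrite EFinM.
  rewrite ge0_integralZl//; last 2 first.
  - by apply/measurable_EFinP; apply: measurable_funX; apply: measurable_funD => //; exact: measurable_funM.
  - by move=> z _; rewrite lee_fin sqr_ge0.
  apply: (@le_trans _ _ ((i.+1%:R `^ a)%:E * (2 * 0 ^+ 2 + 2 * prior_sd alpha i ^+ 2 * normal_moment2 R)%:E)%E).
    apply: lee_wpmul2l; first by rewrite lee_fin powR_ge0.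
    exact: le_integral_normal_affine_sqr.
  rewrite -EFinM lee_fin prior_sd_sqr expr0n mulr0 add0r.
  rewrite (_ : - 1 - s = a + (- 1 - 2 * alpha)); last by rewrite /a /s; field.
  have -> := @powRDp R i.+1%:R a (- 1 - 2 * alpha) (ltr0Sn _ _).
  move: (i.+1%:R `^ a) (i.+1%:R `^ (- 1 - 2 * alpha)) (normal_moment2 R) => x y z.
  by rewrite le_eqVlt; apply/orP; left; apply/eqP; ring.
have Zoo : (\int[Pi]_theta \sum_(i <oo) (f i (theta i : R))%:E < +oo)%E.
  rewrite integral_nneseries//; last first.
    by move=> i; apply/measurable_EFinP; exact: measurableT_comp (mf i) (measurable_coord i).
  apply: (@le_lt_trans _ _ ((2 * normal_moment2 R * ((2 + s) / s))%:E)); last exact: ltry.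
  apply: (@le_trans _ _ (\sum_(i <oo) (2 * normal_moment2 R * i.+1%:R `^ (- 1 - s))%:E)%E).
    apply: lee_nneseries => [i _ _|i _]; last exact: Efi.
    by apply: integral_ge0 => theta _; rewrite lee_fin.
  have M0 : 0 <= 2 * normal_moment2 R by rewrite mulr_ge0// normal_moment2_ge0.
  apply: nneseries_le_bound => [i|k]; first by rewrite mulr_ge0 ?powR_ge0.
  by rewrite -mulr_sumr ler_wpM2l// sum_powRN_le.
have iZ : Pi.-integrable setT (fun theta : Rprod nat R => \sum_(i <oo) (f i (theta i : R))%:E)%E.
  apply/integrableP; split => //.
  under eq_integral do rewrite gee0_abs ?nneseries_ge0//; last first.
  by [].
have [N [mN N0 subN]] := integrable_ae measurableT iZ.
have PSC : Pi (~` summable_set) = 0%E.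
  apply/eqP; rewrite eq_le measure_ge0 andbT -N0; apply: le_measure; rewrite ?inE//.
    by apply: measurableC; exact: measurable_summable_set.
  move=> theta /= nS; apply: subN => /= fin; apply: nS; apply: (ell1_weighted a1).
  by have := fin I; rewrite fin_numE => /andP[_]; rewrite -ltey.
by rewrite -[summable_set]setCK probability_setC ?PSC ?sube0//; apply: measurableC; exact: measurable_summable_set.
Qed.

(* The value 0 off [summable_set], a null set for the prior, only serves the
   measurability: there [vfun g theta] is a limit of a possibly divergent series. *)
Definition signal (theta : Rprod nat R) : Rprod (L2fun R) R :=
  fun phi : L2fun R => if theta \in summable_set then inner (sval phi) (Kop (cosser theta)) else 0.

(** At each [phi] the signal is a limit of finite linear combinations of coordinates, cut off
    outside the measurable set [summable_set]. *)
Lemma measurable_signal : measurable_fun setT signal.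
Proof.
apply: measurable_Rprod => phi; pose a i := sing_val R i * inner (sval phi) (sinb i).
pose p n (theta : Rprod nat R) : R :=
  if theta \in summable_set then \sum_(0 <= i < n) theta i * a i else 0.
apply: (@measurable_fun_cvg _ _ _ setT p) => [n|theta _].
  apply: measurable_fun_ifT => //.
    apply: (measurable_fun_bool true); rewrite setTI.
    rewrite (_ : _ @^-1` _ = summable_set); first exact: measurable_summable_set.
    by apply/seteqP; split => theta /=; [move/set_mem|move/mem_set].
  apply: measurable_sum => i; apply: measurable_funM => //; exact: measurable_coord.
rewrite /p /signal; case: ifPn => [/set_mem Stheta|_]; last exact: cvg_cst.
by apply: inner_Kop_cvg => //; exact: svalP.
Qed.

Lemma upd_finite i t : ell1 (fun j => if j == i then t else 0).
Proof.
apply: (@ell1_finite _ _ i.+1) => j ij.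
by case: eqP => // ji; rewrite ji ltnn in ij.
Qed.

Lemma updE theta i t :
  upd theta i t = fun j => upd theta i 0 j + (if j == i then t else 0).
Proof. by apply/funext => j; rewrite /upd; case: eqP => _; rewrite ?add0r ?addr0. Qed.

Lemma summable_upd theta i t : summable_set theta -> summable_set (upd theta i t).
Proof.
move=> Stheta; rewrite /summable_set/= (_ : upd theta i t =
  fun j => theta j + (if j == i then t - theta i else 0)).
  by apply: ell1D => //; exact: upd_finite.
by apply/funext => j; rewrite /upd; case: eqP => [->|_]; rewrite ?addr0// addrC subrK.
Qed.

Lemma cosser_upd theta i t : summable_set theta ->
  cosser (upd theta i t) = fun x => cosser (upd theta i 0) x + t * hbasis i.+1 x.
Proof.
move=> Stheta; apply/funext => x; rewrite updE cosserD; last 2 first.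
- exact: summable_upd.
- exact: upd_finite.
congr (_ + _); rewrite (cosser_finite (n := i.+1)).
  rewrite big_nat_recr//= eqxx big_nat_cond big1 ?add0r// => j /andP[/andP[_ ji] _].
  by rewrite (ltn_eqF ji) mul0r.
by move=> j ij; case: eqP => // ji; rewrite ji ltnn in ij.
Qed.

Lemma signal_upd theta i t (phi : L2fun R) : summable_set theta ->
  signal (upd theta i t) phi =
  signal (upd theta i 0) phi + t * (sing_val R i * inner (sval phi) (sinb i)).
Proof.
move=> Stheta; have S0 := summable_upd i 0 Stheta; have St := summable_upd i t Stheta.
have Lphi := svalP phi; have Ls := @L2_sinb R i.
rewrite /signal !mem_set// cosser_upd// mulrA -innerZ// -innerD//; last 2 first.
- by apply: L2_Kop; exact: continuous_cosser.
- exact: L2Z.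
apply: eq_inner => x; rewrite inE/= in_itv/= => /andP[x0 _].
apply: etrans (Kop_linear t x (continuous_cosser S0) (@continuous_hbasis R i.+1)) _.
by rewrite Kop_hbasis ?(ltW x0)// mulrA.
Qed.

Lemma signal_diff theta0 theta : summable_set theta0 -> summable_set theta ->
  exists f : L2fun R, forall phi : L2fun R,
    signal theta0 phi = signal theta phi + inner (sval phi) (sval f).
Proof.
move=> S0 S1; have L0 : L2 (Kop (cosser theta0)) by apply: L2_Kop; exact: continuous_cosser.
have L1 : L2 (Kop (cosser theta)) by apply: L2_Kop; exact: continuous_cosser.
exists (exist _ _ (L2B L0 L1)) => phi; rewrite /signal !mem_set//=.
by rewrite innerB//; [rewrite addrC subrK|exact: svalP].
Qed.

Lemma gtilde_derive (g : R -> R) x : derive1 (gtilde g) x = g 1 - g 0.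
Proof.
rewrite derive1E; apply: derive_val => //; apply: is_derive_eq.
by rewrite add0r mul1r [_ *: 1]mulr1.
Qed.

Lemma vfunE (g : R -> R) theta : vfun g theta = fun x => (g 1 - g 0) + cosser theta x.
Proof. by apply/funext => x; rewrite /vfun gtilde_derive. Qed.

(** [Kop] annihilates constants, so the deterministic part of the prior does not enter the
    observation. *)
Lemma Kop_vfun (g : R -> R) theta x : ell1 theta -> 0 <= x ->
  Kop (vfun g theta) x = Kop (cosser theta) x.
Proof.
move=> tl x0; rewrite vfunE.
have cc : continuous (cst (g 1 - g 0) : R -> R) by move=> y; exact: cvg_cst.
have := Kop_linear 1 x cc (continuous_cosser tl); rewrite Kop_cst// add0r mul1r => <-.
by congr (Kop _ x); apply/funext => y; rewrite mul1r.
Qed.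

Lemma observe_vfun disp (Omega : measurableType disp) (W : L2fun R -> Omega -> R)
    (g : R -> R) theta n w : ell1 theta ->
  observe W n (Kop (vfun g theta)) w = obs signal (noise_sd R n) theta (W ^~ w).
Proof.
move=> tl; apply/funext => phi; rewrite /observe /obs /signal (mem_set (tl : summable_set theta)) /noise_sd.
rewrite [inner _ (Kop (vfun _ _))](@eq_inner _ _ _ (Kop (cosser theta)))// => x; rewrite inE/= in_itv/= => /andP[x0 _].
by rewrite Kop_vfun// ltW.
Qed.

End darcy_signal.

(** * From the observation of [vfun] to the measurable [signal]: an identity off a null set *)

Import HBSimple HBNNSimple.

(* The integral of a nonnegative function is a supremum over the simple
   functions below it, hence no measurability of [f] and [g] is needed. *)
Lemma ge0_le_integral_off_null d (T : measurableType d) (R : realType)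
    (m : {measure set T -> \bar R}) (N : set T) (f g : T -> \bar R) :
  measurable N -> m N = 0%E -> (forall x, 0 <= f x)%E -> (forall x, 0 <= g x)%E ->
  (forall x, ~ N x -> f x <= g x)%E -> (\int[m]_x f x <= \int[m]_x g x)%E.
Proof.
move=> mN N0 f0 g0 fg; rewrite !ge0_integralTE//.
apply: ge_ereal_sup => _ /= [h hf <-].
pose h' := proj_nnsfun h (measurableC mN).
have h'E x : h' x = h x * \1_(~` N) x by [].
apply: (@le_trans _ _ (sintegral m h')); last first.
  apply: ereal_sup_ubound; exists h' => // x; rewrite h'E indicE.
  case: (boolP (x \in ~` N)) => [/set_mem /= Nx|_]; last by rewrite mulr0.
  by rewrite mulr1 (le_trans (hf x))// fg.
rewrite -!integralT_nnsfun le_eqVlt; apply/orP; left; apply/eqP.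
apply: ae_eq_integral => //.
- by apply/measurable_EFinP; exact: measurable_funPT.
- by apply/measurable_EFinP; exact: measurable_funPT.
exists N; split => // x /= nE; apply: contrapT => Nx; apply: nE => _.
by rewrite mindicE mem_set// mulr1.
Qed.

Lemma ge0_eq_integral_off_null d (T : measurableType d) (R : realType)
    (m : {measure set T -> \bar R}) (N : set T) (f g : T -> \bar R) :
  measurable N -> m N = 0%E -> (forall x, 0 <= f x)%E -> (forall x, 0 <= g x)%E ->
  (forall x, ~ N x -> f x = g x) -> (\int[m]_x f x = \int[m]_x g x)%E.
Proof.
move=> mN N0 f0 g0 fg; apply/eqP; rewrite eq_le; apply/andP; split;
  apply: (ge0_le_integral_off_null mN N0) => // x /fg ->; exact: lexx.
Qed.

Section posterior_signal.
Context (R : realType) d (Omega : measurableType d) (P : probability Omega R)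
  (W : L2fun R -> Omega -> R) (g : R -> R) (Pi : probability (Rprod nat R) R)
  (n : nat) (Q : R.-pker Rprod (L2fun R) R ~> Rprod nat R).
Hypothesis hW : white_noise P W.
Hypothesis hQ : is_posterior P W g Pi n Q.
Hypothesis PiS : Pi (@summable_set R) = 1%E.

Local Notation S := (@summable_set R).
Local Notation Y := (fun p : Rprod nat R * Omega => obs (@signal R) (noise_sd R n) p.1 (W ^~ p.2)).
Local Notation Y0 := (fun p : Rprod nat R * Omega => observe W n (Kop (vfun g p.1)) p.2).
Local Open Scope ereal_scope.

Let mS : measurable S := @measurable_summable_set R.

Let mY : measurable_fun setT Y.
Proof.
have mp : measurable_fun setT
    (fun p : Rprod nat R * Omega => (p.1, W ^~ p.2 : Rprod (L2fun R) R)).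
  apply: measurable_fun_pair; first exact: measurable_fst.
  exact: measurableT_comp (white_noise_measurableT hW) measurable_snd.
exact: (measurableT_comp (measurable_obs (noise_sd R n) (@measurable_signal R)) mp).
Qed.

Let N : set (Rprod nat R * Omega) := ~` (fst @^-1` S).

Let mN : measurable N.
Proof. by apply: measurableC; rewrite -[X in measurable X]setTI; exact: measurable_fst. Qed.

Let PSC : Pi (~` S) = 0.
Proof. by rewrite probability_setC// PiS subee. Qed.

Let PN0 : (Pi \x P) N = 0.
Proof.
rewrite (_ : N = (~` S) `*` setT); last first.
  by apply/seteqP; split => p /=; [split|case].
rewrite product_measure1E//; last exact: measurableC.
by rewrite [X in X * _]PSC mul0e.
Qed.

Let YE p : ~ N p -> Y0 p = Y p.
Proof. by rewrite /N /= => /contrapT Sp; exact: observe_vfun. Qed.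

Let mQ A : measurable A -> measurable_fun setT (fun p => Q (Y p) A).
Proof. by move=> mA; exact: (measurableT_comp (measurable_kernel Q A mA) mY). Qed.

Let mYB B : measurable B -> measurable [set p | B (Y p)].
Proof. by move=> mB; rewrite -[X in measurable X]setTI; exact: mY. Qed.

Let mPA A : measurable A -> measurable [set p : Rprod nat R * Omega | A p.1].
Proof. by move=> mA; rewrite -[X in measurable X]setTI; exact: measurable_fst. Qed.

(** The hypothesis [hQ] concerns [Y0], which agrees with [Y] on [S]: it is applied to the
    intersection of [A] and [S]. In the integral on the right the two observations differ over the
    null set [N] only, and replacing one by the other requires no measurability of [Y0]. *)
Let posterior_summable A B : measurable A -> measurable B ->
  (Pi \x P) [set p | A p.1 /\ B (Y p)] =
  \int[Pi \x P]_(p in [set p | B (Y p)]) Q (Y p) (A `&` S).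
Proof.
move=> mA mB; have mAS : measurable (A `&` S) by exact: measurableI.
transitivity ((Pi \x P) [set p | (A `&` S) p.1 /\ B (Y p)]).
  rewrite [LHS](@measureDI _ _ _ (Pi \x P) _ N)//; last first.
    by apply: measurableI; [exact: mPA|exact: mYB].
  rewrite [X in _ + X](_ : _ = 0) ?adde0; last first.
    apply/eqP; rewrite eq_le measure_ge0 andbT -PN0; apply: le_measure; rewrite ?inE//.
      by apply: measurableI => //; apply: measurableI; [exact: mPA|exact: mYB].
  congr ((Pi \x P) _); apply/seteqP; split => p /=.
    by move=> [[Ap Bp] /contrapT Sp].
  by move=> [[Ap Sp] Bp]; split=> // /(_ Sp).
rewrite (_ : [set p | (A `&` S) p.1 /\ B (Y p)] = [set p | (A `&` S) p.1 /\ B (Y0 p)]); last first.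
  apply/seteqP; split => p /= [[Ap Sp] Bp]; split => //.
    by rewrite YE// => /(_ Sp).
  by rewrite -YE// => /(_ Sp).
rewrite (hQ mAS mB) integral_mkcond [RHS]integral_mkcond.
apply: (ge0_eq_integral_off_null mN PN0).
- by move=> p; rewrite patchE; case: ifP.
- by move=> p; rewrite patchE; case: ifP.
move=> p Np; rewrite !patchE YE//; congr (if _ then _ else _).
by apply/idP/idP => /set_mem /= Bp; apply/mem_set; rewrite /= ?YE// -?YE.
Qed.

Lemma posterior_signal A B : measurable A -> measurable B ->
  (Pi \x P) [set p | A p.1 /\ B (Y p)] =
  \int[Pi \x P]_(p in [set p | B (Y p)]) Q (Y p) A.
Proof.
move=> mA mB; rewrite posterior_summable//.
have mAS : measurable (A `&` S) by exact: measurableI.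
have mASC : measurable (A `&` ~` S) by apply: measurableI => //; exact: measurableC.
have QS0 : \int[Pi \x P]_p Q (Y p) (~` S) = 0.
  have intS : \int[Pi \x P]_p Q (Y p) S = 1.
    have := posterior_summable (@measurableT _ (Rprod nat R)) (@measurableT _ (Rprod (L2fun R) R)).
    rewrite setTI => <-; rewrite (_ : [set p | _ ] = setT) ?probability_setT//.
    by apply/seteqP; split.
  have := @ge0_integralD _ _ _ (Pi \x P) setT measurableT (fun p => Q (Y p) S)
    (fun p => Q (Y p) (~` S)).
  rewrite intS => /(_ _ (mQ mS) _ (mQ (measurableC mS))).
  rewrite (_ : \int[_]_p (_ + _) = 1).
    move=> H; have := H (fun _ _ => measure_ge0 _ _) (fun _ _ => measure_ge0 _ _).
    have : 0 <= \int[Pi \x P]_p Q (Y p) (~` S) by exact: integral_ge0.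
    case: (\int[Pi \x P]_p Q (Y p) (~` S)) => [r||]//= r0 [] /esym/eqP.
    by rewrite -[X in _ == X](addr0 1%R) => /eqP/addrI ->.
  transitivity (\int[Pi \x P]_p (1 : \bar R)).
    apply: eq_integral => p _; rewrite -measureU//.
    - by rewrite setUv; exact: prob_kernel.
    - exact: measurableC.
    - by rewrite setICr.
  rewrite integral_cst// mul1e; exact: (@probability_setT _ _ _ (Pi \x P)%E).
transitivity (\int[Pi \x P]_(p in [set p | B (Y p)]) (Q (Y p) (A `&` S) + Q (Y p) (A `&` ~` S))).
  rewrite ge0_integralD//; [|exact: mYB|exact: measurable_funTS (mQ mAS)|exact: measurable_funTS (mQ mASC)].
  rewrite [X in _ + X](_ : _ = 0) ?adde0//.
  apply/eqP; rewrite eq_le integral_ge0// andbT -QS0.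
  apply: (@le_trans _ _ (\int[Pi \x P]_p Q (Y p) (A `&` ~` S))).
    apply: ge0_subset_integral => //; [exact: mYB|exact: mQ].
  apply: ge0_le_integral => //; [exact: mQ|apply: mQ; exact: measurableC|].
  by move=> p _; apply: le_measure; rewrite ?inE//; exact: measurableC.
apply: eq_integral => p _; rewrite -measureU//; last by rewrite setIACA setICr setI0.
by rewrite -setIUr setUv setIT.
Qed.

End posterior_signal.

(** * The true coefficient *)

Section scale_representation.
Context (R : realType).
Local Notation mu := (@lebesgue_measure R).
Local Notation D := (`]0, 1[%classic : set R).

Lemma L2norm_lt (f : R -> R) (e : R) : 0 < e -> (L2norm f < e%:E)%E ->
  (\int[mu]_(x in D) (f x ^+ 2)%:E <= (e ^+ 2)%:E)%E.
Proof.
move=> e0; rewrite L2normE; have := int_sqr_ge0 f.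
case: (\int[mu]_(x in D) (f x ^+ 2)%:E)%E => [r|_|//].
  rewrite lee_fin poweR_EFin lte_fin => r0; rewrite powR12_sqrt// => /ltW re.
  by rewrite lee_fin -(sqr_sqrtr r0) ler_sqr ?nnegrE ?sqrtr_ge0 ?(ltW e0).
by rewrite poweRyr ?invr_neq0.
Qed.

Lemma continuous_int_sqr_eq0 (f : R -> R) : measurable_fun D f ->
  (forall x, D x -> {for x, continuous f}) ->
  (\int[mu]_(x in D) (f x ^+ 2)%:E = 0)%E -> forall x, D x -> f x = 0.
Proof.
move=> mf cf If x Dx; apply/eqP/negPn/negP => fx0.
have e0 : 0 < `|f x| / 2 by rewrite divr_gt0 ?normr_gt0.
have near_f : \forall y \near x, `|f x| / 2 <= `|f y|.
  have /cvgrPdist_le/(_ _ e0) := cf x Dx; apply: filterS => y fxy.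
  have := ler_normD (f y) (f x - f y); rewrite addrC subrK; lra.
have near_D : \forall y \near x, D y by exact: (open_nbhs_nbhs (conj (interval_open _ _) Dx)).
have /nbhs_ballP[r /= r0 sub] : nbhs x (fun y => D y /\ `|f x| / 2 <= `|f y|) by exact: filterI.
have mf2 : measurable_fun D (fun y => (f y ^+ 2)%:E).
  by apply/measurable_EFinP; exact: measurable_funX.
have mB := measurable_ball x r.
suff : (0 < \int[mu]_(y in D) (f y ^+ 2)%:E)%E by rewrite If ltxx.
apply: (@lt_le_trans _ _ (\int[mu]_(y in ball x r) ((`|f x| / 2) ^+ 2)%:E)%E).
  rewrite integral_cst// [X in (_ * X)%E]lebesgue_measure_ball ?(ltW r0)// -EFinM lte_fin.
  by rewrite mulr_gt0 ?exprn_gt0// pmulrn_lgt0.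
apply: (@le_trans _ _ (\int[mu]_(y in ball x r) (f y ^+ 2)%:E)%E).
  apply: ge0_le_integral => //.
  - by apply: (measurable_funS _ _ mf2) => // y /sub[].
  - move=> y /sub[_ fy]; rewrite lee_fin -[leRHS]real_normK ?num_real//.
    by rewrite ler_sqr// nnegrE ?normr_ge0// ltW.
apply: (@ge0_subset_integral _ _ _ mu _ _ mB (measurable_itv _) _ mf2) => y.
  by move=> _; rewrite lee_fin sqr_ge0.
by move=> /sub[].
Qed.

Lemma int_sqr_dist_le (f w : R -> R) (r : R) :
  measurable_fun D f -> measurable_fun D w -> (forall x, D x -> `|f x - w x| <= r) ->
  (\int[mu]_(x in D) (f x ^+ 2)%:E <=
   2%:E * \int[mu]_(x in D) (w x ^+ 2)%:E + (2 * r ^+ 2)%:E)%E.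
Proof.
move=> mf mw fw.
have mw2 : measurable_fun D (fun x => (w x ^+ 2)%:E).
  by apply/measurable_EFinP; exact: measurable_funX.
apply: (@le_trans _ _ (\int[mu]_(x in D) (2%:E * (w x ^+ 2)%:E + (2 * r ^+ 2)%:E))%E).
  apply: ge0_le_integral => //.
  - by move=> x _; rewrite lee_fin sqr_ge0.
  - by apply/measurable_EFinP; exact: measurable_funX.
  - by apply: emeasurable_funD => //; exact: measurable_funeM.
  - move=> x Dx; rewrite -EFinM -EFinD lee_fin.
    have : (f x - w x) ^+ 2 <= r ^+ 2.
      rewrite -real_normK ?num_real// ler_sqr ?nnegrE ?normr_ge0 ?fw//.
      exact: le_trans (normr_ge0 _) (fw _ Dx).
    by have := sqr_ge0 (w x - (f x - w x)); lra.
rewrite ge0_integralD//; last 3 first.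
- by move=> x _; apply: mule_ge0; rewrite lee_fin ?sqr_ge0.
- exact: measurable_funeM.
- by move=> x _; rewrite lee_fin mulr_ge0// sqr_ge0.
rewrite ge0_integralZl//; last by move=> x _; rewrite lee_fin sqr_ge0.
by rewrite integral_cst// [X in (_ + _ * X)%E]lebesgue_measure01 mule1.
Qed.

(** For beta > 1/2 the coefficients are absolutely summable, so the series has a continuous sum. It
    agrees with [v] in L2, and since [v] is continuous on (0,1), at every point; pointwise equality
    is what the solution map and the uniform norm require. *)
Lemma scale_cosser (beta : R) (v : R -> R) : 1 / 2 < beta -> in_scale beta v ->
  (forall x, D x -> {for x, continuous v}) ->
  exists (a : R) (d : nat -> R),
    [/\ (\sum_(i <oo) ((i.+1%:R `^ (2 * beta)) * d i ^+ 2)%:E < +oo)%E, ell1 d &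
        forall x, D x -> v x = a + cosser d x].
Proof.
move=> beta12 [/L2P[mv _] [c [cvgv cbeta]]] cv; exists (c 0%N), (fun i => c i.+1).
have doo : (\sum_(i <oo) ((i.+1%:R `^ (2 * beta)) * c i.+1 ^+ 2)%:E < +oo)%E.
  apply: le_lt_trans cbeta.
  rewrite -(@nneseries_addn R (fun i => (i%:R `^ (2 * beta) * c i ^+ 2)%:E) 1); last first.
    by move=> i; rewrite lee_fin mulr_ge0 ?powR_ge0 ?sqr_ge0.
  by under [leRHS]eq_eseriesr do rewrite addn1.
have dl : ell1 (fun i => c i.+1) by apply: ell1_weighted doo; lra.
split=> // x Dx; apply/eqP; rewrite -subr_eq0; apply/eqP.
set d := fun i => c i.+1 in doo dl *.
pose V y := c 0%N + cosser d y.
have cV : continuous V.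
  by move=> y; apply: cvgD; [exact: cvg_cst|exact: continuous_cosser].
have mV : measurable_fun D V by apply: measurable_funTS; exact: continuous_measurable_fun.
have mf : measurable_fun D (fun y => v y - V y) by exact: measurable_funB.
apply: (@continuous_int_sqr_eq0 (fun y => v y - V y)) Dx => //.
  by move=> y Dy; apply: cvgB; [exact: cv|exact: cV].
apply/eqP; rewrite eq_le int_sqr_ge0 andbT; apply/lee_addgt0Pr => _/posnumP[e].
(* The squared distance will be bounded by 2 r^2 + 2 r^2, one term for the L2 convergence and one
   for the uniform one. *)
pose r : R := Num.sqrt (e%:num / 4).
have r0 : 0 < r by rewrite sqrtr_gt0.
have r2 : r ^+ 2 = e%:num / 4 by rewrite sqr_sqrtr.
pose w n y := v y - \sum_(0 <= i < n) c i * hbasis i y.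
have near_w : \forall n \near \oo, (L2norm (w n.+1) < r%:E)%E.
  have nb : nbhs (0%E : \bar R) [set x | (x < r%:E)%E].
    by apply: open_nbhs_nbhs; split; [exact: open_ereal_lt_ereal|rewrite /= lte_fin].
  by have [m _ wm] := cvgv _ nb; exists m => // n mn; apply: wm; exact: leqW.
have near_c := cosser_approx dl r0.
near \oo => n.
have wn : (L2norm (w n.+1) < r%:E)%E by near: n.
have cn : forall y, `|cosser d y - cosser (trunc d n) y| <= r by near: n.
have wE y : w n.+1 y = v y - (c 0%N + cosser (trunc d n) y).
  by rewrite /w big_nat_recl// cosser_trunc mulr1.
have mw : measurable_fun D (w n.+1).
  rewrite (_ : w n.+1 = fun y => v y - (c 0%N + cosser (trunc d n) y)); last exact/funext.
  apply: measurable_funB => //; apply: measurable_funTS; apply: continuous_measurable_fun => y.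
  by apply: cvgD; [exact: cvg_cst|exact: continuous_trunc].
rewrite add0e; apply: (le_trans (int_sqr_dist_le mf mw (r := r) _)).
  move=> y _; rewrite (_ : _ - _ = - (cosser d y - cosser (trunc d n) y)); first by rewrite normrN.
  by rewrite wE /V; ring.
apply: (@le_trans _ _ (2%:E * (r ^+ 2)%:E + (2 * r ^+ 2)%:E)%E).
  by rewrite leeD2r// lee_wpmul2l// L2norm_lt.
by rewrite -EFinM -EFinD lee_fin r2; lra.
Unshelve. all: by end_near. Qed.

End scale_representation.

Section true_signal.
Context (R : realType) (h g f0 u0 : R -> R) (a : R) (d : nat -> R).
Local Notation mu := (@lebesgue_measure R).
Local Notation D := (`]0, 1[%classic : set R).
Hypothesis hf0 : darcy h g f0 u0.
Hypothesis dl : ell1 d.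
Hypothesis u0E : forall x, D x -> derive1 u0 x = a + cosser d x.

(** Continuous extension of u0' beyond (0,1); [V 0] takes the place of the derivative at 0, about
    which the equation says nothing. *)
Let V x := a + cosser d x.

Let cV : continuous V.
Proof. by move=> y; apply: cvgD; [exact: cvg_cst|exact: continuous_cosser]. Qed.

Lemma Rintegral_trunc n : \int[mu]_(s in D) cosser (trunc d n) s = 0.
Proof.
elim: n => [|n IHn].
  transitivity (\int[mu]_(s in D) (0 : R)); last by rewrite Rintegral_cst// mul0r.
  by apply: eq_Rintegral => s _; rewrite cosser_trunc big_nil.
rewrite cosser_truncS RintegralD//; last 2 first.
- by apply: continuous_integrable_oo; exact: continuous_trunc.
- by apply: continuous_integrable_oo => y; apply: cvgM; [exact: cvg_cst|exact: (@continuous_hbasis R n.+1)].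
rewrite IHn add0r RintegralZl//; last first.
  by apply: continuous_integrable_oo; exact: (@continuous_hbasis R n.+1).
by rewrite Rintegral_hbasis// /sinb mulr1 sin_pi_nat !mulr0.
Qed.

Lemma Rintegral_cosser : \int[mu]_(s in D) cosser d s = 0.
Proof.
apply/eqP; rewrite -normr_le0; apply/ler_addgt0Pr => e e0; rewrite add0r.
have [n _ /(_ n (leqnn n)) dn] := cosser_approx dl e0.
have cd := continuous_cosser dl; have ct := @continuous_trunc R d n.
have -> : \int[mu]_(s in D) cosser d s = \int[mu]_(s in D) (cosser d s - cosser (trunc d n) s).
  by rewrite RintegralB// ?Rintegral_trunc ?subr0//; exact: continuous_integrable_oo.
apply: norm_Rintegral_le => //; last exact: ltW.
by move=> y; apply: cvgB; [exact: cd|exact: ct].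
Qed.

Lemma Rintegral_derive_u0 x : 0 < x -> x <= 1 ->
  \int[mu]_(s in `]0, x[) V s = u0 x - g 0.
Proof.
move=> x0 x1; have /continuous_within_itvP[//|cu cu0 cu1] := darcy_cu hf0.
have sub y : y \in `]0, x[ -> y \in `]0, 1[.
  by rewrite !in_itv/= => /andP[-> yx]; exact: lt_le_trans yx x1.
rewrite Rintegral_oo_cc// /Rintegral (@continuous_FTC2 _ V u0)//.
- by rewrite /= (darcy_u0 hf0).
- exact: continuous_subspaceT.
- split => //.
  + by move=> y /sub Dy; exact: (darcy_du hf0).
  + move: x1; rewrite le_eqVlt => /predU1P[->//|x1].
    by apply: cvg_at_left_filter; apply: cu; rewrite in_itv/= x0.
- by move=> y /sub Dy; rewrite u0E.
Qed.

(** The cosines have mean 0, so [a] is the integral of u0', that is u0(1) - u0(0). Hence u0' has the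
    form of the functions in the prior, with [d] as true parameter. *)
Lemma scale_mean : a = g 1 - g 0.
Proof.
have := Rintegral_derive_u0 ltr01 (lexx 1); rewrite (darcy_u1 hf0) => <-.
rewrite RintegralD//; last 2 first.
- by apply: (@continuous_integrable_oo _ (cst a)) => y; exact: cvg_cst.
- by apply: continuous_integrable_oo; exact: continuous_cosser.
by rewrite Rintegral_cosser addr0 Rintegral_cst// [X in fine X]lebesgue_measure01 mulr1.
Qed.

Lemma VE : V = vfun g d.
Proof. by rewrite vfunE -scale_mean. Qed.

Lemma u0_signal x : D x -> u0 x = gtilde g x + Kop (cosser d) x.
Proof.
rewrite /= in_itv/= => /andP[x0 x1]; rewrite -(@Kop_vfun _ g)// ?(ltW x0)// -VE.
rewrite /Kop !Rintegral_derive_u0// ?(ltW x1)// (darcy_u1 hf0) /gtilde; ring.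
Qed.

Lemma shift_obs_true disp (Omega : measurableType disp) (W : L2fun R -> Omega -> R) n w :
  shift_obs g (observe W n u0 w) = obs (@signal R) (noise_sd R n) d (W ^~ w).
Proof.
apply/funext => phi; rewrite /shift_obs /observe /obs /signal.
rewrite (mem_set (dl : summable_set d)) /noise_sd.
have Lphi := svalP phi.
have Lg : L2 (gtilde g).
  apply: L2_continuous => y; apply: cvgD; first exact: cvg_cst.
  by apply: cvgM; [exact: cvg_cst|exact: cvg_id].
have LK : L2 (Kop (cosser d)) by apply: L2_Kop; exact: continuous_cosser.
rewrite [inner _ u0](@eq_inner _ _ _ (fun x => gtilde g x + Kop (cosser d) x)); last first.
  by move=> x; rewrite inE => Dx; exact: u0_signal.
by rewrite innerD// addrAC [X in X + _]addrAC subrr add0r.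
Qed.

Hypothesis h_int : forall x : R, x \in `]0, 1[ -> mu.-integrable `]0, x[ (EFin \o h).

Lemma integrable_Rintegral_oo_cc (f : R -> R) x : mu.-integrable `[0, x] (EFin \o f) ->
  0 < x -> \int[mu]_(s in `]0, x[) f s = \int[mu]_(s in `[0, x]) f s.
Proof.
move=> fi x0; rewrite Rintegral_itv_bndo_bndc; last first.
  by apply: (integrableS _ _ _ fi) => //; exact: subset_itv_oo_cc.
rewrite Rintegral_itv_obnd_cbnd//; apply: (integrableS _ _ _ fi) => //.
exact: subset_itv_oc_cc.
Qed.

(** The fundamental theorem is applied to F = f0 u0' on [y, x] with y > 0, and then y tends to 0.
    Right-continuity of [f0] and continuity of [V] give the limit of F; integrability of [h] near 0
    makes its primitive vanish there. *)
Lemma darcy_solution x : D x -> f0 x * V x = primitive0 h x + f0 0 * V 0.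
Proof.
move=> Dx; have := Dx; rewrite /= in_itv/= => /andP[x0 x1].
(* The integrability of [h] is known on open intervals only. A point [z] beyond [x] makes [h]
   integrable on a set containing [x], and the extension by 0 outside []0, z[] gives a function
   integrable on closed intervals. *)
have [xz z1] := midf_lt x1; set z := (x + 1) / 2 in xz z1.
have z0 : 0 < z by exact: lt_trans xz.
pose hh := h \_ (`]0, z[%classic).
have hhE t : t \in `]0, z[ -> hh t = h t by move=> tz; rewrite /hh patchE mem_set.
have ihh : mu.-integrable `[0, z] (EFin \o hh).
  apply: (@integrableS _ _ _ mu setT) => //.
  have Dz : z \in `]0, 1[ by rewrite in_itv/= z0 z1.
  rewrite (_ : EFin \o hh = (EFin \o h) \_ (`]0, z[%classic)).
    exact: ((@integrable_mkcond _ _ _ mu _ (EFin \o h) (measurable_itv `]0, z[)).1 (h_int Dz)).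
  by apply/funext => t; rewrite /hh /= !patchE; case: ifP.
have HE y : 0 < y -> y <= x -> primitive0 h y = \int[mu]_(s in `[0, y]) hh s.
  move=> y0 yx; have yz := le_lt_trans yx xz.
  rewrite -integrable_Rintegral_oo_cc//; last first.
    by apply: (integrableS _ _ _ ihh) => //; apply: subset_itvl; rewrite bnd_simp ltW.
  apply: eq_Rintegral => t; rewrite inE/= in_itv/= => /andP[t0 ty].
  by rewrite hhE// in_itv/= t0 (lt_trans ty).
pose F y := f0 y * derive1 u0 y.
have dF t : t \in `]0, 1[ -> derivable F t 1 /\ derive1 F t = h t.
  move=> Dt; have df := darcy_df hf0 Dt; have ddu := darcy_ddu hf0 Dt; split.
    exact: (@derivableM _ _ f0 (derive1 u0) t 1 df ddu).
  rewrite derive1E [LHS](@deriveM _ _ f0 (derive1 u0) t 1 df ddu) -(darcy_eq hf0 Dt) !derive1E addrC; congr (_ + _).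
  by rewrite [LHS]mulrC.
have incr y : 0 < y -> y < x -> F y = F x - primitive0 h x + primitive0 h y.
  move=> y0 yx; have : F x - F y = primitive0 h x - primitive0 h y; last by lra.
  rewrite !HE// ?(ltW yx)// Rintegral_itvB; last 3 first.
  - by apply: (integrableS _ _ _ ihh) => //; apply: subset_itvl; rewrite bnd_simp ltW.
  - by rewrite bnd_simp ltW.
  - by rewrite bnd_simp ltW.
  have ihh' : mu.-integrable `[y, x] (EFin \o hh).
    apply: (integrableS _ _ _ ihh) => // t /=; rewrite !in_itv/= => /andP[yt tx].
    by rewrite (le_trans (ltW y0) yt) (le_trans tx (ltW xz)).
  rewrite Rintegral_itv_obnd_cbnd; last first.
    by apply: (integrableS _ _ _ ihh') => //; exact: subset_itv_oc_cc.
  have := @everywhere_derivable_FTC R F hh y x yx _ ihh'.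
  rewrite /Rintegral => <-//= t; rewrite /= in_itv/= => /andP[yt tx].
  have t0 := lt_le_trans y0 yt.
  rewrite hhE; last by rewrite in_itv/= t0 (le_lt_trans tx xz).
  by apply: dF; rewrite in_itv/= t0 (le_lt_trans tx x1).
have cF : F y @[y --> 0^'+] --> f0 0 * V 0.
  apply: (@cvg_trans _ (f0 y * V y @[y --> 0^'+])).
    apply: near_eq_cvg; near=> y; rewrite /F u0E// /= in_itv/=.
    by apply/andP; split; near: y; [exact: nbhs_right_gt|exact: nbhs_right_lt].
  apply: cvgM; first exact: darcy_f0 hf0.
  by apply: cvg_at_right_filter; exact: cV.
have cH : F y @[y --> 0^'+] --> F x - primitive0 h x + 0.
  apply: (@cvg_trans _ (F x - primitive0 h x + \int[mu]_(s in `[0, y]) hh s @[y --> 0^'+])).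
    apply: near_eq_cvg; near=> y; have y0 : 0 < y by near: y; exact: nbhs_right_gt.
    have yx : y < x by near: y; exact: nbhs_right_lt.
    by rewrite (incr y y0 yx) (HE y y0 (ltW yx)).
  apply: cvgD; first exact: cvg_cst.
  apply: cvg_at_right_filter; exact: (parameterized_integral_cvg_left z0 ihh).
have E : f0 0 * V 0 = F x - primitive0 h x + 0.
  by apply: (cvg_unique _ cF cH); exact: norm_hausdorff.
by rewrite E addr0 addrCA subrr addr0 /F u0E.
Unshelve. all: by end_near. Qed.

End true_signal.

(** * Error of the solution map *)

Section norm_bounds.
Context (R : realType).
Local Notation mu := (@lebesgue_measure R).
Local Notation D := (`]0, 1[%classic : set R).
Implicit Types (d : nat -> R) (x : R).

(** Orthonormality gives the exact value for truncations, and the uniform approximation does the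
    rest; the factor 2 comes from (x + y)^2 <= 2 x^2 + 2 y^2. *)
Lemma int_sqr_cosser_le d : ell1 d ->
  (\int[mu]_(x in D) (cosser d x ^+ 2)%:E <= 2%:E * \sum_(i <oo) (d i ^+ 2)%:E)%E.
Proof.
move=> dl; apply/lee_addgt0Pr => _/posnumP[e].
pose r : R := Num.sqrt (e%:num / 2).
have r0 : 0 < r by rewrite sqrtr_gt0.
have r2 : 2 * r ^+ 2 = e%:num by rewrite sqr_sqrtr// mulrC divfK.
have mc d' : ell1 d' -> measurable_fun D (cosser d').
  by move=> /continuous_cosser cd'; apply: measurable_funTS; exact: continuous_measurable_fun.
have [n _ /(_ n (leqnn n)) dn] := cosser_approx dl r0.
apply: le_trans (int_sqr_dist_le (mc _ dl) (mc _ (ell1_trunc d n)) (fun x _ => dn x)) _.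
rewrite r2 leeD2r// lee_wpmul2l// (_ : \int[mu]_(x in D) _ = (\sum_(0 <= i < n) d i ^+ 2)%:E)%E; last first.
  have Lt : L2 (cosser (trunc d n)) by apply: L2_continuous; exact: continuous_trunc.
  have Lh i : L2 (@hbasis R i) by apply: L2_continuous; exact: continuous_hbasis.
  have it := L2_integrableM Lt Lt.
  transitivity ((inner (cosser (trunc d n)) (cosser (trunc d n)))%:E).
    rewrite /inner /Rintegral fineK; last exact: integrable_fin_num it.
    by apply: eq_integral => x _; rewrite expr2.
  congr _%:E; transitivity (inner (cosser (trunc d n)) (fun x => \sum_(0 <= i < n) d i * hbasis i.+1 x)).
    by congr inner; apply/funext => x; exact: cosser_trunc.
  rewrite inner_sum//; last by move=> i; exact: (L2Z (d i) (Lh i.+1)).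
  apply: eq_big_nat => i /andP[_ ni]; rewrite innerZ// expr2; congr (_ * _).
  transitivity (inner (@hbasis R i.+1) (fun x => \sum_(0 <= j < n) d j * hbasis j.+1 x)).
    by rewrite innerC; congr inner; apply/funext => x; exact: cosser_trunc.
  rewrite inner_sum//; last by move=> j; exact: (L2Z (d j) (Lh j.+1)).
  rewrite (bigD1_seq i) ?mem_index_iota ?iota_uniq//= big1 ?addr0.
    by rewrite [LHS](innerZ (d i) (Lh i.+1) (Lh i.+1)) (inner_trig R i i).1 eqxx mulr1.
  move=> j ji; rewrite [LHS](innerZ (d j) (Lh i.+1) (Lh j.+1)) (inner_trig R i j).1 eq_sym.
  by rewrite (negbTE ji) mulr0.
rewrite -sumEFin; apply: nneseries_lim_ge => i _ _; rewrite lee_fin sqr_ge0//.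
Qed.

(** Measurability is asked of [c] only: [k] will be the error of the solution map. The integrals are
    compared off the empty set, since that comparison does without the measurability of the smaller
    function. *)
Lemma L2norm_le (k c : R -> R) (C S : R) : 0 <= C -> measurable_fun D c ->
  (forall x, D x -> `|k x| <= C * `|c x|) ->
  (\int[mu]_(x in D) (c x ^+ 2)%:E <= (S ^+ 2)%:E)%E -> 0 <= S ->
  (L2norm k <= (C * S)%:E)%E.
Proof.
move=> C0 mc kc cS S0; rewrite L2normE.
have CS : (\int[mu]_(x in D) (k x ^+ 2)%:E <= ((C * S) ^+ 2)%:E)%E.
  apply: (@le_trans _ _ (\int[mu]_(x in D) ((C ^+ 2)%:E * (c x ^+ 2)%:E))%E); last first.
    rewrite ge0_integralZl//.
    - by rewrite exprMn (EFinM (C ^+ 2)) lee_wpmul2l// lee_fin sqr_ge0.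
    - by apply/measurable_EFinP; exact: measurable_funX.
    - by move=> x _; rewrite lee_fin sqr_ge0.
    - by rewrite lee_fin sqr_ge0.
  rewrite integral_mkcond [leRHS]integral_mkcond.
  apply: (ge0_le_integral_off_null measurable0 (measure0 mu)).
  - by move=> x; rewrite patchE; case: ifP; rewrite ?lee_fin ?sqr_ge0.
  - by move=> x; rewrite patchE; case: ifP => // _; apply: mule_ge0; rewrite lee_fin sqr_ge0.
  move=> x _; rewrite !patchE; case: ifP => // /set_mem Dx.
  rewrite -EFinM lee_fin -exprMn -[leLHS]real_normK ?num_real// -[leRHS]real_normK ?num_real//.
  by rewrite ler_sqr ?nnegrE ?normr_ge0// normrM (ger0_norm C0) kc.
have CS0 : 0 <= C * S by rewrite mulr_ge0.
rewrite (_ : (C * S)%:E = (((C * S) ^+ 2)%:E `^ 2^-1)%E).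
  apply: gt0_ler_poweR CS.
  - by rewrite invr_ge0.
  - by rewrite in_itv/= leey andbT int_sqr_ge0.
  - by rewrite in_itv/= leey andbT lee_fin sqr_ge0.
by rewrite poweR_EFin powR12_sqrt ?sqr_ge0// sqrtr_sqr ger0_norm.
Qed.

(** Substituting Hx = f V - a V0 turns the error into (f (V - v) + a (v0 - V0)) / v. The closeness
    of [v] to [V] gives v >= m/2, and the equation itself bounds |f| by (HM + |a| |V0|) / m. *)
Lemma emap_error (Hx a v0 V0 v V f m HM : R) : 0 < m -> m <= V ->
  `|v - V| <= m / 2 -> f * V = Hx + a * V0 -> `|Hx| <= HM ->
  `|(Hx + a * v0) / v - f| <=
    (HM + `|a| * `|V0|) / m * (2 / m) * `|v - V| + `|a| * (2 / m) * `|v0 - V0|.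
Proof.
move=> m0 mV vV fV HxM.
have V0' : 0 < V by exact: lt_le_trans mV.
have m20 : 0 < m / 2 by rewrite divr_gt0.
have v0' : m / 2 <= v.
  have := ler_norm (V - v); rewrite distrC; lra.
have vp : 0 < v by exact: lt_le_trans v0'.
have vinv : v^-1 <= 2 / m by rewrite -[2 / m]invf_div lef_pV2 ?posrE.
have fb : `|f| <= (HM + `|a| * `|V0|) / m.
  rewrite ler_pdivlMr//; apply: (@le_trans _ _ (`|f| * V)); first by rewrite ler_wpM2l.
  rewrite -[X in _ * X](gtr0_norm V0') -normrM fV (le_trans (ler_normD _ _))//.
  by rewrite normrM lerD2r.
rewrite (_ : _ - f = (f * (V - v) + a * (v0 - V0)) * v^-1); last first.
  have -> : Hx = f * V - a * V0 by rewrite fV addrK.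
  by field; rewrite gt_eqF.
rewrite normrM [X in _ * X]gtr0_norm ?invr_gt0//.
apply: (@le_trans _ _ (`|f * (V - v) + a * (v0 - V0)| * (2 / m))); first by rewrite ler_wpM2l.
have m2' : 0 <= 2 / m by rewrite divr_ge0// ltW.
rewrite [X in _ <= X + _]mulrAC [X in _ <= _ + X]mulrAC -mulrDl ler_wpM2r//.
apply: (le_trans (ler_normD _ _)); rewrite !normrM distrC lerD// ler_wpM2r//.
Qed.

End norm_bounds.

(** * Contraction *)

Lemma markov_ge0 d (T : measurableType d) (R : realType) (m : {measure set T -> \bar R})
    (U : T -> \bar R) (eta : R) : 0 < eta -> measurable_fun setT U ->
  (forall x, 0 <= U x)%E ->
  (m [set x | eta%:E <= U x] <= (eta^-1)%:E * \int[m]_x U x)%E.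
Proof.
move=> eta0 mU U0.
have mA : measurable [set x | (eta%:E <= U x)%E].
  by rewrite -[X in measurable X]setTI; exact: emeasurable_fun_c_infty.
rewrite -(@mul1e _ (m _)) -(mulVf (lt0r_neq0 eta0)) EFinM -muleA lee_wpmul2l//.
  by rewrite lee_fin invr_ge0 ltW.
rewrite -integral_cst//; apply: (@le_trans _ _ (\int[m]_(x in [set x | (eta%:E <= U x)%E]) U x)%E).
  apply: ge0_le_integral => //; first by move=> x _; rewrite lee_fin ltW.
  exact: measurable_funTS.
exact: ge0_subset_integral.
Qed.

Section contraction.
Context (R : realType) (alpha beta : R) d (Omega : measurableType d)
  (P : probability Omega R) (W : L2fun R -> Omega -> R)
  (Pi : probability (Rprod nat R) R)
  (Q : nat -> R.-pker Rprod (L2fun R) R ~> Rprod nat R).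
Context (h g f0 u0 : R -> R) (theta0 : Rprod nat R) (delta delta0 c K : R)
  (norm : (R -> R) -> \bar R).
Let gamma := Num.min alpha beta.
Let e i : L2fun R := exist _ _ (@L2_sinb R i).
Let Y n w := obs (@signal R) (noise_sd R n) theta0 (W ^~ w).
(** Squared distance to the truth in the scale. It is used at index [delta] with the fixed radius
    [c], to keep v positive, and at index [delta0] with a shrinking radius, for the rate:
    [delta0 = delta] for the uniform norm and 0 for the L2 norm. *)
Let Z del (theta : Rprod nat R) : \bar R :=
  (\sum_(i <oo) ((i.+1%:R `^ (2 * del)) * (theta i - theta0 i) ^+ 2)%:E)%E.
Let rate del (n : nat) : R := n%:R `^ (- ((gamma - del) / (1 + 2 * alpha + 2))).

Hypothesis hW : white_noise P W.
Hypothesis hPi : is_prior alpha Pi.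
Hypothesis hQ : forall n, (0 < n)%N -> is_posterior P W g Pi n (Q n).
Hypothesis gamma12 : 1 / 2 < gamma.
Hypothesis theta0_smooth :
  (\sum_(i <oo) ((i.+1%:R `^ (2 * beta)) * theta0 i ^+ 2)%:E < +oo)%E.
Hypothesis theta0_sum : ell1 theta0.
Hypothesis shift_true : forall n w, shift_obs g (observe W n u0 w) = Y n w.
Hypothesis c0 : 0 < c.
Hypothesis K0 : 0 < K.
Hypothesis delta_ge0 : 0 <= delta.
Hypothesis delta_lt : delta < gamma.
Hypothesis delta0_ge0 : 0 <= delta0.
Hypothesis delta0_lt : delta0 < gamma.
Hypothesis norm_le : forall (theta : Rprod nat R) rho, 0 < rho ->
  (Z delta theta < (c ^+ 2)%:E)%E -> (Z delta0 theta < (rho ^+ 2)%:E)%E ->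
  (norm (emap h (f0 0%R) (vfun g theta) \- f0)%R <= (K * rho)%:E)%E.

Let alpha12 : 1 / 2 < alpha.
Proof. by apply: lt_le_trans gamma12 _; rewrite ge_min lexx. Qed.

Let Z_ge0 del theta : (0 <= Z del theta)%E.
Proof. by apply: nneseries_ge0 => i _ _; rewrite lee_fin mulr_ge0 ?powR_ge0 ?sqr_ge0. Qed.

Let mZ del : measurable_fun setT (Z del).
Proof.
apply: (measurable_nneseries_coord (f := fun i t => (i.+1%:R `^ (2 * del)) * (t - theta0 i) ^+ 2)).
  by move=> i; apply: measurable_funM => //; apply: measurable_funX; exact: measurable_funB.
by move=> i t; rewrite mulr_ge0 ?powR_ge0 ?sqr_ge0.
Qed.

Let mY n : measurable_fun setT (Y n).
Proof.
have mp : measurable_fun setT (fun w => (theta0, W ^~ w : Rprod (L2fun R) R)).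
  by apply: measurable_fun_pair => //; exact: white_noise_measurableT hW.
exact: (measurableT_comp (measurable_obs (noise_sd R n) (@measurable_signal R)) mp).
Qed.

Let mQZ n del : measurable_fun setT (fun w => \int[Q n (Y n w)]_theta Z del theta)%E.
Proof.
have mi : measurable_fun setT (fun y => \int[Q n y]_theta Z del theta)%E.
  apply: (@measurable_fun_integral_kernel _ _ _ _ _ (Q n)) => // U mU.
  exact: measurable_kernel.
exact: measurableT_comp mi (mY n).
Qed.

Lemma posterior_rate del : 0 <= del -> del < gamma -> exists2 C : R, 0 < C &
  forall n, (0 < n)%N ->
    (\int[P]_w \int[Q n (Y n w)]_theta Z del theta <= (C * rate del n ^+ 2)%:E)%E.
Proof.
move=> del0 delg; have [indPi lawPi] := hPi.
have ga : gamma <= alpha by rewrite /gamma ge_min lexx.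
have gb : gamma <= beta by rewrite /gamma ge_min lexx orbT.
have [C C0 HC] := risk_rate del0 delg ga gb theta0_smooth.
have L0 : 0 < 4 + 6 * normal_moment2 R by rewrite ltr_pwDl// mulr_ge0// normal_moment2_ge0.
exists ((4 + 6 * normal_moment2 R) * C); first by rewrite mulr_gt0.
move=> n n0; have PiS := prior_summable alpha12 lawPi.
apply: le_trans (posterior_risk (e := e) (kappa := @sing_val R) hW indPi lawPi
  (prior_sd_gt0 alpha) (noise_sd_gt0 R n0) _ (@measurable_signal R)
  (@measurable_summable_set R) PiS _ _ _ _ _ theta0_sum _) _.
- by move=> i; rewrite /= (inner_trig R i i).2 eqxx.
- by move=> theta i t; exact: summable_upd.
- by move=> theta i t phi; exact: signal_upd.
- by move=> theta i Stheta; rewrite /signal mem_set// inner_sinb_Kop.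
- by move=> theta1 theta; exact: signal_diff.
- by move=> A B mA mB; exact: (posterior_signal hW (hQ n0) PiS mA mB).
- by move=> i; exact: powR_ge0.
rewrite -mulrA EFinM lee_wpmul2l ?lee_fin ?(ltW L0)//; exact: HC.
Qed.

Let far M (eps : nat -> R) n : set (Rprod nat R) :=
  [set theta | ((M n * eps n)%:E <= norm (emap h (f0 0%R) (vfun g theta) \- f0)%R)%E].

Let mlev del (r : R) : measurable [set theta | (r%:E <= Z del theta)%E].
Proof. by rewrite -[X in measurable X]setTI; exact: emeasurable_fun_c_infty. Qed.

Let far_le M n w : (0 < n)%N -> 0 < M n ->
  (mu_ext (Q n (Y n w)) (far M (rate delta0) n) <=
   ((c ^+ 2)^-1)%:E * \int[Q n (Y n w)]_theta Z delta theta +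
   (((M n * rate delta0 n / (2 * K)) ^+ 2)^-1)%:E * \int[Q n (Y n w)]_theta Z delta0 theta)%E.
Proof.
(* For this [rho], [norm_le] yields half of the threshold that defines [far], so a far parameter
   violates one of the two constraints. *)
move=> n0 M0; set rho := M n * rate delta0 n / (2 * K).
have rate0 : 0 < rate delta0 n by rewrite powR_gt0// ltr0n.
have rho0 : 0 < rho by rewrite divr_gt0 ?mulr_gt0.
pose A1 := [set theta | ((c ^+ 2)%:E <= Z delta theta)%E].
pose A2 := [set theta | ((rho ^+ 2)%:E <= Z delta0 theta)%E].
have sub : far M (rate delta0) n `<=` A1 `|` A2.
  move=> theta /= ft; rewrite /A1 /A2 /=; case: leP => [|lt1]; first by left.
  case: leP => [|lt2]; first by right.
  have := le_trans ft (norm_le rho0 lt1 lt2); rewrite lee_fin leNgt => /negP[].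
  rewrite /rho (_ : K * _ = M n * rate delta0 n / 2); last by field; rewrite gt_eqF.
  by rewrite gtr_pMr ?mulr_gt0// invf_lt1// ltr1n.
apply: (le_trans (@le_mu_ext _ _ _ (Q n (Y n w)) _ _ sub)).
rewrite measurable_mu_extE; last by apply: measurableU; exact: mlev.
apply: (@le_trans _ _ (Q n (Y n w) A1 + Q n (Y n w) A2)%E).
  by apply: measureU2; exact: mlev.
by apply: leeD; apply: markov_ge0 => //; rewrite exprn_gt0.
Qed.

Lemma rate_contraction : contraction_rate P W h g f0 u0 Q norm (rate delta0).
Proof.
move=> M Moo eta eta0 /=.
have [C1 C10 HC1] := posterior_rate delta_ge0 delta_lt.
have [C2 C20 HC2] := posterior_rate delta0_ge0 delta0_lt.
pose a1 := eta^-1 * ((c ^+ 2)^-1 * C1).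
pose a2 := eta^-1 * ((2 * K) ^+ 2 * C2).
(* The first term comes from the fixed radius [c] and vanishes with the rate; in the second the rate
   cancels against the one in the radius, which leaves the inverse square of [M n]. *)
pose b n := a1 * rate delta n ^+ 2 + a2 * ((M n)^-1) ^+ 2.
have M0 : \forall n \near \oo, 0 < M n by exact: (cvgryPgt M).1 Moo 0.
have ub : \forall n \near \oo, (0 <= mu_ext P [set w | (eta%:E <=
      mu_ext (Q n (shift_obs g (observe W n u0 w))) (far M (rate delta0) n))%E] <= (b n)%:E)%E.
  near=> n; rewrite mu_ext_ge0//=.
  have n0 : (0 < n)%N by near: n; exists 1%N.
  have Mn0 : 0 < M n by near: n.
  have rate0 : 0 < rate delta0 n by rewrite powR_gt0// ltr0n.
  set k1 := (c ^+ 2)^-1; set k2 := ((M n * rate delta0 n / (2 * K)) ^+ 2)^-1.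
  have k10 : 0 <= k1 by rewrite invr_ge0 sqr_ge0.
  have k20 : 0 <= k2 by rewrite invr_ge0 sqr_ge0.
  pose U w : \bar R := (k1%:E * \int[Q n (Y n w)]_theta Z delta theta +
    k2%:E * \int[Q n (Y n w)]_theta Z delta0 theta)%E.
  have I0 del w : (0 <= \int[Q n (Y n w)]_theta Z del theta)%E by apply: integral_ge0.
  have IZ del (k : R) : 0 <= k ->
      (\int[P]_w (k%:E * \int[Q n (Y n w)]_theta Z del theta) =
       k%:E * \int[P]_w \int[Q n (Y n w)]_theta Z del theta)%E.
    move=> k_ge0; apply: ge0_integralZl; [exact: measurableT|exact: mQZ| |by rewrite lee_fin].
    by move=> w _; exact: I0.
  have mU : measurable_fun setT U.
    by apply: emeasurable_funD; apply: measurable_funeM; exact: mQZ.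
  have U0 w : (0 <= U w)%E by apply: adde_ge0; apply: mule_ge0 => //; rewrite lee_fin.
  (* Markov's inequality is applied to [U], a measurable upper bound of the posterior outer measure
     of the far set. *)
  apply: (@le_trans _ _ (P [set w | (eta%:E <= U w)%E])).
    rewrite -measurable_mu_extE; last first.
      by rewrite -[X in measurable X]setTI; exact: emeasurable_fun_c_infty.
    apply: le_mu_ext => w /= etaw; apply: (le_trans etaw).
    by rewrite shift_true; exact: far_le.
  apply: (le_trans (@markov_ge0 _ _ _ P U eta eta0 mU U0)).
  have IU : (\int[P]_w U w = k1%:E * \int[P]_w \int[Q n (Y n w)]_theta Z delta theta +
      k2%:E * \int[P]_w \int[Q n (Y n w)]_theta Z delta0 theta)%E.
    transitivity (\int[P]_w (k1%:E * \int[Q n (Y n w)]_theta Z delta theta) +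
        \int[P]_w (k2%:E * \int[Q n (Y n w)]_theta Z delta0 theta))%E.
      apply: ge0_integralD; [exact: measurableT| | | |].
      - by move=> w _; apply: mule_ge0; [rewrite lee_fin|exact: I0].
      - by apply: measurable_funeM; exact: mQZ.
      - by move=> w _; apply: mule_ge0; [rewrite lee_fin|exact: I0].
      - by apply: measurable_funeM; exact: mQZ.
    by congr (_ + _)%E; [exact: (IZ delta k1 k10)|exact: (IZ delta0 k2 k20)].
  apply: (@le_trans _ _ ((eta^-1 * (k1 * (C1 * rate delta n ^+ 2) + k2 * (C2 * rate delta0 n ^+ 2)))%:E)).
    rewrite (EFinM eta^-1) EFinD (EFinM k1) (EFinM k2) IU.
    apply: lee_wpmul2l; first by rewrite lee_fin invr_ge0 ltW.
    by apply: leeD; (apply: lee_wpmul2l; first by rewrite lee_fin); [exact: HC1|exact: HC2].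
  rewrite lee_fin le_eqVlt; apply/orP; left; apply/eqP.
  rewrite /b /a1 /a2 /k1 /k2; move: (rate delta0 n) rate0 (rate delta n) => x x0 y.
  by field; rewrite !gt_eqF.
have b0 : b n @[n --> \oo] --> 0.
  have r0 : rate delta n @[n --> \oo] --> 0.
    pose s := (gamma - delta) / (1 + 2 * alpha + 2).
    have s0 : 0 < s by rewrite divr_gt0 ?subr_gt0//; have := alpha12; lra.
    apply/cvgrPdist_lt => x x0; near=> n.
    have n0 : (0 < n)%N by near: n; exists 1%N.
    have xn : x^-1 `^ s^-1 < n%:R by near: n; exact: nbhs_infty_gtr.
    rewrite sub0r normrN ger0_norm ?powR_ge0// /rate -/s powRN -[x]invrK.
    rewrite ltf_pV2 ?posrE ?powR_gt0 ?invr_gt0 ?ltr0n//.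
    have -> : x^-1 = (x^-1 `^ s^-1) `^ s.
      by rewrite -powRrM mulVf ?gt_eqF// powRr1// invr_ge0 ltW.
    by apply: gt0_ltr_powR => //; rewrite nnegrE ?powR_ge0.
  have i0 : (M n)^-1 @[n --> \oo] --> 0.
    apply/gtr0_cvgV0 => //.
  have -> : 0 = a1 * 0 ^+ 2 + a2 * 0 ^+ 2 :> R by rewrite expr0n !mulr0 addr0.
  apply: cvgD; (apply: cvgM; first exact: cvg_cst).
    exact: (cvgM r0 r0).
  exact: (cvgM i0 i0).
apply: (squeeze_cvge ub); first exact: cvg_cst.
by apply: cvg_EFin => //; exact: nearW.
Unshelve. all: by end_near. Qed.

End contraction.

(** * Error of the solution map in terms of the coefficients, and conclusion *)

Section solution_map_error.
Context (R : realType) (h g f0 : R -> R) (theta0 : Rprod nat R) (m HM : R).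
Local Notation mu := (@lebesgue_measure R).
Local Notation D := (`]0, 1[%classic : set R).
Hypothesis theta0_sum : ell1 theta0.
Hypothesis m0 : 0 < m.
Hypothesis m_le : forall x, D x -> m <= vfun g theta0 x.
Hypothesis f0E : forall x, D x ->
  f0 x * vfun g theta0 x = primitive0 h x + f0 0 * vfun g theta0 0.
Hypothesis H_le : forall x, D x -> `|primitive0 h x| <= HM.

(** The coefficients in [emap_error]: [lip1] for the error at the point considered and [lip2] for
    the error at 0, which disappears when [f0 0] is 0. *)
Definition lip1 := (HM + `|f0 0| * `|vfun g theta0 0|) / m * (2 / m).
Definition lip2 := `|f0 0| * (2 / m).

Let HM0 : 0 <= HM.
Proof.
have D2 : D (2^-1) by rewrite /= in_itv/=; apply/andP; split; lra.
exact: le_trans (normr_ge0 _) (H_le D2).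
Qed.

Lemma lip1_ge0 : 0 <= lip1.
Proof.
by apply: mulr_ge0; apply: divr_ge0; rewrite ?(ltW m0)// addr_ge0// mulr_ge0.
Qed.

Lemma lip2_ge0 : 0 <= lip2.
Proof. by apply: mulr_ge0 => //; apply: divr_ge0; rewrite ?(ltW m0). Qed.

Section near_truth.
Context (theta : Rprod nat R) (s : R).
Let err i := theta i - theta0 i.
Hypothesis err_le : (\sum_(i <oo) (`|err i|)%:E <= s%:E)%E.

Lemma ell1_err : ell1 err.
Proof. exact: le_lt_trans err_le (ltry _). Qed.

Lemma emap_dist x : D x -> Num.sqrt 2 * s <= m / 2 ->
  `|emap h (f0 0) (vfun g theta) x - f0 x| <= lip1 * `|cosser err x| + lip2 * `|cosser err 0|.
Proof.
move=> Dx sm; have theta_sum : ell1 theta.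
  have := ell1D ell1_err theta0_sum; congr ell1.
  by apply/funext => i; rewrite /err subrK.
have vV y : vfun g theta y - vfun g theta0 y = cosser err y.
  by rewrite !vfunE cosserB//; ring.
rewrite -!vV /emap; apply: emap_error => //.
- exact: m_le.
- by rewrite vV (le_trans (norm_cosser_le _ err_le)).
- exact: f0E.
- exact: H_le.
Qed.

Lemma supnorm_emap_dist : Num.sqrt 2 * s <= m / 2 ->
  (supnorm (emap h (f0 0%R) (vfun g theta) \- f0)%R <=
   ((lip1 + lip2) * (Num.sqrt 2 * s))%:E)%E.
Proof.
move=> sm; apply: ge_ereal_sup => _ [x Dx <-]; rewrite lee_fin.
apply: (le_trans (emap_dist Dx sm)); rewrite mulrDl lerD//.
  by rewrite ler_wpM2l ?lip1_ge0// norm_cosser_le.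
by rewrite ler_wpM2l ?lip2_ge0// norm_cosser_le.
Qed.

Lemma L2norm_emap_dist r : f0 0 = 0 -> Num.sqrt 2 * s <= m / 2 -> 0 <= r ->
  (\sum_(i <oo) (err i ^+ 2)%:E <= (r ^+ 2)%:E)%E ->
  (L2norm (emap h (f0 0%R) (vfun g theta) \- f0)%R <= (lip1 * (Num.sqrt 2 * r))%:E)%E.
Proof.
move=> f00 sm r0 errr; apply: (@L2norm_le _ _ (cosser err)).
- exact: lip1_ge0.
- by apply: measurable_funTS; apply: continuous_measurable_fun; exact: continuous_cosser ell1_err.
- by move=> x Dx; have := emap_dist Dx sm; rewrite /lip2 f00 normr0 !mul0r addr0.
- apply: (le_trans (int_sqr_cosser_le ell1_err)).
  by rewrite exprMn sqr_sqrtr// EFinM lee_wpmul2l.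
- by rewrite mulr_ge0// sqrtr_ge0.
Qed.

End near_truth.
End solution_map_error.

Lemma norm_le_fine_supnorm (R : realType) (f : R -> R) : (supnorm f < +oo)%E ->
  forall x, x \in `]0, 1[ -> `|f x| <= fine (supnorm f).
Proof.
move=> foo x Dx; have fx : ((`|f x|)%:E <= supnorm f)%E by apply: ereal_sup_ubound; exists x.
rewrite -lee_fin fineK// ge0_fin_numE//; apply: le_trans fx.
by rewrite lee_fin.
Qed.

(** A set without an infimum has [inf] equal to 0 by convention, so a positive value certifies a
    lower bound. *)
Lemma inf_gt0_le (R : realType) (A : set R) : 0 < inf A -> forall x, A x -> inf A <= x.
Proof.
move=> A0 x Ax; apply: ge_inf => //; apply: contrapT => nA.
by move: A0; rewrite inf_out ?ltxx// => -[_].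
Qed.

Theorem theorem6p1 (R : realType) (h g f0 u0 : R -> R) (alpha beta : R)
    (d : measure_display) (Omega : measurableType d) (P : probability Omega R)
    (W : L2fun R -> Omega -> R) (Pi : probability (Rprod nat R) R)
    (Q : nat -> R.-pker Rprod (L2fun R) R ~> Rprod nat R)
    (hW : white_noise P W)
    (hPi : is_prior alpha Pi)
    (hQ : forall n, (0 < n)%N -> is_posterior P W g Pi n (Q n))
    (h_int : forall x : R, x \in `]0, 1[ ->
       lebesgue_measure.-integrable `]0, x[ (EFin \o h))
    (H_bounded : (supnorm (primitive0 h) < +oo)%E)
    (hf0 : darcy h g f0 u0)
    (hbeta : 1 / 2 < beta)
    (u0_smooth : in_scale beta (derive1 u0))
    (u0_pos : 0 < inf [set derive1 u0 x | x in `]0, 1[]) :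
  (forall delta : R, 1 / 2 < delta -> delta < Num.min alpha beta ->
     contraction_rate P W h g f0 u0 Q (@supnorm R)
       (fun n => n%:R `^ (- ((Num.min alpha beta - delta)
                              / (1 + 2 * alpha + 2))))) /\
  (f0 0 = 0 -> 1 / 2 < Num.min alpha beta ->
     contraction_rate P W h g f0 u0 Q (@L2norm R)
       (fun n => n%:R `^ (- (Num.min alpha beta / (1 + 2 * alpha + 2))))).
Proof.
have cu x : x \in `]0, 1[ -> {for x, continuous (derive1 u0)}.
  by move=> Dx; apply: differentiable_continuous; apply/derivable1_diffP; exact: (darcy_ddu hf0).
have [a [d0 [d0oo d0l u0E]]] := scale_cosser hbeta u0_smooth cu.
(* The continuous extension of u0' is [vfun g d0]: the true coefficients are a parameter of the
   model. *)
have vE := VE hf0 d0l u0E.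
set m := inf _ in u0_pos.
have m_le x : x \in `]0, 1[ -> m <= vfun g d0 x.
  by move=> Dx; rewrite -vE /= -u0E//; apply: (inf_gt0_le u0_pos); exists x.
have f0E x : x \in `]0, 1[ -> f0 x * vfun g d0 x = primitive0 h x + f0 0 * vfun g d0 0.
  by move=> Dx; rewrite -vE; exact: (darcy_solution hf0 d0l u0E h_int).
have H_le := norm_le_fine_supnorm H_bounded.
have shift_true n w := shift_obs_true hf0 d0l u0E W n w.
have s2 : 0 < Num.sqrt 2 :> R by rewrite sqrtr_gt0.
pose L1 := lip1 g f0 d0 m (fine (supnorm (primitive0 h))).
have L10 : 0 <= L1 by apply: (lip1_ge0 (h := h)); [exact: u0_pos|exact: H_le].
have L20 : 0 <= lip2 f0 m by exact: lip2_ge0.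
split=> [delta delta12 delta_lt|f00 gamma12].
  have [C C0 HC] := @l1_le_weighted_l2 R (2 * delta) ltac:(lra).
  have gamma12 : 1 / 2 < Num.min alpha beta by exact: lt_trans delta_lt.
  (* The radius at which the weighted norm forces a uniform distance of at most m/2 from u0', the
     margin that [emap_error] requires. *)
  pose c := m / 2 / (Num.sqrt 2 * C).
  have c0 : 0 < c by rewrite divr_gt0 ?mulr_gt0// divr_gt0.
  (* The 1 added to the Lipschitz constant keeps it positive even if [L1] and [lip2] vanish. *)
  apply: (@rate_contraction R alpha beta d Omega P W Pi Q h g f0 u0 d0 delta delta
    c ((L1 + lip2 f0 m) * (Num.sqrt 2 * C) + 1)) => //.
  - by rewrite ltr_wpDl// mulr_ge0 ?addr_ge0// mulr_ge0 ?(ltW C0)// ltW.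
  - lra.
  - lra.
  move=> theta rho rho0 /ltW Zc /ltW Zrho.
  have err_c := HC (fun i => theta i - d0 i) _ c0 Zc.
  have err_rho := HC (fun i => theta i - d0 i) _ rho0 Zrho.
  (* The same l1 bound has to serve twice: through [c] for the positivity of v, through [rho] for
     the rate. *)
  pose s := Num.min (C * c) (C * rho).
  have err_s : (\sum_(i <oo) (`|theta i - d0 i|)%:E <= s%:E)%E.
    by rewrite /s /Num.min; case: ifP.
  have sm : Num.sqrt 2 * s <= m / 2.
    apply: (@le_trans _ _ (Num.sqrt 2 * (C * c))).
      by rewrite ler_wpM2l ?(ltW s2)// /s ge_min lexx.
    by rewrite /c mulrA [leLHS]mulrC divfK// gt_eqF// mulr_gt0.
  apply: (le_trans (supnorm_emap_dist d0l u0_pos m_le f0E H_le err_s sm)).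
  rewrite lee_fin -/L1.
  apply: (@le_trans _ _ ((L1 + lip2 f0 m) * (Num.sqrt 2 * C) * rho)).
    rewrite -[leRHS]mulrA; apply: ler_wpM2l; first exact: addr_ge0.
    rewrite -[leRHS]mulrA; apply: ler_wpM2l; first exact: ltW.
    by rewrite /s ge_min lexx orbT.
  by apply: ler_wpM2r; [exact: ltW|rewrite lerDl].
(* Here [delta] only keeps v positive and leaves no trace in the rate; the midpoint is one choice
   strictly between 1/2 and the smaller of alpha and beta. *)
pose delta := (1 / 2 + Num.min alpha beta) / 2.
have delta12 : 1 / 2 < delta by rewrite /delta; lra.
have delta_lt : delta < Num.min alpha beta by rewrite /delta; lra.
have [C C0 HC] := @l1_le_weighted_l2 R (2 * delta) ltac:(lra).
pose c := m / 2 / (Num.sqrt 2 * C).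
have c0 : 0 < c by rewrite divr_gt0 ?mulr_gt0// divr_gt0.
(* The L2 rate is the one of index [delta0 = 0], for which all weights are 1. *)
rewrite -[X in X / _]subr0.
apply: (@rate_contraction R alpha beta d Omega P W Pi Q h g f0 u0 d0 delta 0
  c (L1 * Num.sqrt 2 + 1)) => //.
- by rewrite ltr_wpDl// mulr_ge0// ltW.
- lra.
- lra.
move=> theta rho rho0 /ltW Zc /ltW Zrho.
have err_c := HC (fun i => theta i - d0 i) _ c0 Zc.
have sm : Num.sqrt 2 * (C * c) <= m / 2.
  by rewrite /c mulrA [leLHS]mulrC divfK// gt_eqF// mulr_gt0.
have err2 : (\sum_(i <oo) ((theta i - d0 i) ^+ 2)%:E <= (rho ^+ 2)%:E)%E.
  apply: le_trans Zrho; rewrite le_eqVlt; apply/orP; left; apply/eqP.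
  by apply: eq_eseriesr => i _; rewrite mulr0 powRr0 mul1r.
apply: (le_trans (L2norm_emap_dist d0l u0_pos m_le f0E H_le err_c f00 sm (ltW rho0) err2)).
rewrite lee_fin -/L1 mulrA; apply: ler_wpM2r; [exact: ltW|by rewrite lerDl].
Qed.
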